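(* Consider the $n\times n$ system $\frac{dY}{dz}=A(z,t)Y$, $A(z,t)=\sum_{j\ge0}A_j(t)z^{-j}$, with $A$ holomorphic for $|z|\ge N_0$, $t\in\mathcal U_{\epsilon_0}(0)\subset\mathbb C^n$, for which there is a holomorphic invertible $G_0(t)$ on $\mathcal U_{\epsilon_0}(0)$, $G_0(0)=I$, with $G_0(t)^{-1}A_0(t)G_0(t)=\Lambda(t)=\mathrm{diag}(u_1(t),\dots,u_n(t))$, $u_a(t)=u_a(0)+t_a$, and let $\epsilon_0=\delta_0$ with $0<\delta_0<\min_{i\ne j}\delta_{ij}$ (see context). Let $\widetilde\tau$ be admissible for $\Lambda(0)$, $\tau_\nu<\widetilde\tau<\tau_{\nu+1}$. Suppose that 1) every $F_j(t)$, $j\ge1$, is holomorphic in $\mathcal U_{\epsilon_0}(0)$; and 2) for any $\widetilde\tau$-cell $c$ and any $k\in\mathbb Z$, $Y_{\nu+k\mu}(z,t;\widetilde\tau,c)$ has analytic continuation in $t$ as a single-valued holomorphic function on the whole $\mathcal U_{\epsilon_0}(0)$ (this continuation is then independent of $c$ and is denoted $Y_{\nu+k\mu}(z,t)$). Let $\mathring Y_{\nu+k\mu}(z)$, $k\in\mathbb Z$, denote the unique fundamental solution of the system at $t=0$ of the form $$\mathring Y_{\nu+k\mu}(z)=\mathcal G_{\nu+k\mu}(z)z^{B_1(0)}e^{\Lambda z},\qquad \Lambda=\Lambda(0),$$ with asymptotics $$\mathcal G_{\nu+k\mu}(z)\sim I+\sum_{j=1}^\infty\mathring F_jz^{-j},\qquad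 z\to\infty,\ z\in\mathcal S_{\nu+k\mu},$$ corresponding to the particular choice $\mathring F_j=F_j(0)$, $j\ge1$. Then $$\mathcal G_{\nu+k\mu}(z,0)=\mathcal G_{\nu+k\mu}(z),\qquad Y_{\nu+k\mu}(z,0)=\mathring Y_{\nu+k\mu}(z),$$ where $\mathcal G_{\nu+k\mu}(z,t):=G_0(t)^{-1}Y_{\nu+k\mu}(z,t)z^{-B_1(t)}e^{-\Lambda(t)z}$.
   Context: Notation. $\mathcal R$ is the universal covering of $\mathbb C\setminus\{0\}$; $S(\alpha,\beta)=\{z\in\mathcal R:\alpha<\arg z<\beta\}$. $|t|=\max_i|t_i|$, $\mathcal U_\epsilon(0)=\{t\in\mathbb C^n:|t|\le\epsilon\}$. The $u_a(0)$ take distinct values $\lambda_1,\dots,\lambda_s$, ordered so that $A_0(0)=\Lambda(0)=\lambda_1I_{p_1}\oplus\cdots\oplus\lambda_sI_{p_s}$. $\Delta=\{t\in\mathcal U_{\epsilon_0}(0):u_a(t)=u_b(t)\text{ for some }a\ne b\}$. Formal solution. Set $\widehat A_k(t)=G_0(t)^{-1}A_k(t)G_0(t)$ and $B_1(t)=\mathrm{diag}(\widehat A_1(t))$ (diagonal part). For $t\notin\Delta$ there is a unique formal solution $G_0(t)\big(I+\sum_{k\ge1}F_k(t)z^{-k}\big)z^{B_1(t)}e^{\Lambda(t)z}$; the $F_k$ are holomorphic on $\mathcal U_{\epsilon_0}(0)\setminus\Delta$. Stokes rays of $\Lambda(t)$: rays $\{z\in\mathcal R:\Re[(u_a(t)-u_b(t))z]=0\}$,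 $u_a(t)\ne u_b(t)$. Those of $\Lambda(0)$ have directions labelled increasingly $\cdots<\tau_\sigma<\tau_{\sigma+1}<\cdots$, $\sigma\in\mathbb Z$, with $\tau_{\sigma+\mu}=\tau_\sigma+\pi$. $\widetilde\tau$ is admissible if it is none of the $\tau_\sigma$. $\mathcal S_\sigma=S(\tau_\sigma-\pi,\tau_{\sigma+1})$. (If $s=1$ there are no such rays, $\widetilde\tau$ is arbitrary, $\mathcal S_\sigma=\mathcal R$, and the indices $\nu+k\mu$ are mere labels for $k\in\mathbb Z$.) Radius: $\delta_{ij}=\frac12\min_{\rho\in\mathbb R}|\lambda_i-\lambda_j+\rho e^{i\widetilde\eta}|$, $\widetilde\eta=\frac{3\pi}2-\widetilde\tau$, $1\le i\neq j\le s$. Cells: $X(\widetilde\tau)$ is the set of $t\in\mathcal U_{\epsilon_0}(0)$ such that, for some $a\neq b$ with $u_a(t)\ne u_b(t)$, $\arg(u_a(t)-u_b(t))=\widetilde\eta$ mod $\pi$. A $\widetilde\tau$-cell is a connected component of $\mathcal U_{\epsilon_0}(0)\setminus(\Delta\cup X(\widetilde\tau))$. Sectors: for $t\notin X(\widetilde\tau)$, $\mathcal S_{\nu+k\mu}(t)$ is the open sector containing $S(\widetilde\tau-\pi+k\pi,\widetilde\tau+k\pi)$ and extending up to the nearest Stokes rays of $\Lambda(t)$ outside it (so $\mathcal S_{\nu+k\mu}(0)=\mathcal S_{\nu+k\mu}$). Solutions: for a cell $c$, $Y_{\nu+k\mu}(z,t;\widetilde\tau,c)$, $t\in c$, is the unique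 fundamental solution, holomorphic in $t\in c$, such that $G_0(t)^{-1}Y_{\nu+k\mu}e^{-\Lambda(t)z}z^{-B_1(t)}\sim I+\sum_{j\ge1}F_j(t)z^{-j}$ as $z\to\infty$ in $\mathcal S_{\nu+k\mu}(t)$. Asymptotics in an open sector means in every proper closed subsector. *)

(* Defs.v *)
From HB Require Import structures.
From mathcomp Require Import all_boot all_order all_algebra complex.
From mathcomp Require Import all_classical all_reals all_analysis.

Set Implicit Arguments.
Unset Strict Implicit.
Unset Printing Implicit Defensive.

Import Order.TTheory GRing.Theory Num.Theory numFieldNormedType.Exports.
Local Open Scope classical_set_scope.
Local Open Scope complex_scope.
Local Open Scope ring_scope.

(* The norm of a row vector or of a matrix is the maximum of the moduli of its
   entries; all norms have values in R[i]. *)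
HB.instance Definition _ (R : realType) := NormedModule.copy R[i] R[i]^o.

(* A function is holomorphic on an arbitrary set D when it is, on D, equal to a
   complex-differentiable function on some open neighbourhood of D. *)
Definition holomorphic_on (R : realType) (V W : normedModType R[i])
    (D : set V) (f : V -> W) : Prop :=
  exists (O : set V) (g : V -> W),
    [/\ open O, D `<=` O, (forall x, O x -> differentiable g x) &
        forall x, D x -> g x = f x].

Section UniversalCovering.
Variable R : realType.

Definition cexp (w : R[i]) : R[i] :=
  (expR (complex.Re w) * cos (complex.Im w))
  +i* (expR (complex.Re w) * sin (complex.Im w)).

(* e^{i theta} *)
Definition cis (theta : R) : R[i] := cexp (0 +i* theta).

(* A point of the universal covering of C \ {0} is represented by its logarithm
   l = ln |z| + i arg z, which is an arbitrary complex number; the covering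
   projection is then cexp. *)
Definition cover_abs (l : R[i]) : R := expR (complex.Re l).
Definition cover_arg (l : R[i]) : R := complex.Im l.
Definition cover_proj (l : R[i]) : R[i] := cexp l.

Definition outer_dom (N0 : R) : set R[i] := [set l | N0 <= cover_abs l].

Definition sector (alpha beta : R) : set R[i] :=
  [set l | alpha < cover_arg l /\ cover_arg l < beta].

Definition closed_sector (alpha beta : R) : set R[i] :=
  [set l | alpha <= cover_arg l /\ cover_arg l <= beta].

(* arg w = eta mod pi *)
Definition arg_mod_pi (w : R[i]) (eta : R) : Prop :=
  exists (m : int) (r : R), 0 < r /\ w = r%:C * cis (eta + m%:~R * pi).

End UniversalCovering.

Section Systems.
Variables (R : realType) (n : nat).
Implicit Types (u b t : 'rV[R[i]]_n) (l : R[i]).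

Definition diag_exp (d : 'rV[R[i]]_n) : 'M[R[i]]_n := diag_mx (map_mx (@cexp R) d).

(* z^{diag b} and e^{diag u z} at the point l of the covering *)
Definition zpow b l : 'M[R[i]]_n := diag_exp (l *: b).
Definition expz u l : 'M[R[i]]_n := diag_exp (cover_proj l *: u).

(* Y is a fundamental solution of dY/dz = A(z) Y on the part |z| >= N0 of the
   covering.  The limit of the difference quotient is the derivative with respect
   to the local coordinate z = cover_proj l; it is one-sided when |z| = N0. *)
Definition fundamental_solution (N0 : R) (A : R[i] -> 'M[R[i]]_n)
    (Y : R[i] -> 'M[R[i]]_n) : Prop :=
  forall l, outer_dom N0 l ->
    Y l \in unitmx /\
    ((cover_proj l' - cover_proj l)^-1 *: (Y l' - Y l))
       @[l' --> within (outer_dom N0) (dnbhs l)] --> A (cover_proj l) *m Y l.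

(* Formal series in 1/z: H stands for sum_k H_k z^{-k}. *)
Definition fser_mul (H K : nat -> 'M[R[i]]_n) (m : nat) : 'M[R[i]]_n :=
  \sum_(j < m.+1) H j *m K (m - j)%N.

Definition fser_deriv (H : nat -> 'M[R[i]]_n) (m : nat) : 'M[R[i]]_n :=
  if m is k.+1 then - (k%:R *: H k) else 0.

(* diag u + diag b z^{-1}, the logarithmic derivative of z^{diag b} e^{diag u z} *)
Definition fser_logder u b (m : nat) : 'M[R[i]]_n :=
  match m with 0%N => diag_mx u | 1%N => diag_mx b | _ => 0 end.

(* I + sum_{k>=1} F_k z^{-k}; the value of F at 0 is not used. *)
Definition fser_unit (F : nat -> 'M[R[i]]_n) (k : nat) : 'M[R[i]]_n :=
  if k is 0%N then 1%:M else F k.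

(* H z^{diag b} e^{diag u z} is a formal solution of dY/dz = (sum_j A_j z^{-j}) Y:
   H' + H (diag u + diag b / z) = A H coefficientwise. *)
Definition formal_solution (A H : nat -> 'M[R[i]]_n) u b : Prop :=
  forall m, fser_deriv H m + fser_mul H (fser_logder u b) m = fser_mul A H m.

(* B_1 is diag_mx of this row: the diagonal part of G0^{-1} A1 G0. *)
Definition formal_exponents (G0 A1 : 'M[R[i]]_n) : 'rV[R[i]]_n :=
  \row_a (invmx G0 *m A1 *m G0) a a.

(* G ~ sum_j F_j z^{-j} as z -> oo in the open sector S *)
Definition asymptotic_expansion (S : set R[i]) (G : R[i] -> 'M[R[i]]_n)
    (F : nat -> 'M[R[i]]_n) : Prop :=
  forall alpha beta : R, closed_sector alpha beta `<=` S ->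
  forall m : nat, exists K M : R, forall l,
    closed_sector alpha beta l -> M <= cover_abs l ->
    `| G l - \sum_(j < m) (cover_proj l) ^- j *: F j |
      <= (K / cover_abs l ^+ m)%:C.

Definition stokes_direction u : set R :=
  [set theta | exists a b : 'I_n,
     u 0 a != u 0 b /\ complex.Re ((u 0 a - u 0 b) * cis theta) = 0].

Definition admissible u (ttau : R) : Prop := ~ stokes_direction u ttau.

(* tau labels increasingly the directions of the Stokes rays of diag u *)
Definition stokes_labelling u (tau : int -> R) (mu : int) : Prop :=
  [/\ forall sigma sigma', sigma < sigma' -> tau sigma < tau sigma',
      range tau = stokes_direction u &
      forall sigma, tau (sigma + mu) = tau sigma + pi].

(* The sector S_sigma; the whole covering when there is only s = 1 eigenvalue. *)
Definition stokes_sector (s : nat) (tau : int -> R) (sigma : int) : set R[i] :=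
  if (s <= 1)%N then setT else sector (tau sigma - pi) (tau (sigma + 1)).

(* S(ttau - pi + k pi, ttau + k pi), extended on both sides up to the nearest
   Stokes rays of diag u outside it (without bound if there is no Stokes ray). *)
Definition extended_sector u (ttau : R) (k : int) : set R[i] :=
  let lo := ttau - pi + k%:~R * pi in
  let hi := ttau + k%:~R * pi in
  sector lo hi
  `|` [set l | hi <= cover_arg l /\
         forall theta, hi <= theta -> theta <= cover_arg l -> ~ stokes_direction u theta]
  `|` [set l | cover_arg l <= lo /\
         forall theta, cover_arg l <= theta -> theta <= lo -> ~ stokes_direction u theta].

Definition polydisc (eps : R) : set 'rV[R[i]]_n := [set t | `|t| <= eps%:C].

(* In the next three definitions the eigenvalues are u_a(t) = u0_a + t_a. *)
Definition coalescence_locus (u0 : 'rV[R[i]]_n) (eps : R) : set 'rV[R[i]]_n :=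
  polydisc eps `&` [set t | exists a b : 'I_n, a != b /\ (u0 + t) 0 a = (u0 + t) 0 b].

Definition crossing_locus (u0 : 'rV[R[i]]_n) (eps ttau : R) : set 'rV[R[i]]_n :=
  polydisc eps `&`
  [set t | exists a b : 'I_n, [/\ a != b, (u0 + t) 0 a != (u0 + t) 0 b &
     arg_mod_pi ((u0 + t) 0 a - (u0 + t) 0 b) (3 * pi / 2 - ttau)]].

Definition is_cell (u0 : 'rV[R[i]]_n) (eps ttau : R) (c : set 'rV[R[i]]_n) : Prop :=
  let W := polydisc eps `\`
             (coalescence_locus u0 eps `|` crossing_locus u0 eps ttau) in
  exists t, W t /\ c = connected_component W t.

(* G0^{-1} Y z^{-diag b} e^{-diag u z} *)
Definition reduced_solution (G0 : 'M[R[i]]_n) u b (Y : R[i] -> 'M[R[i]]_n) l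
    : 'M[R[i]]_n :=
  invmx G0 *m Y l *m zpow (- b) l *m expz (- u) l.

End Systems.

Section Radius.
Variables (R : realType) (s : nat).

(* delta_ij; the infimum over rho is a minimum *)
Definition half_line_dist (lam : 'I_s -> R[i]) (ttau : R) (i j : 'I_s) : R :=
  inf [set complex.Re `|lam i - lam j + rho%:C * cis (3 * pi / 2 - ttau)|
      | rho in [set: R]] / 2.

End Radius.

(* Main.v *)
Require Import Defs.
From HB Require Import structures.
From mathcomp Require Import all_boot all_order all_algebra complex.
From mathcomp Require Import all_classical all_reals all_analysis.
From mathcomp Require Import perm ring lra.
Import Order.TTheory GRing.Theory Num.Theory numFieldNormedType.Exports.
Local Open Scope classical_set_scope.
Local Open Scope complex_scope.
Local Open Scope ring_scope.
Set Implicit Arguments.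
Unset Strict Implicit.
Unset Printing Implicit Defensive.

(** Let hi = ttau + k pi and let t = x t0 run to 0 inside the cell c, x -> 0+
    (a cell is stable under scaling by x in ]0, 1]).  With P_m the formal
    solution G0 (I + F_1/z + ...) truncated at order m, put
      Q = z^{-B} P_m^{-1} Y e^{-Lambda z}.
    Then Q' = [Lambda, Q] + T Q with T = O(z^{-2}) uniformly in x for m large,
    because the F_j are holomorphic at t = 0.  On the line
    z = e^{i hi} (s - i N), s real, Q tends to I at both ends, for each x
    separately.  Integrating every entry from the end at which its exponential
    e^{(u_a - u_b) z} does not decay bounds Q - I uniformly in x, with no uniformity
    assumed of the asymptotics of Y: |(Q - I)_ab| is at most a constant times
    pi/2 - atan (s/N) or pi/2 + atan (s/N), according to the sign of
    Re ((u_a - u_b) e^{i hi}).  These bounds survive the limit x -> 0.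
    By Gronwall, Y(z, 0) = Yr(z) C for a constant matrix C, so that on the line
    e^{Lambda z} C e^{-Lambda z} is bounded at both ends and its (a, b) entry tends
    to delta_ab at one end whenever u_a(0) = u_b(0).  Hence C = I. *)

(** The obstacle is that the asymptotics of Y hold for each t separately, with constants that may
    blow up as t tends to 0, where eigenvalues coalesce. What stays under control is the defect of
    the truncated formal solution, because A, G0 and the F_j have limits at t = 0. The line is
    parallel to the boundary of the half plane hi - pi < arg z < hi for two reasons. On it Re ((u_a
    - u_b) z) is affine in s, so that each exponential is monotone in modulus. Its ends point in the
    directions hi - pi and hi, which lie inside all the sectors in play, since ttau is admissible
    and t avoids the crossing locus. The distance N of the line from the origin is free and is taken
    so large that the integral equation for Q is a contraction for all small x at once. Scaling t =
    x t0 serves the pairs with u_a(0) = u_b(0): there u_a(t) - u_b(t) = x (t0_a - t0_b) has a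
    constant argument, so that the same one of the two bounds holds for every x and passes to the
    limit. *)

Local Notation normc := Normc.normc.
Local Notation Re := complex.Re.
Local Notation Im := complex.Im.

(** * The complex modulus and exponential *)

Section ComplexModulus.
Variable R : realType.
Local Notation C := R[i].
Implicit Types (x y z w : C).

Lemma normr_normc x : `|x| = (normc x)%:C.
Proof. by []. Qed.

Lemma normc_ge0 x : 0 <= normc x.
Proof. by case: x => a b; exact: sqrtr_ge0. Qed.

Lemma normc_sqr x : normc x ^+ 2 = Re x ^+ 2 + Im x ^+ 2.
Proof. by case: x => a b; rewrite /= sqr_sqrtr// addr_ge0// sqr_ge0. Qed.

Lemma normc_eq0 x : (normc x == 0) = (x == 0).
Proof.
apply/eqP/eqP => [/Normc.eq0_normc //|->]; exact: Normc.normc0.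
Qed.

Lemma normc_real (a : R) : normc a%:C = `|a|.
Proof. by rewrite /= expr0n addr0 sqrtr_sqr. Qed.

Lemma Re_le_normc x : `|Re x| <= normc x.
Proof.
rewrite -[leLHS]ger0_norm// -[leRHS]ger0_norm ?normc_ge0// -ler_sqr ?nnegrE//.
by rewrite !real_normK ?num_real// normc_sqr lerDl sqr_ge0.
Qed.

Lemma Im_le_normc x : `|Im x| <= normc x.
Proof.
rewrite -[leLHS]ger0_norm// -[leRHS]ger0_norm ?normc_ge0// -ler_sqr ?nnegrE//.
by rewrite !real_normK ?num_real// normc_sqr lerDr sqr_ge0.
Qed.

Lemma normc_le_ReIm x : normc x <= `|Re x| + `|Im x|.
Proof.
rewrite -ler_sqr ?nnegrE ?normc_ge0 ?addr_ge0// normc_sqr sqrrD.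
by rewrite !real_normK ?num_real// addrAC lerDl mulrn_wge0// mulr_ge0.
Qed.

Lemma normcD x y : normc (x + y) <= normc x + normc y.
Proof. by rewrite -lecR rmorphD /= -!normr_normc ler_normD. Qed.

Lemma ReD x y : Re (x + y) = Re x + Re y.
Proof. by case: x y => [? ?] [? ?]. Qed.

Lemma ImD x y : Im (x + y) = Im x + Im y.
Proof. by case: x y => [? ?] [? ?]. Qed.

Lemma ReN x : Re (- x) = - Re x.
Proof. by case: x. Qed.

Lemma ImN x : Im (- x) = - Im x.
Proof. by case: x. Qed.

Lemma ReM x y : Re (x * y) = Re x * Re y - Im x * Im y.
Proof. by case: x y => [? ?] [? ?]. Qed.

Lemma ImM x y : Im (x * y) = Re x * Im y + Im x * Re y.
Proof. by case: x y => [? ?] [? ?]. Qed.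

Lemma normcB_sym x y : normc (x - y) = normc (y - x).
Proof. by rewrite -opprB normcN. Qed.

Lemma normc_sum (I : Type) (r : seq I) (P : pred I) (f : I -> C) :
  normc (\sum_(i <- r | P i) f i) <= \sum_(i <- r | P i) normc (f i).
Proof.
elim/big_ind2: _ => [|u a v c ua vc|//]; first by rewrite Normc.normc0.
exact: le_trans (normcD _ _) (lerD ua vc).
Qed.

Lemma normcX x k : normc (x ^+ k) = normc x ^+ k.
Proof.
elim: k => [|k IH]; first by rewrite !expr0 Normc.normc1.
by rewrite !exprS Normc.normcM IH.
Qed.

Lemma lenormcE (x : C) (e : R) : (`|x| <= e%:C) = (normc x <= e).
Proof. by rewrite normr_normc lecR. Qed.

Lemma eq0_normc_small x : (forall e, 0 < e -> normc x <= e) -> x = 0.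
Proof.
move=> h; apply/eqP; rewrite -normc_eq0 eq_le normc_ge0 andbT.
by apply/ler_addgt0Pr => e e0; rewrite add0r h.
Qed.

Lemma cexpD x y : cexp (x + y) = cexp x * cexp y.
Proof.
case: x y => [a b] [c d]; rewrite /cexp /= expRD cosD sinD.
by apply/eqP; rewrite eq_complex /=; apply/andP; split; apply/eqP; ring.
Qed.

Lemma cexp0 : cexp 0 = 1 :> C.
Proof. by rewrite /cexp /= expR0 cos0 sin0 mulr0 mulr1. Qed.

Lemma cexp_neq0 x : cexp x != 0.
Proof.
apply/eqP => h; have := cexpD x (- x); rewrite subrr cexp0 h mul0r => /eqP.
by rewrite oner_eq0.
Qed.

Lemma cexpN x : cexp (- x) = (cexp x)^-1.
Proof.
by apply: (mulfI (cexp_neq0 x)); rewrite -cexpD subrr cexp0 divff// cexp_neq0.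
Qed.

Lemma cexpMn x k : cexp (k%:R * x) = cexp x ^+ k.
Proof.
elim: k => [|k IH]; first by rewrite mul0r cexp0 expr0.
by rewrite -natr1 mulrDl mul1r cexpD IH exprSr.
Qed.

Lemma normc_cexp x : normc (cexp x) = expR (Re x).
Proof.
rewrite /cexp /= !exprMn -mulrDr cos2Dsin2 mulr1 sqrtr_sqr ger0_norm//.
Qed.

(** The modulus of cexp (x - y) gives equal real parts, and 0 is the only zero of sin in ]-1, 1[.
    Hence difference quotients in the coordinate z have nonzero denominators at nearby points of the
    covering. *)
Lemma cexp_small_inj x y : normc (x - y) < 1 -> cexp x = cexp y -> x = y.
Proof.
move=> xy1 e.
have : cexp (x - y) = 1 by rewrite cexpD e cexpN divff// cexp_neq0.
set w := x - y => ew.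
have Rew : Re w = 0.
  have := normc_cexp w; rewrite ew Normc.normc1 -expR0 => /esym.
  exact: expR_inj.
have [] : cexp w = 1 := ew; rewrite Rew expR0 !mul1r => cosw sinw.
have Imw : `|Im w| < 1 := le_lt_trans (Im_le_normc w) xy1.
have pi2 : 2 <= (pi : R) by exact: pi_ge2.
have Imw0 : Im w = 0.
  apply/eqP; case: (ltgtP (Im w) 0) => // h; exfalso.
  - have := @sin_gt0_pi R (- Im w); rewrite sinN sinw oppr0 ltxx => H.
    rewrite ltr0_norm// in Imw.
    suff: false by []; move: H.
    by apply=> //; apply/andP; split; lra.
  - have := @sin_gt0_pi R (Im w); rewrite sinw ltxx => H.
    rewrite gtr0_norm// in Imw.
    suff: false by []; move: H.
    by apply=> //; apply/andP; split; lra.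
apply/eqP; rewrite -subr_eq0 -/w; apply/eqP.
by case: w Rew Imw0 {ew sinw cosw Imw xy1} => a b /= -> ->.
Qed.

End ComplexModulus.

(** * Complex functions of a real variable *)

Section RealVariable.
Variable R : realType.
Local Notation C := R[i].
Implicit Types (f g : R -> C) (s : R) (c d e : C).

(** Real and imaginary parts are kept apart so that the real mean value and extreme value theorems
    apply. *)
Definition cderiv f s d :=
  is_derive s 1 (fun r => Re (f r)) (Re d) /\
  is_derive s 1 (fun r => Im (f r)) (Im d).

Lemma cderiv_eq f s d d' : cderiv f s d -> d = d' -> cderiv f s d'.
Proof. by move=> + <-. Qed.

Lemma cderiv_cst c s : cderiv (fun=> c) s 0.
Proof. by split; exact: is_derive_cst. Qed.

Lemma cderivD f g s d e :
  cderiv f s d -> cderiv g s e -> cderiv (fun r => f r + g r) s (d + e).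
Proof.
move=> [f1 f2] [g1 g2]; split.
  have -> : (fun r => Re (f r + g r)) = (fun r => Re (f r)) + (fun r => Re (g r)).
    by apply/funext => r; rewrite ReD.
  by rewrite ReD; exact: is_deriveD.
have -> : (fun r => Im (f r + g r)) = (fun r => Im (f r)) + (fun r => Im (g r)).
  by apply/funext => r; rewrite ImD.
by rewrite ImD; exact: is_deriveD.
Qed.

Lemma cderivM f g s d e :
  cderiv f s d -> cderiv g s e ->
  cderiv (fun r => f r * g r) s (d * g s + f s * e).
Proof.
move=> [f1 f2] [g1 g2]; split.
  have -> : (fun r => Re (f r * g r)) =
      (fun r => Re (f r)) * (fun r => Re (g r)) -
      (fun r => Im (f r)) * (fun r => Im (g r)).
    by apply/funext => r; rewrite ReM.
  apply: (is_derive_eq (is_deriveB (is_deriveM f1 g1) (is_deriveM f2 g2))).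
  by rewrite ReD !ReM /GRing.scale/=; ring.
have -> : (fun r => Im (f r * g r)) =
    (fun r => Re (f r)) * (fun r => Im (g r)) +
    (fun r => Im (f r)) * (fun r => Re (g r)).
  by apply/funext => r; rewrite ImM.
apply: (is_derive_eq (is_deriveD (is_deriveM f1 g2) (is_deriveM f2 g1))).
by rewrite ImD !ImM /GRing.scale/=; ring.
Qed.

Lemma cderivZ c f s d : cderiv f s d -> cderiv (fun r => c * f r) s (c * d).
Proof.
move=> fd; apply: cderiv_eq (cderivM (cderiv_cst c s) fd) _.
by rewrite mul0r add0r.
Qed.

Lemma cderivN f s d : cderiv f s d -> cderiv (fun r => - f r) s (- d).
Proof.
move=> fd; have := cderivZ (- 1) fd; rewrite mulN1r.
by congr (cderiv _ _ _); apply/funext => r; rewrite mulN1r.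
Qed.

Lemma cderivB f g s d e :
  cderiv f s d -> cderiv g s e -> cderiv (fun r => f r - g r) s (d - e).
Proof. by move=> fd /cderivN; exact: cderivD. Qed.

Lemma cderiv_sum (I : Type) (r : seq I) (P : pred I) (f : I -> R -> C) s (d : I -> C) :
  (forall i, P i -> cderiv (f i) s (d i)) ->
  cderiv (fun x => \sum_(i <- r | P i) f i x) s (\sum_(i <- r | P i) d i).
Proof.
move=> fd; elim: r => [|i r IH].
  rewrite big_nil; under [X in cderiv X]funext => x do rewrite big_nil.
  exact: cderiv_cst.
rewrite big_cons; under [X in cderiv X]funext => x do rewrite big_cons.
by case: ifP => // Pi; apply: cderivD => //; exact: fd.
Qed.

Lemma cderiv_cexp f s d :
  cderiv f s d -> cderiv (fun r => cexp (f r)) s (cexp (f s) * d).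
Proof.
move=> [f1 f2].
have de : is_derive s 1 (expR \o (fun r => Re (f r))) (expR (Re (f s)) * Re d).
  exact: is_derive1_comp.
have dc : is_derive s 1 (cos \o (fun r => Im (f r))) (- sin (Im (f s)) * Im d).
  exact: is_derive1_comp.
have ds : is_derive s 1 (sin \o (fun r => Im (f r))) (cos (Im (f s)) * Im d).
  exact: is_derive1_comp.
split.
  apply: (is_derive_eq (is_deriveM de dc)).
  by rewrite ReM /GRing.scale/=; ring.
apply: (is_derive_eq (is_deriveM de ds)).
by rewrite ImM /GRing.scale/=; ring.
Qed.

Lemma cderiv_continuous f s d : cderiv f s d ->
  {for s, continuous (fun r => Re (f r))} /\ {for s, continuous (fun r => Im (f r))}.
Proof.
by move=> [f1 f2]; split; apply/differentiable_continuous/derivable1_diffP;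
  exact: ex_derive.
Qed.

(** Projecting f on the direction w = f b - f a reduces the claim to real functions: [h] is Re (conj
    w f) - |w| g, its derivative is nonpositive, and h b <= h a reads |w|^2 <= |w| (g b - g a). *)
Lemma cderiv_mean_value f (g : R -> R) (f' : R -> C) (g' : R -> R) (a b : R) : a <= b ->
  (forall s, cderiv f s (f' s)) -> (forall s, is_derive s 1 g (g' s)) ->
  (forall s, a <= s <= b -> normc (f' s) <= g' s) ->
  normc (f b - f a) <= g b - g a.
Proof.
move=> ab df dg le; set w := f b - f a.
pose h := (Re w *: (fun r => Re (f r)) + Im w *: (fun r => Im (f r))
            - normc w *: g) : R -> R.
have dh s : is_derive s 1 h (Re w * Re (f' s) + Im w * Im (f' s) - normc w * g' s).
  have [f1 f2] := df s; have g1 := dg s.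
  exact: (is_deriveB (is_deriveD (is_deriveZ _ f1) (is_deriveZ _ f2))
    (is_deriveZ _ g1)).
have ch : {within `[a, b], continuous h}.
  apply: derivable_within_continuous => s _; apply: ex_derive.
have [c] := MVT_segment ab (fun s _ => dh s) ch.
rewrite in_itv /= => cab hab.
have hle : h b - h a <= 0.
  rewrite hab; apply: mulr_le0_ge0; last by rewrite subr_ge0.
  rewrite subr_le0.
  apply: le_trans (_ : normc w * normc (f' c) <= _); last first.
    by apply: ler_wpM2l; [exact: normc_ge0|exact: le].
  apply: le_trans (ler_norm _) _.
  have -> : Re w * Re (f' c) + Im w * Im (f' c) = Re (w^*%C * f' c).
    by rewrite ReM; case: (w) => u v /=; ring.
  apply: le_trans (Re_le_normc _) _; rewrite Normc.normcM.
  by have -> : normc w^*%C = normc w by case: (w) => u v /=; rewrite sqrrN.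
(* For w = 0 division by |w| is impossible; the claim is then g a <= g b, from g' >= |f'| >= 0. *)
have := normc_ge0 w; rewrite le_eqVlt => /orP[/eqP w0|w0].
  have := @MVT_segment R g g' a b ab (fun s _ => dg s).
  have cg : {within `[a, b], continuous g}.
    by apply: derivable_within_continuous => s _; apply: ex_derive.
  move=> /(_ cg)[c' c'ab ->].
  rewrite -w0 mulr_ge0 ?subr_ge0//; apply: le_trans (normc_ge0 _) (le _ _).
  by rewrite in_itv /= in c'ab.
rewrite -(ler_pM2l w0) -expr2 normc_sqr.
have e : h b - h a = Re w ^+ 2 + Im w ^+ 2 - normc w * (g b - g a).
  have -> : Re w ^+ 2 + Im w ^+ 2 = Re w * (Re (f b) - Re (f a)) +
     Im w * (Im (f b) - Im (f a)) by rewrite /w !(ReD, ImD, ReN, ImN) !expr2.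
  by rewrite /h !fctE /GRing.scale /=; ring.
by rewrite e subr_le0 in hle.
Qed.

End RealVariable.

(** * Matrices *)

Section MatrixBounds.
Variable R : realType.
Local Notation C := R[i].

(* A bound on all entries; unlike the norm of MathComp-Analysis, it is real. *)
Definition mxle (m n : nat) (M : 'M[C]_(m, n)) (K : R) :=
  forall i j, normc (M i j) <= K.

Lemma mxle_norm (m n : nat) (M : 'M[C]_(m, n)) K : `|M| <= K%:C -> mxle M K.
Proof.
move=> MK i j; rewrite -lecR -normr_normc; apply: le_trans MK.
have -> : `|M| = mx_norm M by [].
rewrite mx_normE.
have : (`|M i j|%:nng <= \big[Num.max/0%:nng]_k `|M k.1 k.2|%:nng)%R.
  by apply/bigmax_geP; right; exists (i, j).
by rewrite -num_le.
Qed.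

Lemma mxle_trans (m n : nat) (M : 'M[C]_(m, n)) K L :
  mxle M K -> K <= L -> mxle M L.
Proof. by move=> h KL i j; exact: le_trans (h i j) KL. Qed.

Lemma mxleD (m n : nat) (M N : 'M[C]_(m, n)) K L :
  mxle M K -> mxle N L -> mxle (M + N) (K + L).
Proof.
move=> hM hN i j; rewrite mxE; apply: le_trans (normcD _ _) _.
exact: lerD.
Qed.

Lemma mxleN (m n : nat) (M : 'M[C]_(m, n)) K : mxle M K -> mxle (- M) K.
Proof. by move=> hM i j; rewrite mxE normcN. Qed.

Lemma mxleB (m n : nat) (M N : 'M[C]_(m, n)) K L :
  mxle M K -> mxle N L -> mxle (M - N) (K + L).
Proof. by move=> hM /mxleN; exact: mxleD. Qed.

Lemma mxleZ (m n : nat) (c : C) (M : 'M[C]_(m, n)) K L :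
  normc c <= L -> mxle M K -> mxle (c *: M) (L * K).
Proof.
move=> cL hM i j; rewrite mxE Normc.normcM.
by apply: ler_pM => //; exact: normc_ge0.
Qed.

Lemma mxle0 (m n : nat) K : 0 <= K -> mxle (0 : 'M[C]_(m, n)) K.
Proof. by move=> K0 i j; rewrite mxE Normc.normc0. Qed.

Lemma mxle_sum (I : Type) (r : seq I) (P : pred I) (m n : nat)
    (M : I -> 'M[C]_(m, n)) (K : I -> R) :
  (forall i, P i -> mxle (M i) (K i)) ->
  mxle (\sum_(i <- r | P i) M i) (\sum_(i <- r | P i) K i).
Proof.
move=> h i j; rewrite summxE; apply: le_trans (normc_sum _ _ _) _.
by apply: ler_sum => k Pk; exact: h.
Qed.

Lemma mxleM (m n p : nat) (M : 'M[C]_(m, n)) (N : 'M[C]_(n, p)) K L :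
  mxle M K -> mxle N L -> mxle (M *m N) (n%:R * (K * L)).
Proof.
move=> hM hN i j; rewrite mxE; apply: le_trans (normc_sum _ _ _) _.
apply: le_trans (_ : \sum_(k < n) K * L <= _).
  apply: ler_sum => k _; rewrite Normc.normcM.
  by apply: ler_pM => //; exact: normc_ge0.
by rewrite sumr_const card_ord mulr_natl.
Qed.

Lemma mxle_small (m n : nat) (M : 'M[C]_(m, n)) :
  (forall e, 0 < e -> mxle M e) -> M = 0.
Proof.
move=> h; apply/matrixP => i j; rewrite mxE; apply: eq0_normc_small => e e0.
exact: h.
Qed.

(** In the l1 norm of row vectors, v -> v (M - 1) shrinks by the factor n (2 n)^-1 = 1/2. So the
    kernel of M is trivial, and a row v of the inverse satisfies v = e_i - v (M - 1), whence |v| <=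
    1 + |v| / 2. *)
Lemma unitmx_near1 (n : nat) (M : 'M[C]_n) :
  mxle (M - 1%:M) (2 * n%:R)^-1 -> M \in unitmx /\ mxle (invmx M) 2.
Proof.
case: n M => [|n] M; first by split; [rewrite -row_free_unit; apply: inj_row_free => v _;
   apply/matrixP => ? []|case].
set d := (2 * _)^-1 => hM.
have hd : n.+1%:R * d = 2^-1 by rewrite /d invfM mulrC -mulrA mulVf// mulr1.
have half (v : 'rV[C]_n.+1) :
    \sum_j normc ((v *m (M - 1%:M)) 0 j) <= 2^-1 * \sum_j normc (v 0 j).
  apply: le_trans (_ : \sum_(j < n.+1) d * \sum_k normc (v 0 k) <= _).
    apply: ler_sum => j _; rewrite mxE; apply: le_trans (normc_sum _ _ _) _.
    rewrite mulr_sumr; apply: ler_sum => k _; rewrite Normc.normcM mulrC.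
    by apply: ler_wpM2r; [exact: normc_ge0|exact: hM].
  by rewrite sumr_const card_ord -[_ *+ n.+1]mulr_natl mulrA hd.
have sum0 (v : 'rV[C]_n.+1) : 0 <= \sum_j normc (v 0 j).
  by apply: sumr_ge0 => j _; exact: normc_ge0.
have uM : M \in unitmx.
  rewrite -row_free_unit; apply: inj_row_free => v vM.
  have := half v; rewrite mulmxBr mulmx1 vM sub0r.
  under eq_bigr do rewrite mxE normcN.
  have := sum0 v; set S := \sum_j _ => S0 hS.
  have S00 : S = 0 by lra.
  apply/rowP => j; rewrite mxE; apply/eqP; rewrite -normc_eq0.
  have := S00; rewrite /S => /eqP; rewrite psumr_eq0; last first.
    by move=> k _; exact: normc_ge0.
  by move=> /allP/(_ j); rewrite mem_index_enum => /(_ isT).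
split=> // i j.
set v := row i (invmx M).
have ve : v = row i 1%:M - v *m (M - 1%:M).
  rewrite mulmxBr mulmx1 /v -row_mul mulVmx// opprB addrCA subrr addr0.
  by [].
have : \sum_j normc (v 0 j) <= 1 + 2^-1 * \sum_j normc (v 0 j).
  rewrite {1}ve; apply: le_trans (_ : \sum_j (normc ((row i 1%:M : 'rV[C]_n.+1) 0 j) + normc ((v *m (M - 1%:M)) 0 j)) <= _).
    apply: ler_sum => k _; rewrite [in leLHS]mxE; apply: le_trans (normcD _ _) _.
    by rewrite lerD2l mxE normcN.
  rewrite big_split/= lerD// (bigD1 i)//= !mxE eqxx Normc.normc1 big1 ?addr0//.
  by move=> k ki; rewrite !mxE eq_sym (negbTE ki) Normc.normc0.
set S := \sum_j _ => hS.
have -> : invmx M i j = v 0 j by rewrite mxE.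
apply: le_trans (_ : S <= _); last lra.
by rewrite /S (bigD1 j)//= lerDl sumr_ge0// => k _; exact: normc_ge0.
Qed.

End MatrixBounds.

(** * Differentiation of matrix functions of a real variable *)

Section MatrixDerivative.
Variable R : realType.
Local Notation C := R[i].

Definition mderiv (m n : nat) (M : R -> 'M[C]_(m, n)) s (D : 'M[C]_(m, n)) :=
  forall i j, cderiv (fun r => M r i j) s (D i j).

Lemma mderiv_eq (m n : nat) (M : R -> 'M[C]_(m, n)) s D D' :
  mderiv M s D -> D = D' -> mderiv M s D'.
Proof. by move=> + <-. Qed.

Lemma mderiv_cst (m n : nat) (M : 'M[C]_(m, n)) s : mderiv (fun=> M) s 0.
Proof. by move=> i j; rewrite mxE; exact: cderiv_cst. Qed.

Lemma mderivB (m n : nat) (M N : R -> 'M[C]_(m, n)) s D E :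
  mderiv M s D -> mderiv N s E -> mderiv (fun r => M r - N r) s (D - E).
Proof.
move=> hM hN i j; rewrite !mxE; under [X in cderiv X]funext do rewrite !mxE.
exact: cderivB.
Qed.

Lemma mderivM (m n p : nat) (M : R -> 'M[C]_(m, n)) (N : R -> 'M[C]_(n, p)) s D E :
  mderiv M s D -> mderiv N s E ->
  mderiv (fun r => M r *m N r) s (D *m N s + M s *m E).
Proof.
move=> hM hN i j; rewrite !mxE -big_split/=.
under [X in cderiv X]funext do rewrite mxE.
by apply: cderiv_sum => k _; exact: cderivM.
Qed.

Lemma mderiv_sum (I : Type) (r : seq I) (P : pred I) (m n : nat)
    (M : I -> R -> 'M[C]_(m, n)) s (D : I -> 'M[C]_(m, n)) :
  (forall i, P i -> mderiv (M i) s (D i)) ->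
  mderiv (fun x => \sum_(i <- r | P i) M i x) s (\sum_(i <- r | P i) D i).
Proof.
move=> h i j; rewrite summxE; under [X in cderiv X]funext do rewrite summxE.
by apply: cderiv_sum => k Pk; exact: h.
Qed.

Lemma mderivZ (m n : nat) (f : R -> C) (M : 'M[C]_(m, n)) s d :
  cderiv f s d -> mderiv (fun r => f r *: M) s (d *: M).
Proof.
move=> fd i j; rewrite mxE; under [X in cderiv X]funext do rewrite mxE mulrC.
by rewrite mulrC; exact: cderivZ.
Qed.

Lemma mderiv_diag (n : nat) (f : R -> 'rV[C]_n) s (d : 'rV[C]_n) :
  mderiv f s d -> mderiv (fun r => diag_mx (f r)) s (diag_mx d).
Proof.
move=> fd i j; rewrite mxE; under [X in cderiv X]funext do rewrite mxE.
have [->|_] := eqVneq i j; first by rewrite mulr1n; exact: fd.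
exact: cderiv_cst.
Qed.

Lemma cderiv_unique (f : R -> C) s d e : cderiv f s d -> cderiv f s e -> d = e.
Proof.
move=> [f1 f2] [g1 g2]; apply/eqP; rewrite eq_complex.
by rewrite -(@derive_val _ _ _ _ _ _ _ f1) -(@derive_val _ _ _ _ _ _ _ f2)
  (@derive_val _ _ _ _ _ _ _ g1) (@derive_val _ _ _ _ _ _ _ g2) !eqxx.
Qed.

Lemma cderivV (f : R -> C) s d :
  f s != 0 -> cderiv f s d -> exists e, cderiv (fun r => (f r)^-1) s e.
Proof.
move=> fs0 [f1 f2].
pose n2 := ((fun r => Re (f r)) * (fun r => Re (f r)) +
            (fun r => Im (f r)) * (fun r => Im (f r)) : R -> R).
have n2E r : n2 r = Re (f r) ^+ 2 + Im (f r) ^+ 2 by rewrite /n2 !fctE !expr2.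
have n20 : n2 s != 0.
  by rewrite n2E -normc_sqr expf_eq0/= normc_eq0.
have dn2 := is_deriveD (is_deriveM f1 f1) (is_deriveM f2 f2).
have dV := @is_deriveV R n2 s _ 1 n20 dn2.
have d1 := is_deriveM f1 dV.
have d2 := is_deriveN (is_deriveM f2 dV).
eexists (_ +i* _); split => /=.
- rewrite (_ : (fun r => Re (f r)^-1) = (fun r => Re (f r)) * (fun y => (n2 y)^-1)); first exact: d1.
  by apply/funext => r; rewrite !fctE n2E; case: (f r).
- rewrite (_ : (fun r => Im (f r)^-1) = - ((fun r => Im (f r)) * (fun y => (n2 y)^-1))); first exact: d2.
  by apply/funext => r; rewrite !fctE n2E; case: (f r).
Qed.

Lemma cderiv_prod (I : Type) (r : seq I) (f : I -> R -> C) s :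
  (forall i, exists d, cderiv (f i) s d) ->
  exists d, cderiv (fun x => \prod_(i <- r) f i x) s d.
Proof.
move=> fd; elim: r => [|i r [e IH]].
  exists 0; under [X in cderiv X]funext => x do rewrite big_nil.
  exact: cderiv_cst.
have [d hd] := fd i.
eexists; under [X in cderiv X]funext => x do rewrite big_cons.
by apply: cderivM; [exact: hd|exact: IH].
Qed.

Lemma cderiv_det (n : nat) (M : R -> 'M[C]_n) s D :
  mderiv M s D -> exists d, cderiv (fun r => \det (M r)) s d.
Proof.
move=> hM.
have h (p : 'S_n) : exists d, cderiv (fun x => (-1) ^+ p * \prod_i M x i (p i)) s d.
  have [|d hd] := @cderiv_prod _ (index_enum 'I_n) (fun i r => M r i (p i)) s.
    by move=> i; exists (D i (p i)).
  by exists ((-1) ^+ p * d); apply: cderivZ.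
exists (\sum_p projT1 (cid (h p))); rewrite /determinant.
by apply: cderiv_sum => p _; exact: projT2 (cid (h p)).
Qed.

(** The cofactor formula shows that the inverse is differentiable; the value of the derivative then
    comes from differentiating M M^-1 = 1. *)
Lemma mderiv_invmx (n : nat) (M : R -> 'M[C]_n) s D :
  (forall r, M r \in unitmx) -> mderiv M s D ->
  mderiv (fun r => invmx (M r)) s (- (invmx (M s) *m D *m invmx (M s))).
Proof.
move=> uM hM.
have h i j : exists d, cderiv (fun r => invmx (M r) i j) s d.
  have -> : (fun r => invmx (M r) i j) = (fun r => (\det (M r))^-1 * cofactor (M r) j i).
    by apply/funext => r; rewrite /invmx uM !mxE.
  have [d hd] := cderiv_det hM.
  have [|e he] := cderivV _ hd; first by have := uM s; rewrite unitmxE unitfE.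
  have hr : mderiv (fun r => row' j (col' i (M r))) s (row' j (col' i D)).
    move=> k l; rewrite !mxE; under [X in cderiv X]funext do rewrite !mxE.
    exact: hM.
  have [c hc] := cderiv_det hr.
  by eexists; apply: cderivM he _; apply: cderivZ; exact: hc.
pose E := \matrix_(i, j) projT1 (cid (h i j)).
have hE : mderiv (fun r => invmx (M r)) s E.
  by move=> i j; rewrite mxE; exact: projT2 (cid (h i j)).
suff -> : - (invmx (M s) *m D *m invmx (M s)) = E by [].
have e0 : D *m invmx (M s) + M s *m E = 0.
  apply/matrixP => i j; apply: cderiv_unique (mderivM hM hE i j) _.
  under [X in cderiv X]funext do rewrite mulmxV//.
  exact: mderiv_cst.
apply: (can_inj (mulKmx (uM s))).
by rewrite mulmxN -mulmxA mulKVmx//; apply/eqP; rewrite eq_sym -addr_eq0 addrC e0.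
Qed.

End MatrixDerivative.

(** * Limits with real tolerances, and solutions along a path *)

Section Convergence.
Variable R : realType.
Local Notation C := R[i].

Lemma gtC0 (e : C) : 0 < e -> exists2 d : R, 0 < d & e = d%:C.
Proof.
case: e => a b; rewrite ltcE /= => /andP[/eqP -> a0].
by exists a.
Qed.

Lemma cvg_normcP (T : Type) (F : set_system T) {FF : Filter F} (f : T -> C) (l : C) :
  f @ F --> l <-> forall e : R, 0 < e -> \forall x \near F, normc (f x - l) < e.
Proof.
split=> [/cvgrPdist_lt h e e0|h].
  have := h e%:C; rewrite ltcR => /(_ e0); apply: filterS => x.
  by rewrite distrC normr_normc ltcR.
apply/cvgrPdist_lt => e /gtC0[d d0 ->]; have := h d d0.
by apply: filterS => x xd; rewrite distrC normr_normc ltcR.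
Qed.

Lemma cvg_mx_entry (T : Type) (F : set_system T) {FF : Filter F} (m n : nat)
    (f : T -> 'M[C]_(m, n)) (l : 'M[C]_(m, n)) :
  f @ F --> l -> forall e : R, 0 < e -> \forall x \near F, mxle (f x - l) e.
Proof.
move=> /cvgrPdist_lt h e e0; have := h e%:C; rewrite ltcR => /(_ e0).
by apply: filterS => x /ltW xd; apply: mxle_norm; rewrite distrC.
Qed.

Lemma nbhs_normcP (l : C) (A : set C) :
  nbhs l A <-> exists2 d : R, 0 < d & forall x, normc (x - l) < d -> A x.
Proof.
split.
  move=> /nbhs_normP[e /= /gtC0[d d0 ->] h]; exists d => // x xd.
  by apply: h; rewrite /ball_/= distrC normr_normc ltcR.
move=> [d d0 h]; apply/nbhs_normP; exists d%:C; rewrite /= ?ltcR// => x /=.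
by rewrite distrC normr_normc ltcR => /h.
Qed.

Lemma cderiv_near (f : R -> C) s d (e : R) : cderiv f s d -> 0 < e ->
  \forall r \near s, normc (f r - f s) < e.
Proof.
move=> fd e0; have [c1 c2] := cderiv_continuous fd.
have e20 : 0 < e / 2 by rewrite divr_gt0.
near=> r.
apply: le_lt_trans (normc_le_ReIm _) _; rewrite (splitr e) !(ReD, ImD, ReN, ImN).
apply: ltrD.
  by rewrite distrC; near: r; move/cvgrPdist_lt: c1; exact.
by rewrite distrC; near: r; move/cvgrPdist_lt: c2; exact.
Unshelve. all: by end_near. Qed.

(** Caratheodory's form of differentiability: p and q need only converge at s. Two slopes occur
    because a product of complex increments has two real terms in each component. *)
Lemma is_derive_slope (F x y p q : R -> R) (s a b P Q : R) :
  is_derive s 1 x a -> is_derive s 1 y b ->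
  p @ s --> P -> q @ s --> Q ->
  (\forall r \near s, F r - F s = (x r - x s) * p r + (y r - y s) * q r) ->
  is_derive s 1 F (a * P + b * Q).
Proof.
move=> dx dy pP qQ FE.
have sh (g : R -> R) (G : R) : g @ s --> G -> g (h *: 1 + s) @[h --> 0^'] --> G.
  move=> gG; apply: cvg_comp gG.
  have : h *: (1 : R) + s @[h --> (0 : R)] --> (0 : R) *: (1 : R) + s.
    by apply: cvgD; [apply: cvgZr_tmp; exact: cvg_id|exact: cvg_cst].
  rewrite scale0r add0r => hs; apply: cvg_trans hs.
  by apply: cvg_app; exact: cvg_within.
have dl (g : R -> R) c : is_derive s 1 g c ->
    h^-1 *: (g (h *: 1 + s) - g s) @[h --> 0^'] --> c.
  by move=> [gd <-]; exact: gd.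
have lim : h^-1 *: (F (h *: 1 + s) - F s) @[h --> 0^'] --> a * P + b * Q.
  have hs : h *: (1 : R) + s @[h --> (0 : R)^'] --> s.
    by apply: (sh (fun r : R => r)); exact: cvg_id.
  apply: (@cvg_trans _ (((h^-1 *: (x (h *: 1 + s) - x s)) * p (h *: 1 + s)
      + (h^-1 *: (y (h *: 1 + s) - y s)) * q (h *: 1 + s)) @[h --> 0^'])).
    have FEh : \forall h \near (0 : R)^', F (h *: 1 + s) - F s =
        (x (h *: 1 + s) - x s) * p (h *: 1 + s) + (y (h *: 1 + s) - y s) * q (h *: 1 + s).
      exact: (hs _ FE).
    apply: near_eq_cvg; near=> h.
    have -> : F (h *: 1 + s) - F s =
        (x (h *: 1 + s) - x s) * p (h *: 1 + s) + (y (h *: 1 + s) - y s) * q (h *: 1 + s).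
      by near: h.
    by rewrite /GRing.scale/=; ring.
  by apply: cvgD; apply: cvgM; [exact: dl|exact: sh|exact: dl|exact: sh].
by apply: DeriveDef; [apply/cvg_ex; exists (a * P + b * Q)|exact: cvg_lim].
Unshelve. all: by end_near. Qed.

Lemma cderiv_slope (f z p : R -> C) s d c : cderiv z s d ->
  (forall e : R, 0 < e -> \forall r \near s, normc (p r - c) <= e) ->
  (\forall r \near s, f r - f s = (z r - z s) * p r) -> cderiv f s (d * c).
Proof.
move=> [z1 z2] pc fE.
have p1 : Re (p r) @[r --> s] --> Re c.
  apply/cvgrPdist_lt => e e0; near=> r; rewrite distrC -ReN -ReD.
  apply: le_lt_trans (Re_le_normc _) _.
  apply: (@le_lt_trans _ _ (e / 2)); last by rewrite ltr_pdivrMr// ltr_pMr// ltr1n.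
  by near: r; apply: pc; rewrite divr_gt0.
have p2 : Im (p r) @[r --> s] --> Im c.
  apply/cvgrPdist_lt => e e0; near=> r; rewrite distrC -ImN -ImD.
  apply: le_lt_trans (Im_le_normc _) _.
  apply: (@le_lt_trans _ _ (e / 2)); last by rewrite ltr_pdivrMr// ltr_pMr// ltr1n.
  by near: r; apply: pc; rewrite divr_gt0.
have zN : is_derive s 1 (fun r => - Im (z r)) (- Im d) by exact: is_deriveN.
split.
  rewrite ReM -mulNr; apply: is_derive_slope z1 zN p1 p2 _.
  apply: filterS fE => r fE.
  have := congr1 (@complex.Re R) fE; rewrite ReM !(ReD, ReN, ImD, ImN) => ->; ring.
rewrite ImM; apply: is_derive_slope z1 z2 p2 p1 _.
apply: filterS fE => r fE.
by have := congr1 (@complex.Im R) fE; rewrite ImM !(ReD, ReN, ImD, ImN) => ->; ring.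
Unshelve. all: by end_near. Qed.

(** Chain rule for a path that stays in the domain. The slope form copes with the limit of the
    quotient being taken only within [outer_dom]. *)
Lemma mderiv_fundamental_solution (n : nat) N0 (A : C -> 'M[C]_n) (Y : C -> 'M[C]_n)
    (g : R -> C) s d :
  fundamental_solution N0 A Y -> (forall r, outer_dom N0 (g r)) -> cderiv g s d ->
  mderiv (fun r => Y (g r)) s ((cexp (g s) * d) *: (A (cexp (g s)) *m Y (g s))).
Proof.
move=> fY og dg i j; rewrite mxE.
set c := (A _ *m _) i j.
have [_ lim] := fY _ (og s).
(* The punctured limit says nothing where the path returns to g s; the slope is given its limit
   value there. *)
pose p r := if g r == g s then c else
  (((cexp (g r) - cexp (g s))^-1 *: (Y (g r) - Y (g s))) : 'M[C]_n) i j.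
apply: (cderiv_slope (cderiv_cexp dg) (p := p)) => [e e0|].
  have [t t0 ht] := (nbhs_normcP (g s) _).1 (cvg_mx_entry lim e0).
  have := cderiv_near dg t0; apply: filterS => r rt; rewrite /p.
  have [_|grs] := eqVneq (g r) (g s).
    by rewrite subrr Normc.normc0 ltW.
  by have := ht _ rt grs (og r) i j; rewrite /c !mxE.
have := cderiv_near dg ltr01; apply: filterS => r rs; rewrite /p.
have [->|grs] := eqVneq (g r) (g s); first by rewrite !subrr mul0r.
rewrite !mxE mulrA divff ?mul1r//.
apply: contra grs => /eqP /subr0_eq e; apply/eqP.
exact: cexp_small_inj e.
Qed.

End Convergence.

(** * Differential inequalities *)

Section Dichotomy.
Variable R : realType.
Local Notation C := R[i].

Lemma cderiv_id s : cderiv (fun r : R => r%:C) s 1.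
Proof. by split => /=; [exact: is_derive_id|exact: is_derive_cst]. Qed.

(** N^2 + s^2 is |z|^2 on the line, so this is a primitive of the O(z^-2) bound on the
    perturbation. *)
Lemma is_derive_atan_scaled (N K s : R) : 0 < N ->
  is_derive s 1 (fun r => K / N * atan (r / N)) (K / (N ^+ 2 + s ^+ 2)).
Proof.
move=> N0.
have d1 : is_derive s 1 (fun r : R => N^-1 *: r) N^-1.
  by apply: (is_derive_eq (is_deriveZ N^-1 (is_derive_id s 1))); rewrite /GRing.scale/= mulr1.
have d2 : is_derive s 1 (atan \o (fun r : R => N^-1 *: r)) ((1 + (N^-1 *: s) ^+ 2)^-1 * N^-1).
  exact: is_derive1_comp.
rewrite (_ : (fun r => _) = (K / N) *: (atan \o (fun r : R => N^-1 *: r))); last first.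
  by apply/funext => r; rewrite /GRing.scale/= [r / N]mulrC.
apply: (is_derive_eq (is_deriveZ (K / N) d2)).
have p1 : N ^+ 2 + s ^+ 2 != 0 by rewrite lt0r_neq0// ltr_wpDr ?sqr_ge0// exprn_gt0.
have p2 : N != 0 by rewrite lt0r_neq0.
rewrite /GRing.scale/=; field.
by rewrite p2 p1.
Qed.

(** Variation of constants from s0 to a distant T: since Re k >= 0, the factor exp (-k (s - s0)) has
    modulus at most 1 for s >= s0, so |f s0| is at most |f T| plus the integral of K / (N^2 + s^2),
    and |f T| is as small as desired. *)
Lemma decay_right (f r : R -> C) (k : C) (N K : R) :
  0 < N -> 0 <= K -> 0 <= Re k ->
  (forall s, cderiv f s (k * f s + r s)) ->
  (forall s, normc (r s) <= K / (N ^+ 2 + s ^+ 2)) ->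
  (forall e, 0 < e -> exists M, forall s, M <= s -> normc (f s) <= e) ->
  forall s, normc (f s) <= K / N * (pi / 2 - atan (s / N)).
Proof.
move=> N0 K0 k0 df hr lim s0; apply/ler_addgt0Pr => e e0.
have [M hM] := lim e e0.
set T := Num.max M s0.
have sT : s0 <= T by rewrite le_max lexx orbT.
pose h s := cexp (- k * (s%:C - s0%:C)) * f s.
have dh s : cderiv h s (cexp (- k * (s%:C - s0%:C)) * r s).
  have d1 := cderivZ (- k) (cderivB (cderiv_id s) (cderiv_cst s0%:C s)).
  apply: cderiv_eq (cderivM (cderiv_cexp d1) (df s)) _.
  by ring.
have ex s : s0 <= s -> normc (cexp (- k * (s%:C - s0%:C))) <= 1.
  move=> s0s; rewrite normc_cexp -expR0 ler_expR -rmorphB/= ReM /= mulr0 subr0 ReN.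
  by rewrite mulNr oppr_le0 mulr_ge0// subr_ge0.
have := @cderiv_mean_value _ h _ _ _ s0 T sT dh
  (fun s => is_derive_atan_scaled K s N0) _.
have -> : h s0 = f s0 by rewrite /h subrr mulr0 cexp0 mul1r.
move=> /(_ _)/wrap[].
  move=> s /andP[ss _]; rewrite Normc.normcM -[leRHS]mul1r.
  by apply: ler_pM; rewrite ?normc_ge0 ?ex.
move=> hmv.
have hT : normc (h T) <= e.
  rewrite /h Normc.normcM -[leRHS]mul1r.
  by apply: ler_pM; rewrite ?normc_ge0 ?ex ?hM// /T le_max lexx.
have -> : f s0 = h T - (h T - f s0) by ring.
apply: le_trans (normcD _ _) _; rewrite normcN addrC lerD//.
apply: le_trans hmv _; rewrite -mulrBr ler_wpM2l ?divr_ge0 ?(ltW N0)//.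
by rewrite lerB// ltW// atan_ltpi2.
Qed.

Lemma cderiv_opp (f : R -> C) s d :
  cderiv f (- s) d -> cderiv (fun r => f (- r)) s (- d).
Proof.
move=> [f1 f2].
have dN : is_derive s 1 (fun r : R => - r) (- 1).
  by apply: (is_derive_eq (is_deriveN (is_derive_id s 1))).
split; rewrite (ReN, ImN) -mulrN1.
  exact: (@is_derive1_comp _ (fun r => Re (f r)) (fun r => - r) s).
exact: (@is_derive1_comp _ (fun r => Im (f r)) (fun r => - r) s).
Qed.

Lemma decay_left (f r : R -> C) (k : C) (N K : R) :
  0 < N -> 0 <= K -> Re k <= 0 ->
  (forall s, cderiv f s (k * f s + r s)) ->
  (forall s, normc (r s) <= K / (N ^+ 2 + s ^+ 2)) ->
  (forall e, 0 < e -> exists M, forall s, s <= M -> normc (f s) <= e) ->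
  forall s, normc (f s) <= K / N * (pi / 2 + atan (s / N)).
Proof.
move=> N0 K0 k0 df hr lim s.
have := @decay_right (fun r => f (- r)) (fun s => - r (- s)) (- k) N K N0 K0.
move=> /(_ _ _ _ _ (- s)); rewrite opprK mulNr atanN opprK; apply.
- by rewrite ReN oppr_ge0.
- by move=> x; apply: cderiv_eq (cderiv_opp (df (- x))) _; ring.
- by move=> x; rewrite normcN -(sqrrN x).
- move=> e /lim[M hM]; exists (- M) => x Mx; apply: hM.
  by rewrite lerNl.
Qed.

Lemma cderiv_bounded (f f' : R -> C) (M : R) :
  (forall s, cderiv f s (f' s)) -> exists2 B, 0 <= B & forall s, `|s| <= M -> normc (f s) <= B.
Proof.
move=> df; case: (leP 0 M) => M0; last first.
  by exists 0 => // s sM; have := le_lt_trans (normr_ge0 s) (le_lt_trans sM M0); rewrite ltxx.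
have bd (g : R -> R) : continuous g -> exists2 B, 0 <= B & forall s, `|s| <= M -> `|g s| <= B.
  move=> cg; have MM : - M <= M by rewrite ge0_cp.
  have [|c _ hc] := @EVT_max R (fun s => `|g s|) (- M) M MM.
    by apply: continuous_subspaceT => s; apply: (continuous_comp (cg s)); exact: norm_continuous.
  by exists `|g c| => // s sM; apply: hc; rewrite in_itv/= -ler_norml.
have [B1 B10 h1] : exists2 B, 0 <= B & forall s, `|s| <= M -> `|Re (f s)| <= B.
  by apply: bd => s; exact: (cderiv_continuous (df s)).1.
have [B2 B20 h2] : exists2 B, 0 <= B & forall s, `|s| <= M -> `|Im (f s)| <= B.
  by apply: bd => s; exact: (cderiv_continuous (df s)).2.
exists (B1 + B2); first exact: addr_ge0.
by move=> s sM; apply: le_trans (normc_le_ReIm _) _; rewrite lerD ?h1 ?h2.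
Qed.

(* The a priori finite supremum S of |Q - I| satisfies S <= (1 + S) / 2. *)
Lemma dichotomy (n : nat) (N K : R) (k : 'I_n -> 'I_n -> C) (Q T : R -> 'M[C]_n) :
  0 < N -> 0 <= K -> n%:R * K * pi <= N / 2 ->
  (forall a, k a a = 0) ->
  (forall s, mderiv Q s (\matrix_(a, b) (k a b * Q s a b) + T s *m Q s)) ->
  (forall s, mxle (T s) (K / (N ^+ 2 + s ^+ 2))) ->
  (forall e, 0 < e -> exists M, forall s, M <= `|s| -> mxle (Q s - 1%:M) e) ->
  forall a b s,
  (0 <= Re (k a b) ->
    normc ((Q s - 1%:M) a b) <= 2 * n%:R * K / N * (pi / 2 - atan (s / N))) /\
  (Re (k a b) <= 0 ->
    normc ((Q s - 1%:M) a b) <= 2 * n%:R * K / N * (pi / 2 + atan (s / N))).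
Proof.
move=> N0 K0 NK kaa dQ hT lim.
pose f a b s := (Q s - 1%:M) a b.
pose E := [set x | exists s a b, x = normc (f a b s)].
have df a b s : cderiv (f a b) s (k a b * f a b s + (T s *m Q s) a b).
  apply: cderiv_eq (mderivB (dQ s) (mderiv_cst 1%:M s) a b) _.
  rewrite /f !mxE subr0; congr (_ + _).
  by have [->|] := eqVneq a b; rewrite ?kaa ?mul0r// subr0.
(* A matrix of size 0 has no entries, and the supremum would be over an empty set. *)
case: n k Q T NK kaa dQ hT lim @f @E df => [|n] k Q T NK kaa dQ hT lim f E df.
  by case.
(* Finiteness of the supremum: the entries of Q - I are at most 1 beyond M0 and bounded by
   compactness on [-M0, M0]. *)
have [M0 hM0] := lim _ ltr01.
have hB a b : exists2 B, 0 <= B & forall s, `|s| <= M0 -> normc (f a b s) <= B.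
  exact: cderiv_bounded (df a b).
pose B a b := projT1 (cid2 (hB a b)).
have B0 a b : 0 <= B a b by rewrite /B; case: cid2.
have BP a b s : `|s| <= M0 -> normc (f a b s) <= B a b by rewrite /B; case: cid2 => /= ? _; exact.
have supE : has_sup E.
  split; first by exists (normc (f ord0 ord0 0)), 0, ord0, ord0.
  exists (1 + \sum_a \sum_b B a b) => _ [s [a [b ->]]].
  have [sM|/ltW sM] := leP `|s| M0; last first.
    apply: le_trans (hM0 s sM a b) _; rewrite lerDl sumr_ge0// => i _.
    by rewrite sumr_ge0.
  apply: le_trans (BP a b s sM) _.
  rewrite (bigD1 a)//= (bigD1 b)//= !addrA addrAC [1 + _]addrC -!addrA lerDl.
  rewrite !addr_ge0//; last by rewrite sumr_ge0.
  by rewrite sumr_ge0// => i _; rewrite sumr_ge0.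
set S := sup E.
have hS s : mxle (Q s - 1%:M) S.
  by move=> a b; apply: sup_ubound => //; [exact: supE.2|exists s, a, b].
have S0 : 0 <= S by apply: le_trans (hS 0 ord0 ord0); exact: normc_ge0.
have m1 : mxle (1%:M : 'M[C]_n.+1) 1.
  by move=> a b; rewrite mxE; case: eqP => _; rewrite ?Normc.normc1// Normc.normc0.
have hQ s : mxle (Q s) (1 + S).
  have -> : Q s = 1%:M + (Q s - 1%:M) by rewrite addrC subrK.
  exact: mxleD.
pose K1 := n.+1%:R * (K * (1 + S)).
have K10 : 0 <= K1 by rewrite !mulr_ge0// addr_ge0.
have hr s a b : normc ((T s *m Q s) a b) <= K1 / (N ^+ 2 + s ^+ 2).
  apply: le_trans (mxleM (hT s) (hQ s) a b) _.
  by rewrite /K1 le_eqVlt; apply/orP; left; apply/eqP; ring.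
have fR a b s : 0 <= Re (k a b) -> normc (f a b s) <= K1 / N * (pi / 2 - atan (s / N)).
  move=> k0; apply: (decay_right N0 K10 k0 (df a b)) => [x|e e0]; first exact: hr.
  have [M hM] := lim e e0; exists M => x Mx; apply: hM.
  exact: le_trans Mx (ler_norm _).
have fL a b s : Re (k a b) <= 0 -> normc (f a b s) <= K1 / N * (pi / 2 + atan (s / N)).
  move=> k0; apply: (decay_left N0 K10 k0 (df a b)) => [x|e e0]; first exact: hr.
  have [M hM] := lim e e0; exists (- M) => x Mx; apply: hM.
  by rewrite -normrN; apply: le_trans (ler_norm _); rewrite lerNr.
have S1 : S <= 1.
  suff : S <= (1 + S) / 2 by lra.
  apply: ge_sup; first exact: supE.1.
  move=> _ [s [a [b ->]]].
  (* The total integral of the perturbation carries the factor n K pi / N <= 1/2, which makes the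
     inequality for S contractive. *)
  have Kpi : K1 / N * pi <= (1 + S) / 2.
    have -> : K1 / N * pi = (n.+1%:R * K * pi) * ((1 + S) / N) by rewrite /K1; ring.
    apply: le_trans (ler_wpM2r _ NK) _; first by rewrite divr_ge0 ?addr_ge0// ltW.
    by rewrite le_eqVlt; apply/orP; left; apply/eqP; field; rewrite lt0r_neq0.
  have KN0 : 0 <= K1 / N by rewrite divr_ge0// ltW.
  have [k0|/ltW k0] := leP 0 (Re (k a b)).
    apply: le_trans (fR a b s k0) _; apply: le_trans Kpi; apply: ler_wpM2l => //.
    by have := atan_gtNpi2 (s / N); lra.
  apply: le_trans (fL a b s k0) _; apply: le_trans Kpi; apply: ler_wpM2l => //.
  by have := atan_ltpi2 (s / N); lra.
have K2 : K1 / N <= 2 * n.+1%:R * K / N.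
  rewrite ler_wpM2r ?invr_ge0 ?(ltW N0)// /K1 [2 * _]mulrC -!mulrA ler_wpM2l//.
  by rewrite mulrC ler_wpM2r//; lra.
move=> a b s; split=> k0.
  apply: le_trans (fR a b s k0) _; apply: ler_wpM2r K2.
  by rewrite subr_ge0 ltW// atan_ltpi2.
apply: le_trans (fL a b s k0) _; apply: ler_wpM2r K2.
by have := atan_gtNpi2 (s / N); lra.
Qed.

Lemma is_derive_bigsum (n : nat) (h : 'I_n -> R -> R) (s : R) (dh : 'I_n -> R) :
  (forall i, is_derive s 1 (h i) (dh i)) ->
  is_derive s 1 (fun x => \sum_i h i x) (\sum_i dh i).
Proof.
move=> hd; rewrite (_ : (fun x => _) = \sum_i h i); first exact: is_derive_sum.
by apply/funext => x; rewrite fct_sumE.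
Qed.

(** D precedes U, E, G and e, so that e can later tend to 0 with D fixed. The energy [En], the sum
    of all |U_ij|^2, is differentiable and satisfies En' <= c (En + e^2); hence exp (-c s) (En +
    e^2) does not increase from a to b. *)
Lemma gronwall (m n : nat) (K a b : R) : 0 <= K -> a <= b -> exists2 D, 0 < D &
  forall (U E : R -> 'M[C]_(m, n)) (G : R -> 'M[C]_m) (e : R), 0 <= e ->
  (forall s, mderiv U s (G s *m U s + E s)) ->
  (forall s, a <= s <= b -> mxle (G s) K) ->
  (forall s, a <= s <= b -> mxle (E s) e) ->
  mxle (U a) e -> mxle (U b) (e * D).
Proof.
(* With w^2 = En, each of the m n entries contributes at most 2 w (m K w + e) <= (2 m K + 1) (w^2 +
   e^2). *)
move=> K0 ab; pose c : R := (m * n)%:R * (2 * m%:R * K + 1).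
have c0 : 0 <= c by rewrite mulr_ge0// addr_ge0// !mulr_ge0.
(* The factor m n + 1 bounds the initial value: En a + e^2 <= (m n + 1) e^2. *)
pose D := ((m * n)%:R + 1) * expR (c * (b - a)).
have D1 : 1 <= D.
  rewrite -[1]mul1r ler_pM ?lerDr//.
  by rewrite -expR0 ler_expR mulr_ge0// subr_ge0.
have D0 : 0 < D by exact: lt_le_trans D1.
exists D => // U E G e e0 dU hG hE hUa.
pose U' s := G s *m U s + E s.
pose En s := \sum_i \sum_j (Re (U s i j) ^+ 2 + Im (U s i j) ^+ 2).
pose En' s := \sum_i \sum_j 2 * (Re (U s i j) * Re (U' s i j) + Im (U s i j) * Im (U' s i j)).
have dEn (s : R) : is_derive s 1 En (En' s).
  apply: is_derive_bigsum => i; apply: is_derive_bigsum => j.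
  have [f1 f2] := dU s i j.
  apply: (is_derive_eq (is_deriveD (is_deriveM f1 f1) (is_deriveM f2 f2))).
  by rewrite -/(U' s) /GRing.scale/=; ring.
have Enn s i j : normc (U s i j) ^+ 2 <= En s.
  rewrite normc_sqr /En (bigD1 i)//= (bigD1 j)//= -addrA lerDl addr_ge0//.
    by rewrite sumr_ge0// => k _; rewrite addr_ge0// sqr_ge0.
  by rewrite sumr_ge0// => k _; rewrite sumr_ge0// => l _; rewrite addr_ge0// sqr_ge0.
have En0 s : 0 <= En s.
  by rewrite sumr_ge0// => k _; rewrite sumr_ge0// => l _; rewrite addr_ge0// sqr_ge0.
have le' s : a <= s <= b -> En' s <= c * (En s + e ^+ 2).
  move=> sab; set w := Num.sqrt (En s).
  have w0 : 0 <= w := sqrtr_ge0 _.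
  have w2 : w ^+ 2 = En s by rewrite sqr_sqrtr.
  have Uw : mxle (U s) w.
    move=> i j; rewrite -ler_sqr ?nnegrE ?normc_ge0//; rewrite w2; exact: Enn.
  have U'w : mxle (U' s) (m%:R * (K * w) + e).
    by apply: mxleD; [apply: mxleM => //; exact: hG|exact: hE].
  have term i j : 2 * (Re (U s i j) * Re (U' s i j) + Im (U s i j) * Im (U' s i j)) <=
      (2 * m%:R * K + 1) * (En s + e ^+ 2).
    apply: (@le_trans _ _ (2 * (w * (m%:R * (K * w) + e)))).
      rewrite ler_wpM2l//; apply: le_trans (_ : normc ((U s i j)^*%C * U' s i j) <= _).
        have -> : Re (U s i j) * Re (U' s i j) + Im (U s i j) * Im (U' s i j) =
          Re ((U s i j)^*%C * U' s i j).
          by rewrite ReM; case: (U s i j) => u v /=; ring.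
        exact: le_trans (ler_norm _) (Re_le_normc _).
      rewrite Normc.normcM; apply: ler_pM; rewrite ?normc_ge0//.
      have -> : normc (U s i j)^*%C = normc (U s i j) by case: (U s i j) => u v /=; rewrite sqrrN.
      exact: Uw.
    rewrite -w2 -subr_ge0.
    have -> : (2 * m%:R * K + 1) * (w ^+ 2 + e ^+ 2) - 2 * (w * (m%:R * (K * w) + e)) =
      (w - e) ^+ 2 + 2 * m%:R * K * e ^+ 2 by ring.
    by rewrite addr_ge0 ?sqr_ge0// !mulr_ge0// ?sqr_ge0.
  apply: le_trans (_ : \sum_(i < m) \sum_(j < n) (2 * m%:R * K + 1) * (En s + e ^+ 2) <= _).
    by apply: ler_sum => i _; apply: ler_sum => j _; exact: term.
  rewrite (eq_bigr _ (fun i _ => sumr_const _ _)) sumr_const !card_ord -mulrnA.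
  by rewrite -[_ *+ (n * m)]mulr_natl /c mulnC mulrA.
pose h := ((fun s => expR (- c * s)) * (fun s => En s + e ^+ 2) : R -> R).
have dh (s : R) : is_derive s 1 h (expR (- c * s) * (En' s - c * (En s + e ^+ 2))).
  have d1 : is_derive s 1 (fun s : R => - c *: s) (- c).
    by apply: (is_derive_eq (is_deriveZ (- c) (is_derive_id s 1))); rewrite /GRing.scale/= mulr1.
  have d2 : is_derive s 1 (expR \o (fun s : R => - c *: s)) (expR (- c * s) * (- c)).
    exact: is_derive1_comp.
  have d3 : is_derive s 1 (fun s => En s + e ^+ 2) (En' s).
    by apply: (is_derive_eq (is_deriveD (dEn s) (is_derive_cst (e ^+ 2) s 1))); rewrite addr0.
  apply: (is_derive_eq (is_deriveM d2 d3)).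
  by rewrite /GRing.scale/=; ring.
have ch : {within `[a, b], continuous h}.
  by apply: derivable_within_continuous => s _; apply: ex_derive.
have [x xab hx] := MVT_segment ab (fun s _ => dh s) ch.
have hle : h b <= h a.
  rewrite -subr_le0 hx mulr_le0_ge0 ?subr_ge0// mulr_ge0_le0 ?expR_ge0//.
  by rewrite subr_le0 le'// -in_itv.
have Ea : En a <= (m * n)%:R * e ^+ 2.
  apply: le_trans (_ : \sum_(i < m) \sum_(j < n) e ^+ 2 <= _).
    apply: ler_sum => i _; apply: ler_sum => j _; rewrite -normc_sqr.
    by rewrite ler_sqr ?nnegrE ?normc_ge0//; exact: hUa.
  rewrite (eq_bigr _ (fun i _ => sumr_const _ _)) sumr_const !card_ord -mulrnA.
  by rewrite -[_ *+ (n * m)]mulr_natl mulnC.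
have Eb : En b <= e ^+ 2 * D.
  have : h b * expR (c * b) <= h a * expR (c * b) by rewrite ler_wpM2r ?expR_ge0.
  rewrite /h !fctE mulrAC -expRD mulNr addNr expR0 mul1r mulrAC -expRD.
  have -> : - c * a + c * b = c * (b - a) by ring.
  move=> hb; apply: (@le_trans _ _ (En b + e ^+ 2)); first by rewrite lerDl sqr_ge0.
  apply: le_trans hb _; rewrite /D mulrC [leRHS]mulrA ler_wpM2r ?expR_ge0//.
  by rewrite mulrDr mulr1 [e ^+ 2 * _]mulrC lerD2r.
move=> i j; rewrite -ler_sqr ?nnegrE ?normc_ge0 ?mulr_ge0 ?(ltW D0)//.
apply: le_trans (Enn b i j) _; apply: le_trans Eb _.
(* As D >= 1, e^2 D <= (e D)^2. *)
rewrite exprMn ler_wpM2l ?sqr_ge0// expr2 ler_peMl// ltW//.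
Qed.

End Dichotomy.

(** * Cauchy estimates *)

Section PowerSeries.
Variable R : realType.
Local Notation C := R[i].

Definition series_to (b : nat -> C) (l : C) := forall e : R, 0 < e ->
  exists M, forall m, (M <= m)%N -> normc (\sum_(j < m) b j - l) <= e.

(** For q <= 1/2 one has B q^j <= 2 B (q^j - q^(j+1)), so that the tail telescopes. *)
Lemma geometric_tail (b : nat -> C) l (B q : R) m : 0 <= B -> 0 <= q -> q <= 2^-1 ->
  (forall j, (m <= j)%N -> normc (b j) <= B * q ^+ j) -> series_to b l ->
  normc (l - \sum_(j < m) b j) <= 2 * B * q ^+ m.
Proof.
move=> B0 q0 q2 hb lim; apply/ler_addgt0Pr => e e0.
have part k : normc (\sum_(j < m + k) b j - \sum_(j < m) b j) <=
    2 * B * (q ^+ m - q ^+ (m + k)).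
  elim: k => [|k IH]; first by rewrite addn0 !subrr mulr0 Normc.normc0.
  rewrite addnS big_ord_recr/= addrAC; apply: le_trans (normcD _ _) _.
  apply: le_trans (lerD IH (hb _ (leq_addr _ _))) _.
  rewrite exprS -subr_ge0.
  have -> : 2 * B * (q ^+ m - q * q ^+ (m + k)) - (2 * B * (q ^+ m - q ^+ (m + k)) + B * q ^+ (m + k))
    = B * q ^+ (m + k) * (1 - 2 * q) by ring.
  rewrite !mulr_ge0 ?exprn_ge0// subr_ge0; lra.
have [M hM] := lim e e0.
have := hM (m + M)%N (leq_addl _ _).
rewrite (normcB_sym _ l) => h.
rewrite -[l](subrK (\sum_(j < m + M) b j)) -addrA.
apply: le_trans (normcD _ _) _; apply: le_trans (lerD h (part M)) _.
by rewrite [leRHS]addrC lerD2l ler_wpM2l ?mulr_ge0// gerBl exprn_ge0.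
Qed.

Lemma root_of_unity_sum (q : C) M : q ^+ M = 1 -> q != 1 -> \sum_(k < M) q ^+ k = 0.
Proof.
move=> qM q1; have := subrX1 q M; rewrite qM subrr => /esym/eqP.
by rewrite mulf_eq0 subr_eq0 (negbTE q1) => /eqP.
Qed.

Lemma cexp_i_neq1 (x : R) : 0 < x < 2 * pi -> cexp (0 +i* x) != 1.
Proof.
move=> /andP[x0 x2]; apply/eqP => -[]; rewrite expR0 !mul1r => cx _.
have := cos_mulr2n (x / 2); rewrite -[x / 2 *+ 2]mulr_natr divfK ?pnatr_eq0// cx => h.
have s1 : 0 < sin (x / 2) by apply: sin_gt0_pi; apply/andP; split; lra.
have := cos2Dsin2 (x / 2); move: h; rewrite -mulr_natr; nra.
Qed.

(* Averaging z^j f(z) over the M-th roots of unity isolates the coefficient a_j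
   as M -> oo, in place of the Cauchy integral. *)
Lemma cauchy_estimate (N0 S : R) (a : nat -> C) (f : C -> C) : 0 < N0 ->
  (forall z, N0 <= normc z -> series_to (fun j => z ^- j * a j) (f z)) ->
  (forall x, 0 <= x <= 2 * pi -> normc (f ((2 * N0)%:C * cexp (0 +i* x))) <= S) ->
  forall j, normc (a j) <= S * (2 * N0) ^+ j.
Proof.
move=> N00 lim hf j; set r := 2 * N0.
have r0 : 0 < r by rewrite mulr_gt0.
(* Convergence at the single point z = N0 bounds the terms there; on the circle |z| = 2 N0 the
   series is then dominated by a geometric one of ratio 1/2. *)
have [B B0 hB] : exists2 B, 0 <= B & forall i, normc (a i) <= B * N0 ^+ i.
  have nz : normc N0%:C = N0 by rewrite normc_real gtr0_norm.
  have [|M hM] := lim N0%:C _ 1 ltr01; first by rewrite nz.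
  (* From index M on, consecutive partial sums are both within 1 of the limit, so a term is at most
     2; the sum covers the earlier terms. *)
  exists (2 + \sum_(i < M) normc (a i) / N0 ^+ i).
    rewrite addr_ge0// sumr_ge0// => i _; rewrite divr_ge0 ?normc_ge0//.
    by rewrite exprn_ge0// ltW.
  move=> i; rewrite -ler_pdivrMr ?exprn_gt0//.
  have [iM|Mi] := ltnP i M.
    rewrite (bigD1 (Ordinal iM))//= addrCA lerDl addr_ge0// sumr_ge0// => k _.
    by rewrite divr_ge0 ?normc_ge0// exprn_ge0// ltW.
  apply: le_trans (_ : 2 <= _); last first.
    rewrite lerDl sumr_ge0// => k _; rewrite divr_ge0 ?normc_ge0//.
    by rewrite exprn_ge0// ltW.
  have h := lerD (hM i.+1 (leqW Mi)) (hM i Mi).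
  rewrite [X in _ + X]normcB_sym in h.
  have {}h := le_trans (normcD (\sum_(j < i.+1) N0%:C ^- j * a j - f N0%:C) (f N0%:C - \sum_(j < i) N0%:C ^- j * a j)) h.
  move: h; rewrite big_ord_recr/= addrA addrNK.
  rewrite addrAC subrr add0r Normc.normcM Normc.normcV normcX nz mulrC.
  by [].
have tail z M : normc z = r ->
    normc (f z - \sum_(i < M) z ^- i * a i) <= 2 * B * 2^-1 ^+ M.
  move=> zr; apply: (@geometric_tail (fun i => z ^- i * a i) _ B 2^-1 M) => // [i _|].
  - rewrite Normc.normcM Normc.normcV normcX zr.
    rewrite mulrC ler_pdivrMr ?exprn_gt0//; apply: le_trans (hB i) _.
    rewrite -mulrA ler_wpM2l// -exprMn /r mulrA mulVf ?pnatr_eq0// mul1r.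
    by [].
  - by apply: lim; rewrite zr /r; lra.
have est M : (j < M)%N -> normc (a j) / r ^+ j <= S + 2 * B * 2^-1 ^+ M.
  move=> jM; have M0 : (0 < M)%N by case: M jM.
  have MR : (0 : R) < M%:R by rewrite ltr0n.
  pose w : C := cexp (0 +i* (2 * pi / M%:R)).
  have w0 : w != 0 := cexp_neq0 _.
  have wE k : w ^+ k = cexp (0 +i* (k%:R * (2 * pi / M%:R))).
    rewrite -cexpMn; congr cexp.
    have -> : (k%:R : C) = (k%:R : R)%:C by rewrite rmorph_nat.
    by apply/eqP; rewrite eq_complex /=; apply/andP; split; apply/eqP; ring.
  have wM : w ^+ M = 1.
    rewrite wE mulrC divfK ?lt0r_neq0// /cexp /= expR0 !mul1r mulr_natl cos2pi sin2pi.
    by [].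
  have wk k : (0 < k < M)%N -> w ^+ k != 1.
    move=> /andP[k0 kM]; rewrite wE; apply: cexp_i_neq1; apply/andP; split.
      by rewrite !mulr_gt0 ?ltr0n ?invr_gt0 ?pi_gt0.
    rewrite mulrA ltr_pdivrMr// [ltRHS]mulrC ltr_pM2r ?mulr_gt0 ?pi_gt0//.
    by rewrite ltr_nat.
  have nw k : normc (w ^+ k) = 1 by rewrite wE normc_cexp /= expR0.
  pose z (k : nat) : C := r%:C * w ^+ k.
  have nz k : normc (z k) = r.
    by rewrite Normc.normcM nw mulr1 normc_real gtr0_norm.
  have key : \sum_(k < M) z k ^+ j * (\sum_(i < M) z k ^- i * a i) = M%:R * a j.
    under eq_bigr do rewrite mulr_sumr.
    rewrite exchange_big/= (bigD1 (Ordinal jM))//= [X in _ + X]big1 ?addr0; last first.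
      (* The contribution of an index i other than j is a geometric sum over the powers of q = w^(j
         - i), an M-th root of unity that differs from 1 because 0 < |i - j| < M. *)
      move=> i ij; pose q : C := w ^+ j * (w ^+ i)^-1.
      have rz : r%:C != 0 by rewrite -normc_eq0 normc_real normr_eq0 lt0r_neq0.
      rewrite (eq_bigr (fun k : 'I_M => (r%:C ^+ j * r%:C ^- i * a i) * q ^+ k)); last first.
        move=> k _; rewrite /z /q !exprMn invfM exprVn -!exprM [(k * j)%N]mulnC [(k * i)%N]mulnC.
        ring.
      rewrite -mulr_sumr root_of_unity_sum ?mulr0//.
        by rewrite /q exprMn exprVn -!exprM ![(_ * M)%N]mulnC !exprM wM !expr1n invr1 mulr1.
      have ij' : nat_of_ord i != j by apply: contra ij => /eqP e; apply/eqP/val_inj.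
      rewrite /q; apply/eqP => /(congr1 ( *%R^~ (w ^+ i))); rewrite mulfVK ?expf_neq0// mul1r.
      have [lij|lji|/eqP] := ltngtP i j; last by rewrite (negbTE ij').
        rewrite -(subnK (ltnW lij)) exprD -[RHS]mul1r => /(mulIf (expf_neq0 _ w0)) /eqP.
        apply/negP; apply: wk; rewrite subn_gt0 lij/=; exact: leq_ltn_trans (leq_subr _ _) jM.
      rewrite -(subnK (ltnW lji)) exprD -[LHS]mul1r => /(mulIf (expf_neq0 _ w0)) /esym/eqP.
      apply/negP; apply: wk; rewrite subn_gt0 lji/=.
      exact: leq_ltn_trans (leq_subr _ _) (ltn_ord i).
    rewrite (eq_bigr (fun=> a j)).
      by rewrite sumr_const card_ord mulr_natl.
    move=> k _; rewrite mulrA divff ?mul1r// expf_neq0//.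
    by rewrite -normc_eq0 nz lt0r_neq0.
  have : normc (M%:R * a j) <= M%:R * (r ^+ j * (S + 2 * B * 2^-1 ^+ M)).
    rewrite -key; apply: le_trans (normc_sum _ _ _) _.
    apply: le_trans (_ : \sum_(k < M) r ^+ j * (S + 2 * B * 2^-1 ^+ M) <= _); last first.
      by rewrite sumr_const card_ord -[_ *+ M]mulr_natl.
    apply: ler_sum => k _; rewrite Normc.normcM normcX nz ler_wpM2l ?exprn_ge0 ?(ltW r0)//.
    have -> : \sum_(i < M) z k ^- i * a i = f (z k) - (f (z k) - \sum_(i < M) z k ^- i * a i) by ring.
    apply: le_trans (normcD _ _) _; rewrite normcN lerD ?tail//.
    rewrite /z wE; apply: hf; apply/andP; split.
      by rewrite !mulr_ge0 ?invr_ge0// pi_ge0.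
    rewrite mulrA ler_pdivrMr// mulrC ler_pM2l ?mulr_gt0 ?pi_gt0//.
    by rewrite ler_nat ltnW.
  rewrite Normc.normcM.
  have -> : normc (M%:R : C) = M%:R.
    have -> : (M%:R : C) = (M%:R : R)%:C by rewrite rmorph_nat.
    by rewrite normc_real ger0_norm.
  by rewrite ler_pM2l// ler_pdivrMr ?exprn_gt0// mulrC.
rewrite -ler_pdivrMr ?exprn_gt0//; apply/ler_addgt0Pr => e e0.
have [M hM] : exists M, 2 * B * 2^-1 ^+ M <= e.
  have : (fun k => 2 * B * (2^-1 : R) ^+ k) @ \oo --> 2 * B * 0.
    apply: cvgMr; apply: cvg_expr.
    by rewrite ger0_norm ?invr_ge0// invf_lt1// ltr1n.
  rewrite mulr0 => /cvgrPdist_le/(_ _ e0)[M _ /(_ M (leqnn _))] /=.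
  by rewrite sub0r normrN => h; exists M; apply: le_trans h; exact: ler_norm.
apply: le_trans (est (maxn M j.+1) _) _; first by rewrite leq_max ltnSn orbT.
rewrite lerD2l; apply: le_trans hM; rewrite ler_wpM2l ?mulr_ge0//.
by apply: ler_wiXn2l; rewrite ?invr_ge0// ?leq_maxl// invf_le1// ler1n.
Qed.

(** The condition |z| >= 4 N0 makes the ratio 2 N0 / |z| at most 1/2. *)
Lemma series_tail (N0 S : R) (a : nat -> C) (f : C -> C) : 0 < N0 -> 0 <= S ->
  (forall z, N0 <= normc z -> series_to (fun j => z ^- j * a j) (f z)) ->
  (forall j, normc (a j) <= S * (2 * N0) ^+ j) ->
  forall m z, 4 * N0 <= normc z ->
  normc (f z - \sum_(j < m) z ^- j * a j) <= 2 * S * (2 * N0) ^+ m / normc z ^+ m.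
Proof.
move=> N00 S0 lim ha m z hz.
have z0 : 0 < normc z by apply: lt_le_trans hz; rewrite mulr_gt0.
rewrite -mulrA -expr_div_n; apply: (@geometric_tail (fun i => z ^- i * a i)) => // [||i _|].
- by rewrite divr_ge0 ?mulr_ge0// ltW.
- rewrite ler_pdivrMr//; lra.
- rewrite Normc.normcM Normc.normcV normcX mulrC expr_div_n mulrA ler_wpM2r//.
  by rewrite invr_ge0 exprn_ge0 ?normc_ge0.
- by apply: lim; lra.
Qed.

End PowerSeries.

(** * Truncated formal solutions *)

Section Residual.
Variables (R : realType) (n : nat).
Local Notation C := R[i].
Implicit Types (A H : nat -> 'M[C]_n) (u b : 'rV[C]_n) (z : C).

Definition fser_sum H m z : 'M[C]_n := \sum_(j < m) z ^- j *: H j.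

Definition fser_dsum H m z : 'M[C]_n := \sum_(j < m) (- (j%:R * z ^- j.+1)) *: H j.

(** With P the truncated sum, this is the defect of P z^B e^(Lambda z) as a solution: A P minus the
    logarithmic form P' + P (Lambda + B / z) of its derivative. *)
Definition residual (Az : 'M[C]_n) H u b m z : 'M[C]_n :=
  Az *m fser_sum H m z - fser_dsum H m z
    - fser_sum H m z *m (diag_mx u + z^-1 *: diag_mx b).

(** Cauchy product: the pairs of total degree below m regroup into coefficients, and the others all
    carry a factor z^-m or smaller. *)
Lemma fser_mulE A H m z :
  fser_sum A m z *m fser_sum H m z = \sum_(q < m) z ^- q *: fser_mul A H q
    + \sum_(j < m) \sum_(i < m | (m <= i + j)%N) z ^- (i + j) *: (A j *m H i).
Proof.
have -> : fser_sum A m z *m fser_sum H m z =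
    \sum_(j < m) \sum_(i < m) z ^- (i + j) *: (A j *m H i).
  rewrite mulmx_suml; apply: eq_bigr => j _; rewrite mulmx_sumr.
  apply: eq_bigr => i _; rewrite -scalemxAl -scalemxAr scalerA.
  by rewrite addnC exprD invfM.
have -> : \sum_(q < m) z ^- q *: fser_mul A H q =
    \sum_(j < m) \sum_(i < m | (i + j < m)%N) z ^- (i + j) *: (A j *m H i).
  transitivity (\sum_(q < m) \sum_(j < m | (j <= q)%N) z ^- q *: (A j *m H (q - j)%N)).
    apply: eq_bigr => q _; rewrite /fser_mul scaler_sumr.
    rewrite (big_ord_widen m (fun j => z ^- q *: (A j *m H (q - j)%N)) (ltn_ord q)).
    by apply: eq_bigl => j; rewrite ltnS.
  rewrite (exchange_big_dep predT)//=; apply: eq_bigr => j _.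
  rewrite -(big_geq_mkord j m xpredT (fun q => z ^- q *: (A j *m H (q - j)%N))).
  rewrite -{1}[nat_of_ord j]add0n big_addn.
  rewrite (big_mkord xpredT (fun i => z ^- (i + j) *: (A j *m H (i + j - j)%N))).
  rewrite (big_ord_widen m (fun i => z ^- (i + j) *: (A j *m H (i + j - j)%N)) (leq_subr j m)).
  apply: eq_big => [i|i _]; last by rewrite addnK.
  by rewrite ltn_subRL addnC.
rewrite -big_split/=; apply: eq_bigr => j _.
rewrite (bigID (fun i : 'I_m => (i + j < m)%N))/=; congr (_ + _).
by apply: eq_bigl => i; rewrite -leqNgt.
Qed.

Lemma fser_dsumE H m z :
  fser_dsum H m z = \sum_(q < m) z ^- q *: fser_deriv H q + z ^- m *: fser_deriv H m.
Proof.
rewrite -(big_ord_recr m (fun q => z ^- q *: fser_deriv H q)) big_ord_recl/= scaler0 add0r.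
by apply: eq_bigr => j _; rewrite /bump /= add1n scalerN scalerA scaleNr mulrC.
Qed.

(** Multiplication by B / z raises the degree by one, so the coefficient of index m - 1 spills over
    into degree m. Differentiation causes the same overshoot in [fser_dsumE]. *)
Lemma fser_logderE H u b m z : (0 < m)%N -> z != 0 ->
  fser_sum H m z *m (diag_mx u + z^-1 *: diag_mx b) =
  \sum_(q < m) z ^- q *: fser_mul H (fser_logder u b) q
    + z ^- m *: (H m.-1 *m diag_mx b).
Proof.
case: m => // m _ z0; rewrite mulmxDr.
have -> : \sum_(q < m.+1) z ^- q *: fser_mul H (fser_logder u b) q =
    \sum_(q < m.+1) z ^- q *: (H q *m diag_mx u) + \sum_(q < m) z ^- q.+1 *: (H q *m diag_mx b).
  rewrite [LHS]big_ord_recl [X in _ = X + _]big_ord_recl -addrA /=; congr (_ *: _ + _).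
    by rewrite /fser_mul big_ord_recl big_ord0 addr0.
  rewrite -big_split/=; apply: eq_bigr => q _; rewrite -scalerDr; congr (_ *: _).
  rewrite /fser_mul big_ord_recr/= big_ord_recr/= big1; last first.
    move=> i _ /=; rewrite /bump leq0n add1n.
    by rewrite subSn ?(ltnW (ltn_ord i))// -(subnSK (ltn_ord i)) mulmx0.
  by rewrite /bump leq0n add1n /= subnn subSnn add0r addrC.
rewrite -addrA -[X in _ + (_ + X)]/((fun q : nat => z ^- q.+1 *: (H q *m diag_mx b)) m).
rewrite -(big_ord_recr m (fun q => z ^- q.+1 *: (H q *m diag_mx b))) /fser_sum !mulmx_suml.
congr (_ + _); apply: eq_bigr => q _; rewrite -!scalemxAl//.
by rewrite -scalemxAr scalerA exprSr invfM.
Qed.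

(** The formal equation cancels every degree below m. What remains is the tail of A, the overflow of
    the product and the spill into degree m. *)
Lemma residualE A H u b m z Az : (0 < m)%N -> z != 0 -> formal_solution A H u b ->
  residual Az H u b m z = (Az - fser_sum A m z) *m fser_sum H m z
    + \sum_(j < m) \sum_(i < m | (m <= i + j)%N) z ^- (i + j) *: (A j *m H i)
    - z ^- m *: (fser_deriv H m + H m.-1 *m diag_mx b).
Proof.
move=> m0 z0 formal; rewrite /residual mulmxBl fser_mulE fser_dsumE fser_logderE//.
have -> : \sum_(q < m) z ^- q *: fser_mul A H q = \sum_(q < m) z ^- q *: fser_deriv H q +
    \sum_(q < m) z ^- q *: fser_mul H (fser_logder u b) q.
  by rewrite -big_split; apply: eq_bigr => q _; rewrite -formal scalerDr.
rewrite scalerDr.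
set X := Az *m _; set a1 := \sum_(q < m) _; set a2 := \sum_(q < m) _.
set a3 := \sum_(j < m) _; set c1 := z ^- m *: _; set c2 := z ^- m *: _.
rewrite !opprD !addrA; apply/matrixP => i j; rewrite !mxE; ring.
Qed.

(** K depends only on n, m and c: this is the source of uniformity in the deformation parameter. *)
Lemma residual_bound (m : nat) (c : R) : (0 < m)%N -> 0 <= c -> exists2 K, 0 <= K &
  forall A H u b z Az, 1 <= normc z -> formal_solution A H u b ->
  (forall j, (j < m)%N -> mxle (A j) c) -> (forall j, (j < m)%N -> mxle (H j) c) ->
  (forall a, normc (b 0 a) <= c) ->
  mxle (Az - fser_sum A m z) (c / normc z ^+ m) ->
  mxle (residual Az H u b m z) (K / normc z ^+ m).
Proof.
move=> m0 c0.
(* One constant for each of the three terms of [residualE]. *)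
pose K1 := n%:R * (c * (m%:R * c)).
pose K2 := m%:R * (m%:R * (n%:R * (c * c))).
pose K3 := m%:R * c + n%:R * (c * c).
exists (K1 + K2 + K3); first by rewrite !addr_ge0 ?mulr_ge0.
move=> A H u b z Az z1 formal hA hH hb hAz.
have zgt0 : 0 < normc z by apply: lt_le_trans z1.
have z0 : z != 0 by rewrite -normc_eq0 lt0r_neq0.
have znv j : normc (z ^- j) = (normc z ^+ j)^-1 by rewrite Normc.normcV normcX.
have zp j : 0 < normc z ^+ j by rewrite exprn_gt0.
have zle j : (m <= j)%N -> normc (z ^- j) <= (normc z ^+ m)^-1.
  by move=> mj; rewrite znv lef_pV2 ?posrE//; apply: ler_weXn2l.
have zle1 j : normc (z ^- j) <= 1 by rewrite znv invf_le1// exprn_ege1.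
have hP : mxle (fser_sum H m z) (m%:R * c).
  have -> : m%:R * c = \sum_(j < m) c by rewrite sumr_const card_ord mulr_natl.
  apply: mxle_sum => j _; rewrite -[c]mul1r.
  by apply: mxleZ; [exact: zle1|exact: hH].
rewrite (residualE (A := A))// !mulrDl; apply: mxleB; first apply: mxleD.
- apply: mxle_trans (mxleM hAz hP) _; rewrite le_eqVlt; apply/orP; left; apply/eqP.
  by rewrite /K1; ring.
- have -> : K2 / normc z ^+ m = \sum_(j < m) \sum_(i < m) (normc z ^+ m)^-1 * (n%:R * (c * c)).
    rewrite (eq_bigr _ (fun i _ => sumr_const _ _)) sumr_const !card_ord.
    by rewrite -mulrnA -[RHS]mulr_natl natrM /K2; ring.
  apply: mxle_sum => j _; rewrite big_mkcond/=; apply: mxle_sum => i _.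
  case: ifP => hm; last by apply: mxle0; rewrite !mulr_ge0 ?invr_ge0// ltW.
  apply: mxleZ; first exact: zle.
  by apply: mxleM; [exact: hA|exact: hH].
- rewrite /K3 -mulrDl [X in mxle _ X]mulrC; apply: mxleZ; first exact: zle.
  apply: mxleD; last first.
    apply: mxleM; first by apply: hH; case: (m) m0.
    move=> i j; rewrite mxE; case: eqP => _; last by rewrite Normc.normc0.
    by rewrite mulr1n; exact: hb.
  case: m m0 {K1 K2 K3 zle hP} hA hH hAz => // k _ hA hH hAz /=; apply: mxleN; apply: mxleZ.
    have -> : (k%:R : C) = (k%:R : R)%:C by rewrite rmorph_nat.
    by rewrite normc_real ger0_norm// ler_nat.
  exact: hH.
Qed.

End Residual.

(** * The equation for the quotient of a solution by the truncated formal one *)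

Section Conjugation.
Variables (R : realType) (n : nat).
Local Notation C := R[i].
Implicit Types (u b : 'rV[C]_n).

Lemma diag_expD (d e : 'rV[C]_n) : diag_exp d *m diag_exp e = diag_exp (d + e).
Proof.
apply/matrixP => i j; rewrite mul_diag_mx !mxE cexpD.
by case: eqP => [->|_]; rewrite ?mulr1n// !mulr0n mulr0.
Qed.

Lemma diag_exp0 : diag_exp (0 : 'rV[C]_n) = 1%:M.
Proof. by apply/matrixP => i j; rewrite !mxE cexp0. Qed.

Lemma zpowNK b l : zpow (- b) l *m zpow b l = 1%:M.
Proof. by rewrite diag_expD -scalerDr addNr scaler0 diag_exp0. Qed.

Lemma zpowKN b l : zpow b l *m zpow (- b) l = 1%:M.
Proof. by rewrite diag_expD -scalerDr subrr scaler0 diag_exp0. Qed.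

Lemma expzNK u l : expz (- u) l *m expz u l = 1%:M.
Proof. by rewrite diag_expD -scalerDr addNr scaler0 diag_exp0. Qed.

Lemma expzKN u l : expz u l *m expz (- u) l = 1%:M.
Proof. by rewrite diag_expD -scalerDr subrr scaler0 diag_exp0. Qed.

Lemma zpow_expzC b u l : zpow b l *m expz u l = expz u l *m zpow b l.
Proof. by rewrite !diag_expD addrC. Qed.

Lemma mul_diag_conj (d e : 'rV[C]_n) (X : 'M[C]_n) a c :
  (diag_exp d *m X *m diag_exp e) a c = cexp (d 0 a) * X a c * cexp (e 0 c).
Proof. by rewrite mul_mx_diag mxE mul_diag_mx !mxE. Qed.

Lemma mderiv_diag_exp (f : R -> 'rV[C]_n) s d : mderiv f s d ->
  mderiv (fun r => diag_exp (f r)) s (diag_mx d *m diag_exp (f s)).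
Proof.
move=> fd.
have : mderiv (fun r => map_mx (@cexp R) (f r)) s (\row_a (cexp (f s 0 a) * d 0 a)).
  move=> i a; rewrite ord1 mxE; under [X in cderiv X]funext do rewrite mxE.
  exact: cderiv_cexp.
move=> /mderiv_diag h; apply: mderiv_eq h _.
rewrite mulmx_diag; congr diag_mx; apply/rowP => a; rewrite !mxE.
by rewrite mulrC.
Qed.

(** The left side is the product rule for z^-B P^-1 Y e^(-Lambda z), with V = P^-1, [zN] = z^-B,
    [zB] = z^B, [eN] = e^(-Lambda z) and [zi] = 1/z. Inserting P Lambda once with each sign yields
    the commutator with Lambda, and the rest is the residual. *)
Lemma conjugated_algebra (P V P' Az Ys zN zB eN U B : 'M[C]_n) (d dz zi : C) :
  V *m P = 1%:M -> P *m V = 1%:M -> zB *m zN = 1%:M ->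
  zN *m U = U *m zN -> zN *m B = B *m zN -> eN *m U = U *m eN -> d = dz * zi ->
  (((d *: (- B *m zN)) *m V + zN *m (- (V *m (dz *: P') *m V))) *m Ys
     + zN *m V *m (dz *: (Az *m Ys))) *m eN + zN *m V *m Ys *m (dz *: (- U *m eN)) =
  dz *: (U *m (zN *m V *m Ys *m eN) - zN *m V *m Ys *m eN *m U) +
  (dz *: (zN *m V *m (Az *m P - P' - P *m (U + zi *: B)) *m zB))
    *m (zN *m V *m Ys *m eN).
Proof.
move=> VP PV zBN zNU zNB eNU ->.
set X := V *m Ys *m eN.
have PX : P *m X = Ys *m eN by rewrite /X !mulmxA PV mul1mx.
have QX : zN *m V *m Ys *m eN = zN *m X by rewrite /X !mulmxA.
have t1 : (dz * zi) *: (- B *m zN) *m V *m Ys *m eN = - (dz *: (zi *: (zN *m B *m X))).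
  by rewrite scalerA !mulNmx scalerN !mulNmx -!scalemxAl zNB /X !mulmxA.
have t2 : zN *m (- (V *m (dz *: P') *m V)) *m Ys *m eN = - (dz *: (zN *m V *m P' *m X)).
  by rewrite mulmxN !mulNmx -!scalemxAr -!scalemxAl -!scalemxAr -!scalemxAl /X !mulmxA.
have t3 : zN *m V *m (dz *: (Az *m Ys)) *m eN = dz *: (zN *m V *m Az *m Ys *m eN).
  by rewrite -scalemxAr -scalemxAl !mulmxA.
have t4 : zN *m V *m Ys *m (dz *: (- U *m eN)) = - (dz *: (zN *m X *m U)).
  rewrite -scalemxAr mulNmx mulmxN scalerN -eNU /X !mulmxA.
  by [].
have t5 : zN *m V *m (Az *m P - P' - P *m (U + zi *: B)) *m zB *m (zN *m X) =
    zN *m V *m Az *m Ys *m eN - zN *m V *m P' *m X - zN *m U *m X - zi *: (zN *m B *m X).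
  rewrite mulmxA -(mulmxA _ zB zN) zBN mulmx1 !mulmxBr !mulmxBl.
  have -> : zN *m V *m (Az *m P) *m X = zN *m V *m Az *m Ys *m eN.
    by rewrite -!mulmxA PX.
  have -> : zN *m V *m (P *m (U + zi *: B)) *m X = zN *m U *m X + zi *: (zN *m B *m X).
    rewrite -(mulmxA zN V) (mulmxA V P) VP mul1mx mulmxDr mulmxDl.
    by rewrite -scalemxAr -scalemxAl.
  by rewrite opprD addrA.
rewrite QX -[(dz *: _) *m (zN *m X)]scalemxAl t5 !mulmxDl t1 t2 t3 t4 !mulmxA -zNU -scalerDr.
move: (zi *: _) (_ *m P' *m V *m Ys *m eN) (_ *m Az *m Ys *m eN)
  (zN *m U *m V *m Ys *m eN) (_ *m eN *m U) => a1 a2 a3 a4 a5.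
by apply/matrixP => i j; rewrite !mxE; ring.
Qed.

Variables (g : R -> C) (s : R) (d : C).
Hypothesis dg : cderiv g s d.
Local Notation z := (cexp (g s)).
Local Notation dz := (cexp (g s) * d).

Lemma mderiv_zpow b :
  mderiv (fun r => zpow b (g r)) s (d *: (diag_mx b *m zpow b (g s))).
Proof.
have h : mderiv (fun r => g r *: b) s (d *: b) by exact: mderivZ.
apply: mderiv_eq (mderiv_diag_exp h) _.
by rewrite linearZ/= -scalemxAl.
Qed.

Lemma mderiv_expz u :
  mderiv (fun r => expz u (g r)) s (dz *: (diag_mx u *m expz u (g s))).
Proof.
have h : mderiv (fun r => cover_proj (g r) *: u) s (dz *: u).
  by apply: mderivZ; exact: cderiv_cexp.
apply: mderiv_eq (mderiv_diag_exp h) _.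
by rewrite linearZ/= -scalemxAl.
Qed.

Lemma mderiv_fser_sum (H : nat -> 'M[C]_n) m :
  mderiv (fun r => fser_sum H m (cexp (g r))) s (dz *: fser_dsum H m z).
Proof.
rewrite /fser_dsum scaler_sumr; apply: mderiv_sum => j _; rewrite scalerA.
apply: mderivZ.
rewrite (_ : (fun r => _) = (fun r => cexp (- j%:R * g r))); last first.
  by apply/funext => r; rewrite mulNr cexpN cexpMn.
apply: cderiv_eq (cderiv_cexp (cderivZ _ dg)) _.
have z0 : z != 0 := cexp_neq0 _.
rewrite mulNr cexpN cexpMn exprS invfM; field.
by rewrite z0 expf_neq0.
Qed.

(** Diagonal matrices commute, so this is e^(Lambda z) (P z^B e^(Lambda z))^-1 Y e^(-Lambda z): the
    quotient of Y by the truncated formal solution, conjugated by e^(Lambda z). A factor C on the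
    right of Y becomes e^(Lambda z) C e^(-Lambda z). *)
Definition conjugated (P : 'M[C]_n) u b (Yl : 'M[C]_n) l : 'M[C]_n :=
  zpow (- b) l *m invmx P *m Yl *m expz (- u) l.

Lemma mderiv_conjugated (Y : R -> 'M[C]_n) (H : nat -> 'M[C]_n) u b m (Az : 'M[C]_n) :
  (forall r, fser_sum H m (cexp (g r)) \in unitmx) ->
  mderiv Y s (dz *: (Az *m Y s)) ->
  let Q r := conjugated (fser_sum H m (cexp (g r))) u b (Y r) (g r) in
  mderiv Q s (\matrix_(a, c) (dz * (u 0 a - u 0 c) * Q s a c) +
    (dz *: (zpow (- b) (g s) *m invmx (fser_sum H m z) *m residual Az H u b m z
      *m zpow b (g s))) *m Q s).
Proof.
move=> uP dY Q.
have dP := mderiv_invmx uP (mderiv_fser_sum H m).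
apply: mderiv_eq (mderivM (mderivM (mderivM (mderiv_zpow (- b)) dP) dY) (mderiv_expz (- u))) _.
have -> : \matrix_(a, c) (dz * (u 0 a - u 0 c) * Q s a c) =
    dz *: (diag_mx u *m Q s - Q s *m diag_mx u).
  by apply/matrixP => a c; rewrite mul_diag_mx mul_mx_diag !mxE; ring.
have -> : diag_mx (- b) = - diag_mx b by rewrite linearN.
have -> : diag_mx (- u) = - diag_mx u by rewrite linearN.
apply: conjugated_algebra.
- by rewrite mulVmx//; exact: uP.
- by rewrite mulmxV//; exact: uP.
- exact: zpowKN.
- by rewrite !mulmx_diag; congr diag_mx; apply/rowP => a; rewrite !mxE mulrC.
- by rewrite !mulmx_diag; congr diag_mx; apply/rowP => a; rewrite !mxE mulrC.
- by rewrite !mulmx_diag; congr diag_mx; apply/rowP => a; rewrite !mxE mulrC.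
- by rewrite mulrC mulKf// cexp_neq0.
Qed.

End Conjugation.

(** * The line of integration *)

Section Line.
Variable R : realType.
Local Notation C := R[i].
Variables (N h : R).
Hypothesis N0 : 0 < N.

(* A logarithm of z = cis h * (s - i N): the line through the half plane
   h - pi < arg z < h, parallel to its boundary. *)
Definition line_log (s : R) : C :=
  (2^-1 * ln (N ^+ 2 + s ^+ 2)) +i* (h - pi / 2 + atan (s / N)).

Let y0 s : 0 < N ^+ 2 + s ^+ 2.
Proof. by rewrite ltr_wpDr ?sqr_ge0// exprn_gt0. Qed.

(** The value is 1 / (s - i N), the logarithmic derivative of z. *)
Lemma cderiv_line_log s :
  cderiv line_log s ((s / (N ^+ 2 + s ^+ 2)) +i* (N / (N ^+ 2 + s ^+ 2))).
Proof.
split=> /=.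
  have d1 : is_derive s 1 (fun r : R => N ^+ 2 + r ^+ 2) (2 * s).
    rewrite (_ : (fun r => _) = cst (N ^+ 2) + (fun r : R => r) * (fun r : R => r)).
      apply: (is_derive_eq (is_deriveD (is_derive_cst (N ^+ 2) s 1)
        (is_deriveM (is_derive_id s 1) (is_derive_id s 1)))).
      by rewrite /GRing.scale/= add0r !mulr1 mulr_natl.
    by apply/funext => r; rewrite !fctE expr2.
  have dl := is_derive1_ln (y0 s).
  have d2 : is_derive s 1 (@ln R \o (fun r : R => N ^+ 2 + r ^+ 2)) ((N ^+ 2 + s ^+ 2)^-1 * (2 * s)).
    exact: is_derive1_comp.
  apply: (is_derive_eq (is_deriveZ 2^-1 d2)).
  by rewrite /GRing.scale/= mulrCA mulKf// mulrC.
have d1 := is_derive_atan_scaled N s N0.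
rewrite (_ : (fun r => _) = cst (h - pi / 2) + (fun r => N / N * atan (r / N))).
  apply: (is_derive_eq (is_deriveD (is_derive_cst (h - pi / 2) s 1) d1)).
  by rewrite add0r.
by apply/funext => r; rewrite !fctE divff ?mul1r// lt0r_neq0.
Qed.

Let rho s : R := expR (2^-1 * ln (N ^+ 2 + s ^+ 2)).

Let rho2 s : rho s ^+ 2 = N ^+ 2 + s ^+ 2.
Proof. by rewrite /rho -expRM_natl mulrA mulfV// mul1r lnK ?posrE. Qed.

Lemma normc_line_sqr s : normc (cexp (line_log s)) ^+ 2 = N ^+ 2 + s ^+ 2.
Proof. by rewrite normc_cexp /= rho2. Qed.

Lemma cexp_line_log s : cexp (line_log s) = cis h * (s +i* (- N)).
Proof.
have r0 : rho s != 0 by rewrite lt0r_neq0// expR_gt0.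
have cosE : cos (atan (s / N)) = N / rho s.
  rewrite cos_atan.
  have -> : 1 + (s / N) ^+ 2 = (rho s / N) ^+ 2.
    by rewrite !expr_div_n rho2; field; rewrite lt0r_neq0.
  by rewrite sqrtr_sqr ger0_norm ?invf_div// divr_ge0 ?expR_ge0// ltW.
have sinE : sin (atan (s / N)) = s / rho s.
  have := atanK (s / N); rewrite /tan cosE => /(congr1 ( *%R^~ (N / rho s))).
  rewrite mulfVK; last by rewrite mulf_neq0// ?invr_neq0// lt0r_neq0.
  by move=> ->; rewrite mulrA divfK// lt0r_neq0.
rewrite /cis /cexp /= -/(rho s) expR0 !mul1r.
have -> : h - pi / 2 + atan (s / N) = (h + atan (s / N)) - pi / 2 by ring.
rewrite cosBpihalf sinBpihalf sinD cosD cosE sinE.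
by apply/eqP; rewrite eq_complex /=; apply/andP; split; apply/eqP; field.
Qed.

(** The velocity dz/ds is constant, so the coefficients (u_a - u_b) dz/ds in the equation for Q do
    not depend on s, as [dichotomy] requires. *)
Lemma line_speed s :
  cexp (line_log s) * ((s / (N ^+ 2 + s ^+ 2)) +i* (N / (N ^+ 2 + s ^+ 2))) = cis h.
Proof.
rewrite cexp_line_log -mulrA -[RHS]mulr1; congr (_ * _).
have y1 := y0 s.
by apply/eqP; rewrite eq_complex /=; apply/andP; split; apply/eqP; field; rewrite lt0r_neq0.
Qed.

Lemma normc_line_ge s : N <= normc (cexp (line_log s)).
Proof.
rewrite -ler_sqr ?nnegrE ?normc_ge0 ?(ltW N0)// normc_line_sqr.
by rewrite lerDl sqr_ge0.
Qed.

Lemma normc_line_ge_abs s : `|s| <= normc (cexp (line_log s)).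
Proof.
rewrite -ler_sqr ?nnegrE ?normc_ge0// normc_line_sqr real_normK ?num_real//.
by rewrite lerDr sqr_ge0.
Qed.

Lemma line_log_sector s : closed_sector (h - pi) h (line_log s).
Proof.
rewrite /closed_sector /cover_arg /=.
by have := atan_ltpi2 (s / N); have := atan_gtNpi2 (s / N); split; lra.
Qed.

End Line.

(** * Growth of powers of z on the covering *)

Section PowerBounds.
Variable R : realType.
Local Notation C := R[i].

Lemma normc_cover_abs (l : C) : normc (cexp l) = cover_abs l.
Proof. exact: normc_cexp. Qed.

(** |z^w| = exp (ln |z| Re w - arg z Im w): the first term gives the power of |z|, and a bounded
    argument turns the second into a constant. *)
Lemma normc_zpow_le (l w : C) (p : nat) (T : R) : normc w <= p%:R ->
  1 <= normc (cexp l) -> `|Im l| <= T ->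
  normc (cexp (l * w)) <= expR (p%:R * T) * normc (cexp l) ^+ p.
Proof.
move=> wp l1 lT; rewrite !normc_cexp -expRM_natl -expRD ler_expR ReM.
have Rl : 0 <= Re l by rewrite -(ler_expR 0) expR0 -normc_cexp.
have h1 : Re l * Re w <= p%:R * Re l.
  rewrite mulrC ler_wpM2r//; apply: le_trans (ler_norm _) (le_trans (Re_le_normc w) wp).
have h2 : - (Im l * Im w) <= p%:R * T.
  apply: le_trans (ler_norm _) _; rewrite normrN normrM mulrC.
  by apply: ler_pM => //; exact: le_trans (Im_le_normc w) wp.
by rewrite addrC lerD.
Qed.

Variable n : nat.
Implicit Types (u b : 'rV[C]_n) (P X : 'M[C]_n).

(** Each of z^-B and z^B costs |z|^p, so order 2 p + 2 before conjugation leaves order 2 after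
    it. *)
Lemma zpow_conj_bound b l X (p : nat) (T K : R) :
  (forall a, normc (b 0 a) <= p%:R) -> 1 <= normc (cexp l) -> `|Im l| <= T ->
  mxle X (K / normc (cexp l) ^+ (2 * p + 2)) ->
  mxle (zpow (- b) l *m X *m zpow b l)
    (expR (p%:R * T) ^+ 2 * K / normc (cexp l) ^+ 2).
Proof.
move=> hb l1 lT hX i j; rewrite mul_diag_conj !mxE !Normc.normcM.
have z0 : 0 < normc (cexp l) by apply: lt_le_trans l1.
have b1 : normc (cexp (l * - b 0 i)) <= expR (p%:R * T) * normc (cexp l) ^+ p.
  by apply: normc_zpow_le => //; rewrite normcN.
have b2 := normc_zpow_le (hb j) l1 lT.
apply: le_trans (_ : (expR (p%:R * T) * normc (cexp l) ^+ p) * (K / normc (cexp l) ^+ (2 * p + 2)) *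
   (expR (p%:R * T) * normc (cexp l) ^+ p) <= _).
  apply: ler_pM => //; rewrite ?mulr_ge0 ?normc_ge0//.
  by apply: ler_pM => //; rewrite ?normc_ge0.
rewrite exprD mulnC exprM le_eqVlt; apply/orP; left; apply/eqP; field.
by rewrite expf_neq0 ?andbT lt0r_neq0.
Qed.

(** Q - I = z^-B P^-1 (Y z^-B e^(-Lambda z) - P) z^B, which reduces the claim to the error of the
    asymptotic expansion. *)
Lemma conjugated_near1 P u b (Yl : 'M[C]_n) l (p : nat) (T K : R) :
  P \in unitmx -> mxle (invmx P) 2 -> (forall a, normc (b 0 a) <= p%:R) ->
  1 <= normc (cexp l) -> `|Im l| <= T ->
  mxle (Yl *m zpow (- b) l *m expz (- u) l - P) (K / normc (cexp l) ^+ (2 * p + 2)) ->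
  mxle (conjugated P u b Yl l - 1%:M)
    (expR (p%:R * T) ^+ 2 * (n%:R * 2 * K) / normc (cexp l) ^+ 2).
Proof.
move=> uP P2 hb l1 lT hY.
have -> : conjugated P u b Yl l - 1%:M = zpow (- b) l *m
    (invmx P *m (Yl *m zpow (- b) l *m expz (- u) l - P)) *m zpow b l.
  rewrite mulmxBr mulVmx// mulmxBr mulmxBl mulmx1 zpowNK; congr (_ - _).
  have e : zpow (- b) l *m expz (- u) l *m zpow b l = expz (- u) l.
    by rewrite zpow_expzC -mulmxA zpowNK mulmx1.
  by rewrite /conjugated -{1}e !mulmxA.
apply: zpow_conj_bound => //; apply: mxle_trans (mxleM P2 hY) _.
by rewrite !mulrA.
Qed.

End PowerBounds.

(** * Limits of matrices along a filter *)

Section MatrixLimits.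
Variable R : realType.
Local Notation C := R[i].
Variables (T : Type) (F : set_system T).
Context {FF : Filter F}.

Definition mlim (m n : nat) (M : T -> 'M[C]_(m, n)) (L : 'M[C]_(m, n)) :=
  forall e : R, 0 < e -> \forall x \near F, mxle (M x - L) e.

Lemma mxle_bound (m n : nat) (L : 'M[C]_(m, n)) : exists2 B, 0 <= B & mxle L B.
Proof.
exists (\sum_i \sum_j normc (L i j)).
  by apply: sumr_ge0 => i _; apply: sumr_ge0 => j _; exact: normc_ge0.
move=> i j; rewrite (bigD1 i)//= (bigD1 j)//= -addrA lerDl addr_ge0//.
  by rewrite sumr_ge0// => k _; exact: normc_ge0.
by rewrite sumr_ge0// => k _; rewrite sumr_ge0// => l _; exact: normc_ge0.
Qed.

Lemma mlim_cst (m n : nat) (L : 'M[C]_(m, n)) : mlim (fun=> L) L.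
Proof. by move=> e e0; near=> x; rewrite subrr; apply: mxle0; exact: ltW.
Unshelve. all: by end_near. Qed.

Lemma mlimD (m n : nat) (M M' : T -> 'M[C]_(m, n)) L L' :
  mlim M L -> mlim M' L' -> mlim (fun x => M x + M' x) (L + L').
Proof.
move=> hM hM' e e0; have e2 : 0 < e / 2 by rewrite divr_gt0.
near=> x; rewrite opprD addrACA (splitr e); apply: mxleD; near: x.
  exact: hM.
exact: hM'.
Unshelve. all: by end_near. Qed.

Lemma mlimM (m n p : nat) (M : T -> 'M[C]_(m, n)) (M' : T -> 'M[C]_(n, p)) L L' :
  mlim M L -> mlim M' L' -> mlim (fun x => M x *m M' x) (L *m L').
Proof.
move=> hM hM' e e0.
have [B B0 hB] := mxle_bound L; have [B' B'0 hB'] := mxle_bound L'.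
pose D := n%:R * (B' + 1) + n%:R * B + 1.
have D0 : 0 < D by rewrite ltr_wpDl// addr_ge0// mulr_ge0// addr_ge0.
pose d := Num.min 1 (e / D).
have d0 : 0 < d by rewrite lt_min ltr01 divr_gt0.
near=> x.
have h1 : mxle (M x - L) d by near: x; exact: hM.
have h2 : mxle (M' x - L') d by near: x; exact: hM'.
have h3 : mxle (M' x) (B' + 1).
  rewrite -[M' x](subrK L') addrC; apply: mxleD => //; apply: mxle_trans h2 _.
  by rewrite ge_min lexx.
have -> : M x *m M' x - L *m L' = (M x - L) *m M' x + L *m (M' x - L').
  by rewrite mulmxBl mulmxBr addrA subrK.
apply: mxle_trans (mxleD (mxleM h1 h3) (mxleM hB h2)) _.
apply: le_trans (_ : D * d <= _).
  rewrite /D -subr_ge0.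
  have -> : (n%:R * (B' + 1) + n%:R * B + 1) * d - (n%:R * (d * (B' + 1)) + n%:R * (B * d)) = d by ring.
  exact: ltW.
by rewrite mulrC -ler_pdivlMr// ge_min lexx orbT.
Unshelve. all: by end_near. Qed.

Lemma mlim_sum (I : Type) (r : seq I) (m n : nat) (M : I -> T -> 'M[C]_(m, n)) L :
  (forall i, mlim (M i) (L i)) ->
  mlim (fun x => \sum_(i <- r) M i x) (\sum_(i <- r) L i).
Proof.
move=> h; elim: r => [|i r IH].
  rewrite big_nil; under [X in mlim X]funext => x do rewrite big_nil.
  exact: mlim_cst.
rewrite big_cons; under [X in mlim X]funext => x do rewrite big_cons.
exact: mlimD.
Qed.

Lemma mlimZ (m n : nat) (c : C) (M : T -> 'M[C]_(m, n)) L :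
  mlim M L -> mlim (fun x => c *: M x) (c *: L).
Proof.
move=> h; have := mlimM (mlim_cst (c%:M : 'M[C]_m)) h; rewrite mul_scalar_mx.
suff -> : (fun x => c%:M *m M x) = (fun x => c *: M x) by [].
by apply/funext => x; rewrite mul_scalar_mx.
Qed.

(** M^-1 - L^-1 = - M^-1 (M - L) L^-1; the bound on M^-1 is of the kind that [unitmx_near1]
    provides. *)
Lemma mlim_invmx (n : nat) (M : T -> 'M[C]_n) L :
  mlim M L -> L \in unitmx -> (\forall x \near F, M x \in unitmx /\ mxle (invmx (M x)) 2) ->
  mlim (fun x => invmx (M x)) (invmx L).
Proof.
move=> hM uL near2 e e0.
have [B B0 hB] := mxle_bound (invmx L).
pose D := n%:R * (n%:R * 2 * B) + 1.
have D0 : 0 < D by rewrite ltr_wpDl// !mulr_ge0.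
have d0 : 0 < e / D by rewrite divr_gt0.
near=> x.
have [uM M2] : M x \in unitmx /\ mxle (invmx (M x)) 2 by near: x.
have h : mxle (M x - L) (e / D) by near: x; exact: hM.
have -> : invmx (M x) - invmx L = - (invmx (M x) *m (M x - L) *m invmx L).
  by rewrite mulmxBr mulVmx// mulmxBl mul1mx -mulmxA mulmxV// mulmx1 opprB.
apply: mxleN; apply: mxle_trans (mxleM (mxleM M2 h) hB) _.
apply: le_trans (_ : D * (e / D) <= _); last by rewrite mulrC divfK// lt0r_neq0.
rewrite -subr_ge0.
have -> : D * (e / D) - n%:R * (n%:R * (2 * (e / D)) * B) = e / D by rewrite /D; ring.
exact: ltW.
Unshelve. all: by end_near. Qed.

Lemma cexp_lipschitz (w v : C) : normc (v - w) <= 1 ->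
  normc (cexp v - cexp w) <= expR (Re w + 1) * normc (v - w).
Proof.
move=> vw; pose f (s : R) := cexp (w + (v - w) * s%:C).
have df s : cderiv f s (cexp (w + (v - w) * s%:C) * (v - w)).
  apply: cderiv_cexp; rewrite -[X in cderiv _ _ X]add0r; apply: cderivD; first exact: cderiv_cst.
  by apply: cderiv_eq (cderivZ _ (cderiv_id s)) _; rewrite mulr1.
pose K := expR (Re w + 1) * normc (v - w).
have dg (s : R) : is_derive s 1 (fun r : R => K *: r) K.
  by apply: (is_derive_eq (is_deriveZ K (is_derive_id s 1))); rewrite /GRing.scale/= mulr1.
have := @cderiv_mean_value _ f _ _ _ 0 1 ler01 df dg.
have -> : f 1 = cexp v by rewrite /f rmorph1 mulr1 addrC subrK.
have -> : f 0 = cexp w by rewrite /f rmorph0 mulr0 addr0.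
rewrite /GRing.scale/= mulr1 mulr0 subr0; apply.
move=> s /andP[s0 s1]; rewrite Normc.normcM /K ler_wpM2r ?normc_ge0//.
rewrite normc_cexp ler_expR ReD lerD2l; apply: le_trans (ler_norm _) _.
apply: le_trans (Re_le_normc _) _; rewrite Normc.normcM normc_real ger0_norm//.
by rewrite -[1]mulr1; apply: ler_pM; rewrite ?normc_ge0.
Qed.

Lemma mlim_diag_exp (n : nat) (d : T -> 'rV[C]_n) d0 :
  mlim d d0 -> mlim (fun x => diag_exp (d x)) (diag_exp d0).
Proof.
move=> hd e e0.
have [B B0 hB] := mxle_bound d0.
pose D := expR (B + 1).
have D0 : 0 < D := expR_gt0 _.
pose r := Num.min 1 (e / D).
have r0 : 0 < r by rewrite lt_min ltr01 divr_gt0.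
near=> x.
have h : mxle (d x - d0) r by near: x; exact: hd.
move=> i j; rewrite !mxE; have [->|_] := eqVneq i j; last first.
  by rewrite !mulr0n subrr Normc.normc0 ltW.
rewrite !mulr1n; have := h 0 j; rewrite !mxE => hj.
apply: le_trans (cexp_lipschitz _) _.
  by apply: le_trans hj _; rewrite ge_min lexx.
apply: le_trans (_ : D * r <= _).
  apply: ler_pM; rewrite ?expR_ge0 ?normc_ge0// ler_expR lerD2r.
  exact: le_trans (ler_norm _) (le_trans (Re_le_normc _) (hB 0 j)).
by rewrite mulrC -ler_pdivlMr// ge_min lexx orbT.
Unshelve. all: by end_near. Qed.

Lemma mlim_entry_le (m n : nat) (M : T -> 'M[C]_(m, n)) L i j (w : C) (B : R) :
  ProperFilter F -> mlim M L -> (\forall x \near F, normc (M x i j - w) <= B) ->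
  normc (L i j - w) <= B.
Proof.
move=> PF hM hB; apply/ler_addgt0Pr => e e0.
have [x [h1 h2]] := filter_ex (filterI hB (hM e e0)).
have := h2 i j; rewrite !mxE => h3.
have -> : L i j - w = (M x i j - w) - (M x i j - L i j) by ring.
by apply: le_trans (normcD _ _) _; rewrite normcN lerD.
Qed.

Lemma mlim_unique (m n : nat) (M : T -> 'M[C]_(m, n)) L L' :
  ProperFilter F -> mlim M L -> mlim M L' -> L = L'.
Proof.
move=> PF h h'; apply/eqP; rewrite -subr_eq0; apply/eqP; apply: mxle_small => e e0 i j.
rewrite mxE [X in _ + X]mxE; apply: mlim_entry_le h _.
by have := h' e e0; apply: filterS => x hx; have := hx i j; rewrite !mxE.
Qed.

End MatrixLimits.

(** * Uniform bounds and the limit *)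

Section Uniqueness.
Variable R : realType.
Local Notation C := R[i].

Lemma near_all_lt (T : Type) (F : set_system T) {FF : Filter F} (m : nat) (P : nat -> T -> Prop) :
  (forall j, \forall x \near F, P j x) -> \forall x \near F, forall j, (j < m)%N -> P j x.
Proof.
move=> h; elim: m => [|m IH]; first by near=> x.
near=> x => j; rewrite ltnS leq_eqVlt => /orP[/eqP ->|].
  by near: x; exact: h.
by move: j; near: x.
Unshelve. all: by end_near. Qed.

Lemma fser_sum_near1 (n m : nat) (H : nat -> 'M[C]_n) (z : C) (e c e' : R) : (0 < m)%N ->
  1 <= normc z -> 0 <= c ->
  mxle (H 0%N - 1%:M) e -> (forall j, (j < m)%N -> mxle (H j) c) ->
  m%:R * c <= e' * normc z -> mxle (fser_sum H m z - 1%:M) (e + e').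
Proof.
case: m => // m _ z1 c0 h0 hH he.
have z0 : 0 < normc z by apply: lt_le_trans z1.
rewrite /fser_sum big_ord_recl expr0 invr1 scale1r addrAC; apply: mxleD => //.
apply: (@mxle_trans _ _ _ _ (\sum_(j < m) (normc z)^-1 * c)).
  apply: mxle_sum => j _; apply: mxleZ; last by apply: hH; rewrite /= /bump leq0n add1n ltnS.
  rewrite Normc.normcV normcX lef_pV2 ?posrE ?exprn_gt0//.
  by rewrite -[leLHS]expr1; apply: ler_weXn2l.
rewrite sumr_const card_ord -[_ *+ m]mulr_natl mulrCA mulrC ler_pdivrMr//.
apply: le_trans he; rewrite ler_wpM2r// ler_nat.
exact: leqnSn.
Qed.

Lemma insert_inverse (n : nat) (X V W e eN : 'M[C]_n) : eN *m e = 1%:M ->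
  X *m (V *m W) *m eN = X *m V *m eN *m (e *m W *m eN).
Proof. by move=> h; rewrite !mulmxA -(mulmxA _ eN e) h mulmx1. Qed.

Lemma atan_half_pi (x : R) :
  0 <= pi / 2 - atan x <= pi /\ 0 <= pi / 2 + atan x <= pi.
Proof.
have := atan_ltpi2 x; have := atan_gtNpi2 x.
by split; apply/andP; split; lra.
Qed.

Lemma line_log_Im (N h s : R) : `|Im (line_log N h s)| <= `|h| + pi.
Proof.
have [h1 h2] := line_log_sector N h s; rewrite /cover_arg in h1 h2.
have := ler_norm h; have := ler_norm (- h); rewrite normrN ler_norml => h3 h4.
have pi0 := @pi_ge0 R.
by apply/andP; split; lra.
Qed.

Lemma line_limit0 (N h K : R) : 0 < N -> 0 <= K -> forall e, 0 < e ->
  exists M, forall s, M <= `|s| -> K / normc (cexp (line_log N h s)) ^+ 2 <= e.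
Proof.
move=> N0 K0 e e0; exists (K / e + 1) => s hs.
have z := normc_line_ge_abs h N0 s; set w := normc _ in z *.
have M1 : 1 <= K / e + 1 by rewrite lerDr divr_ge0// ltW.
have w1 : 1 <= w by apply: le_trans M1 (le_trans hs z).
have w0 : 0 < w by apply: lt_le_trans w1.
rewrite ler_pdivrMr ?exprn_gt0// mulrC -ler_pdivrMr//.
apply: (@le_trans _ _ w); last by rewrite expr2 ler_peMl// ltW.
by apply: le_trans (le_trans hs z); rewrite lerDl.
Qed.

Lemma exp_bounded_eq0 (r c B M v : R) : 0 <= c -> r != 0 ->
  (forall s, M <= `|s| -> expR (r * s + v) * c <= B) -> c = 0.
Proof.
move=> c0 r0 h; apply/eqP; rewrite eq_le c0 andbT leNgt; apply/negP => c1.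
(* The point s solves r s = y. The first bound on y puts |s| beyond M, and the second makes exp (y +
   v) exceed B / c, through exp x >= 1 + x. *)
pose y := Num.max (`|r| * M) (B / c - v).
pose s := y / r.
have ry : r * s = y by rewrite /s mulrC divfK.
have sM : M <= `|s|.
  rewrite /s normrM normfV ler_pdivlMr ?normr_gt0// mulrC.
  by apply: le_trans (ler_norm y); rewrite /y le_max lexx.
have := h s sM; rewrite ry -ler_pdivlMr// leNgt => /negP; apply.
apply: lt_le_trans (expR_ge1Dx _); rewrite -ltrBlDl.
have : B / c - v <= y by rewrite /y le_max lexx orbT.
lra.
Qed.

Variables (n : nat) (N0 hi : R).
Variables (A : R -> C -> 'M[C]_n) (Ac H : nat -> R -> 'M[C]_n) (u b : R -> 'rV[C]_n).
Variables (Y : R -> C -> 'M[C]_n) (Y0 Yr : C -> 'M[C]_n) (Cm : 'M[C]_n).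
Local Notation F0 := ((0 : R)^'+).
Local Notation At f x := (fun j => f j x).

(** Only the closed half plane around the line is kept, the factor G0 is absorbed into the
    coefficients, and K and M are free to depend on the parameter. *)
Definition asymptotic_on_sector (f : nat -> 'M[C]_n) ux bx (Yx : C -> 'M[C]_n) :=
  forall m : nat, exists K M : R, forall l,
    closed_sector (hi - pi) hi l -> M <= cover_abs l ->
    mxle (Yx l *m zpow (- bx) l *m expz (- ux) l - fser_sum f m (cexp l))
      (K / cover_abs l ^+ m).

Hypotheses (n0 : (0 < n)%N) (N0_gt0 : 0 < N0).
Hypothesis formal : \forall x \near F0, formal_solution (At Ac x) (At H x) (u x) (b x).
Hypothesis limH : forall j, mlim F0 (H j) (H j 0).
Hypothesis H00 : H 0%N 0 = 1%:M.
Hypothesis limb : mlim F0 b (b 0).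
Hypothesis limu : mlim F0 u (u 0).
Hypothesis tailA : forall m : nat, exists2 c : R, 0 <= c & \forall x \near F0,
  (forall j, (j < m)%N -> mxle (Ac j x) c) /\
  (forall z, 4 * N0 <= normc z -> mxle (A x z - fser_sum (At Ac x) m z) (c / normc z ^+ m)).
Hypothesis solY : \forall x \near F0, fundamental_solution N0 (A x) (Y x).
Hypothesis asymY : \forall x \near F0, asymptotic_on_sector (At H x) (u x) (b x) (Y x).
Hypothesis limY : forall l, outer_dom N0 l -> mlim F0 (Y^~ l) (Y0 l).
Hypothesis asymYr : asymptotic_on_sector (At H 0) (u 0) (b 0) Yr.
Hypothesis connect : forall l, outer_dom N0 l -> Y0 l = Yr l *m Cm.
(** For a coalescing pair the limit needs one and the same of the two bounds of [dichotomy], hence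
    an eventually constant sign. *)
Hypothesis same_sign : forall i j, u 0 0 i = u 0 0 j ->
  (\forall x \near F0, 0 <= Re (cis hi * (u x 0 i - u x 0 j))) \/
  (\forall x \near F0, Re (cis hi * (u x 0 i - u x 0 j)) <= 0).
Hypothesis distinct_ray : forall i j, u 0 0 i != u 0 0 j ->
  Re (cis hi * (u 0 0 i - u 0 0 j)) != 0.

Lemma connection_trivial : Cm = 1%:M.
Proof.
have PF0 : ProperFilter F0 by exact: at_right_proper_filter.
have nR : (0 : R) < n%:R by rewrite ltr0n.
have [Bb Bb0 hBb] := mxle_bound (b 0).
(* The added 1 lets p bound b x for all small x, not only b 0. Order m = 2 p + 2 leaves an
   integrable O(z^-2) after conjugation by z^B. *)
pose p := Num.bound (Bb + 1).
have hp : Bb + 1 <= p%:R by apply: ltW; apply: archi_boundP; rewrite addr_ge0.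
pose m := (2 * p + 2)%N.
have m0 : (0 < m)%N by rewrite /m addn2 ltnS.
have [cA cA0 hA] := tailA m.
pose cH := 1 + \sum_(j < m) projT1 (cid2 (mxle_bound (H j 0))).
have BH0 j : 0 <= projT1 (cid2 (mxle_bound (H j 0))) by case: cid2.
have cH0 : 0 <= cH by rewrite addr_ge0// sumr_ge0.
have hH0 j : (j < m)%N -> mxle (H j 0) (cH - 1).
  move=> jm; apply: (@mxle_trans _ _ _ _ (projT1 (cid2 (mxle_bound (H j 0))))).
    by case: cid2.
  rewrite /cH addrAC subrr add0r (bigD1 (Ordinal jm))//= lerDl; apply: sumr_ge0 => k _; exact: BH0.
pose c := cA + cH + p%:R.
have pR0 : (0 : R) <= p%:R by exact: ler0n.
have c0 : 0 <= c by rewrite addr_ge0// addr_ge0.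
have [K K0 hK] := @residual_bound R n m c m0 c0.
pose Th := `|hi| + pi.
(* The exponentials come from z^-B and z^B, the factor 2 from the bound on P^-1, and K from the
   residual. *)
pose K2 := expR (p%:R * Th) ^+ 2 * (n%:R * 2 * K).
have K20 : 0 <= K2 by rewrite !mulr_ge0// exprn_ge0// expR_ge0.
(* Half of the tolerance of [unitmx_near1]: one half for H_0(x) - I, the other for the terms of
   positive degree. *)
pose q : R := (4 * n%:R)^-1.
have q0 : 0 < q by rewrite invr_gt0 mulr_gt0.
have qq : q + q = (2 * n%:R)^-1 by rewrite /q; field; rewrite lt0r_neq0.
(* One summand per requirement on the line: |z| >= 1, the uniform tail of A, terms of positive
   degree below q, and the contraction condition of [dichotomy]. *)
pose N := 1 + 4 * N0 + m%:R * cH / q + 2 * (n%:R * K2 * pi).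
have pi0 : 0 <= pi :> R by exact: pi_ge0.
have NA : 0 <= m%:R * cH / q by rewrite divr_ge0 ?mulr_ge0// ltW.
have NB : 0 <= 2 * (n%:R * K2 * pi) by rewrite !mulr_ge0.
have N40 : 0 <= 4 * N0 by rewrite mulr_ge0// ltW.
have N_1 : 1 <= N by rewrite /N -!addrA lerDl !addr_ge0.
have N_N0 : 4 * N0 <= N by rewrite /N -!addrA addrCA lerDl !addr_ge0.
have N_q : m%:R * cH <= q * N.
  by rewrite [leRHS]mulrC -ler_pdivrMr// /N addrAC lerDr !addr_ge0.
have N_K : n%:R * K2 * pi <= N / 2.
  by rewrite ler_pdivlMr// mulrC /N lerDr !addr_ge0.
have Ngt0 : 0 < N by apply: lt_le_trans N_1.
pose g := line_log N hi.
have gT s : `|Im (g s)| <= Th.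
  exact: line_log_Im.
have zN s : N <= normc (cexp (g s)) by exact: normc_line_ge.
have z1 s : 1 <= normc (cexp (g s)) by apply: le_trans (zN s).
have z0 s : 0 < normc (cexp (g s)) by apply: lt_le_trans (z1 s).
have og s : outer_dom N0 (g s).
  by rewrite /outer_dom/= -normc_cover_abs; apply: le_trans (zN s); lra.
pose P x s := fser_sum (At H x) m (cexp (g s)).
have Punit x s : mxle (H 0%N x - 1%:M) q -> (forall j, (j < m)%N -> mxle (H j x) cH) ->
    P x s \in unitmx /\ mxle (invmx (P x s)) 2.
  move=> h1 h2; apply: unitmx_near1; rewrite -qq; apply: (fser_sum_near1 (c := cH)) => //.
  by apply: le_trans N_q _; rewrite ler_wpM2l// ltW.
have P0 s : P 0 s \in unitmx /\ mxle (invmx (P 0 s)) 2.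
  apply: Punit => [|j jm]; first by rewrite H00 subrr; apply: mxle0; exact: ltW.
  by apply: mxle_trans (hH0 j jm) _; lra.
have asym_near1 x (Yx : C -> 'M[C]_n) : (forall s, P x s \in unitmx /\ mxle (invmx (P x s)) 2) ->
    (forall a, normc (b x 0 a) <= p%:R) ->
    asymptotic_on_sector (At H x) (u x) (b x) Yx -> forall e, 0 < e ->
    exists M, forall s, M <= `|s| ->
      mxle (conjugated (P x s) (u x) (b x) (Yx (g s)) (g s) - 1%:M) e.
  move=> hP hb /(_ m)[K' [M' h']] e e0.
  pose K'' := expR (p%:R * Th) ^+ 2 * (n%:R * 2 * `|K'|).
  have K''0 : 0 <= K'' by rewrite !mulr_ge0// exprn_ge0// expR_ge0.
  have [M hM] := line_limit0 hi Ngt0 K''0 e0.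
  exists (Num.max M M') => s; rewrite ge_max => /andP[sM sM'].
  apply: mxle_trans (hM s sM).
  have [uP P2] := hP s.
  apply: conjugated_near1 => //.
  apply: (@mxle_trans _ _ _ _ (K' / cover_abs (g s) ^+ m)).
    apply: h'; first exact: line_log_sector.
    by rewrite -normc_cover_abs; apply: le_trans sM' (normc_line_ge_abs _ Ngt0 s).
  rewrite -normc_cover_abs ler_wpM2r ?invr_ge0 ?exprn_ge0 ?normc_ge0//.
  exact: ler_norm.
pose Q x s := conjugated (P x s) (u x) (b x) (Y x (g s)) (g s).
pose k x i j := cis hi * (u x 0 i - u x 0 j).
pose D := 2 * n%:R * K2 / N.
have D0 : 0 <= D by rewrite divr_ge0 ?mulr_ge0// ltW.
have nearH : \forall x \near F0, forall j, (j < m)%N -> mxle (H j x) cH.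
  have : \forall x \near F0, forall j, (j < m)%N -> mxle (H j x - H j 0) 1.
    by apply: near_all_lt => j; exact: limH.
  apply: filterS => x hx j jm; rewrite -[H j x](subrK (H j 0)).
  by apply: mxle_trans (mxleD (hx j jm) (hH0 j jm)) _; lra.
have nearH0 : \forall x \near F0, mxle (H 0%N x - 1%:M) q.
  by rewrite -H00; exact: limH.
have nearb : \forall x \near F0, forall a, normc (b x 0 a) <= p%:R.
  have := limb ltr01; apply: filterS => x hx a; rewrite -[b x](subrK (b 0)) mxE addrC.
  by apply: le_trans (normcD _ _) (le_trans (lerD (hBb 0 a) (hx 0 a)) hp).
(* N and D were fixed before x. The asymptotics of Y x enter only through the vanishing of Q - I at
   the two ends, so their constants leave no trace. *)
have bound : \forall x \near F0, forall i j s,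
   (0 <= Re (k x i j) -> normc ((Q x s - 1%:M) i j) <= D * (pi / 2 - atan (s / N))) /\
   (Re (k x i j) <= 0 -> normc ((Q x s - 1%:M) i j) <= D * (pi / 2 + atan (s / N))).
  near=> x.
  have hHx : forall j, (j < m)%N -> mxle (H j x) cH by near: x.
  have hH0x : mxle (H 0%N x - 1%:M) q by near: x.
  have hbx : forall a, normc (b x 0 a) <= p%:R by near: x.
  have formx : formal_solution (At Ac x) (At H x) (u x) (b x) by near: x.
  have [hAc hAt] : (forall j, (j < m)%N -> mxle (Ac j x) cA) /\
    (forall z, 4 * N0 <= normc z -> mxle (A x z - fser_sum (At Ac x) m z) (cA / normc z ^+ m)).
    by near: x.
  have solx : fundamental_solution N0 (A x) (Y x) by near: x.
  have asymx : asymptotic_on_sector (At H x) (u x) (b x) (Y x) by near: x.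
  have uP s := Punit x s hH0x hHx.
  pose z s := cexp (g s).
  pose T s := cis hi *: (zpow (- b x) (g s) *m invmx (P x s) *m
    residual (A x (z s)) (At H x) (u x) (b x) m (z s) *m zpow (b x) (g s)).
  apply: (@dichotomy R n N K2 (k x) (Q x) T Ngt0 K20 N_K).
  - by move=> a; rewrite /k subrr mulr0.
  - move=> s; have dg := cderiv_line_log hi Ngt0 s.
    have dY := mderiv_fundamental_solution solx og dg.
    have := mderiv_conjugated dg (u x) (b x) (fun r => (uP r).1) dY.
    by rewrite /= line_speed.
  - move=> s; rewrite /T -[zpow _ _ *m invmx _ *m _]mulmxA.
    have c1 : normc (cis hi) <= 1 by rewrite /cis normc_cexp expR0.
    rewrite -[K2 / _]mul1r; apply: mxleZ => //.
    rewrite -(normc_line_sqr hi Ngt0 s).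
    apply: zpow_conj_bound => //.
    have hR : mxle (residual (A x (z s)) (At H x) (u x) (b x) m (z s)) (K / normc (z s) ^+ m).
      apply: (hK (At Ac x)) => //.
      + exact: z1.
      + by move=> j jm; apply: mxle_trans (hAc j jm) _; rewrite /c -addrA lerDl addr_ge0.
      + by move=> j jm; apply: mxle_trans (hHx j jm) _; rewrite /c addrAC lerDr addr_ge0.
      + by move=> a; apply: le_trans (hbx a) _; rewrite /c lerDr addr_ge0.
      + apply: mxle_trans (hAt _ _) _; first exact: le_trans N_N0 (zN s).
        by rewrite ler_wpM2r ?invr_ge0 ?exprn_ge0 ?normc_ge0// /c -addrA lerDl addr_ge0.
    by apply: mxle_trans (mxleM (uP s).2 hR) _; rewrite !mulrA.
  - by move=> e e0; exact: (asym_near1 x (Y x) uP hbx asymx).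
pose Q0 s := conjugated (P 0 s) (u 0) (b 0) (Y0 (g s)) (g s).
have limP s : mlim F0 (P^~ s) (P 0 s).
  by apply: mlim_sum => j; apply: mlimZ; exact: limH.
have nearP s : \forall x \near F0, P x s \in unitmx /\ mxle (invmx (P x s)) 2.
  by near=> x; apply: Punit; near: x.
have limQ s : mlim F0 (Q^~ s) (Q0 s).
  have scN (w : C) (v : 'rV[C]_n) : w *: - v = (- w) *: v by rewrite scaleNr scalerN.
  apply: mlimM; first apply: mlimM; first apply: mlimM.
  - apply: mlim_diag_exp; rewrite scN; under [X in mlim _ X]funext do rewrite scN.
    exact: mlimZ.
  - by apply: mlim_invmx => //; exact: (P0 s).1.
  - exact: limY.
  - apply: mlim_diag_exp; rewrite scN; under [X in mlim _ X]funext do rewrite scN.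
    exact: mlimZ.
have atanb s : 0 <= pi / 2 - atan (s / N) <= pi /\ 0 <= pi / 2 + atan (s / N) <= pi.
  exact: atan_half_pi.
have ent (X : 'M[C]_n) i j : (X - 1%:M) i j = X i j - (1%:M : 'M[C]_n) i j.
  by rewrite mxE [X in _ + X]mxE.
(* The sign of Re (k x i j) may change with x; D pi covers both cases. *)
have Q0_bound s : mxle (Q0 s - 1%:M) (D * pi).
  move=> i j; rewrite ent; apply: mlim_entry_le (limQ s) _.
  near=> x.
  have hx : forall i j s,
    (0 <= Re (k x i j) -> normc ((Q x s - 1%:M) i j) <= D * (pi / 2 - atan (s / N))) /\
    (Re (k x i j) <= 0 -> normc ((Q x s - 1%:M) i j) <= D * (pi / 2 + atan (s / N))).
    by near: x.
  have [h1 h2] := hx i j s; rewrite ent in h1 h2.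
  have [/andP[_ a1] /andP[_ a2]] := atanb s.
  have [k0|/ltW k0] := leP 0 (Re (k x i j)).
    by apply: le_trans (h1 k0) _; rewrite ler_wpM2l.
  by apply: le_trans (h2 k0) _; rewrite ler_wpM2l.
have Q0_good i j : u 0 0 i = u 0 0 j ->
    (forall s, normc ((Q0 s - 1%:M) i j) <= D * (pi / 2 - atan (s / N))) \/
    (forall s, normc ((Q0 s - 1%:M) i j) <= D * (pi / 2 + atan (s / N))).
  move=> /same_sign[] hs; [left|right] => s; rewrite ent;
    apply: mlim_entry_le (limQ s) _; near=> x.
  - have hx : forall i j s,
    (0 <= Re (k x i j) -> normc ((Q x s - 1%:M) i j) <= D * (pi / 2 - atan (s / N))) /\
    (Re (k x i j) <= 0 -> normc ((Q x s - 1%:M) i j) <= D * (pi / 2 + atan (s / N))).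
      by near: x.
    have := (hx i j s).1; rewrite ent; apply.
    by near: x.
  - have hx : forall i j s,
    (0 <= Re (k x i j) -> normc ((Q x s - 1%:M) i j) <= D * (pi / 2 - atan (s / N))) /\
    (Re (k x i j) <= 0 -> normc ((Q x s - 1%:M) i j) <= D * (pi / 2 + atan (s / N))).
      by near: x.
    have := (hx i j s).2; rewrite ent; apply.
    by near: x.
pose Qr s := conjugated (P 0 s) (u 0) (b 0) (Yr (g s)) (g s).
pose E s := expz (u 0) (g s) *m Cm *m expz (- u 0) (g s).
have QE s : Q0 s = Qr s *m E s.
  by rewrite /Q0 /conjugated connect//; apply: insert_inverse; exact: expzNK.
have Qr1 e : 0 < e -> exists M, forall s, M <= `|s| -> mxle (Qr s - 1%:M) e.
  move=> e0; apply: asym_near1 asymYr _ e0; first exact: P0.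
  by move=> a; apply: le_trans (hBb 0 a) (le_trans _ hp); rewrite lerDl.
have BQ s : mxle (Q0 s) (D * pi + 1).
  rewrite -[Q0 s](subrK 1%:M); apply: mxleD => // i j; rewrite mxE.
  by case: eqP => _; rewrite ?Normc.normc1// Normc.normc0.
have BQ0 : 0 <= D * pi + 1 by rewrite addr_ge0// mulr_ge0.
pose BE := n%:R * (2 * (D * pi + 1)).
have BE0 : 0 <= BE by rewrite !mulr_ge0.
(* E = Qr^-1 Q0, and Qr^-1 is bounded by 2 once Qr is close to I. *)
have [M1 hM1] : exists M, forall s, M <= `|s| -> mxle (E s) BE.
  have [|M hM] := Qr1 (2 * n%:R)^-1; first by rewrite invr_gt0 mulr_gt0.
  exists M => s /hM/unitmx_near1[uQ Q2].
  rewrite -(mulKmx uQ (E s)) -QE; exact: mxleM.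
have Eentry s i j : E s i j = cexp (cexp (g s) * (u 0 0 i - u 0 0 j)) * Cm i j.
  rewrite /E mul_diag_conj !mxE mulrAC -cexpD; congr (cexp _ * _).
  by rewrite mulrBr mulrN.
apply/matrixP => i j; rewrite mxE; have [uij|uij] := eqVneq (u 0 0 i) (u 0 0 j); last first.
  have -> : (i == j) = false by apply/negbTE; apply: contra uij => /eqP ->.
  rewrite mulr0n; apply/eqP; rewrite -normc_eq0; apply/eqP.
  apply: (@exp_bounded_eq0 (Re (cis hi * (u 0 0 i - u 0 0 j))) _ BE M1
     (Re (cis hi * (0 +i* (- N)) * (u 0 0 i - u 0 0 j)))) => [||s sM].
  - exact: normc_ge0.
  - exact: distinct_ray.
  - have := hM1 s sM i j; rewrite Eentry Normc.normcM normc_cexp.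
    suff -> : Re (cexp (g s) * (u 0 0 i - u 0 0 j)) = Re (cis hi * (u 0 0 i - u 0 0 j)) * s +
       Re (cis hi * (0 +i* (- N)) * (u 0 0 i - u 0 0 j)) by [].
    rewrite cexp_line_log//.
    have -> : s +i* (- N) = s%:C + (0 +i* (- N)) by apply/eqP; rewrite eq_complex /= addr0 add0r !eqxx.
    move: (cis hi) (0 +i* (- N)) (u 0 0 i - u 0 0 j) => c1 c2 c3.
    have -> : c1 * (s%:C + c2) * c3 = s%:C * (c1 * c3) + c1 * c2 * c3 by ring.
    rewrite ReD; congr (_ + _).
    by case: (c1 * c3) => a d /=; ring.
(* For equal eigenvalues the exponentials cancel, so the entry can be evaluated at whichever end is
   convenient. *)
have Econst s : E s i j = Cm i j by rewrite Eentry uij subrr mulr0 cexp0 mul1r.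
apply/eqP; rewrite -subr_eq0; apply/eqP; apply: eq0_normc_small => e e0.
pose e1 := e / (2 * (n%:R * BE + 1)).
have den0 : 0 < 2 * (n%:R * BE + 1) by rewrite mulr_gt0// ltr_wpDl// mulr_ge0.
have e10 : 0 < e1 by rewrite divr_gt0.
have [M2 hM2] := Qr1 e1 e10.
pose del := (i == j)%:R : C.
(* From Q0 = Qr E: E - I = (Q0 - I) - (Qr - I) E. The first term is small at the end selected by
   [Q0_good], the second at both. *)
have split s : Cm i j - del = (Q0 s - 1%:M) i j - ((Qr s - 1%:M) *m E s) i j.
  rewrite mulmxBl mul1mx -QE [RHS]addrC.
  have -> : (Q0 s - E s) i j = Q0 s i j - E s i j by rewrite !mxE.
  have -> : (Q0 s - 1%:M) i j = Q0 s i j - del by rewrite !mxE.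
  by rewrite Econst; ring.
have part2 s : M1 <= `|s| -> M2 <= `|s| -> normc (((Qr s - 1%:M) *m E s) i j) <= e / 2.
  move=> s1 s2; apply: le_trans (mxleM (hM2 s s2) (hM1 s s1) i j) _.
  have -> : e / 2 = e1 * (n%:R * BE + 1).
    by rewrite /e1; field; rewrite lt0r_neq0// ltr_wpDl// mulr_ge0.
  by rewrite mulrCA ler_wpM2l ?(ltW e10)// lerDl.
have tendsto : exists M, forall s, M <= s -> D * (pi / 2 - atan (s / N)) <= e / 2.
  have e2 : 0 < e / 2 / (D + 1) by rewrite !divr_gt0// ltr_wpDl.
  have /cvgrPdist_le/(_ _ e2) := @cvgy_atan R.
  move=> [M [_ hM]]; exists ((M + 1) * N) => s sM.
  have := hM (s / N); rewrite /= ltr_pdivlMr//.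
  have MM : M * N < s by apply: lt_le_trans sM; rewrite mulrDl mul1r ltrDl.
  move=> /(_ MM); rewrite ger0_norm; last by have [/andP[]] := atanb s.
  move=> h; apply: le_trans (ler_wpM2l D0 h) _.
  rewrite mulrCA -[leRHS]mulr1 ler_wpM2l ?(ltW (divr_gt0 e0 _))//.
  by rewrite ler_pdivrMr ?mul1r ?lerDl// ltr_wpDl.
have [M3 hM3] := tendsto.
pose s0 := `|M1| + `|M2| + `|M3|.
have s00 : 0 <= s0 by rewrite !addr_ge0.
have sM1 : M1 <= s0 by apply: le_trans (ler_norm _) _; rewrite /s0 -addrA lerDl addr_ge0.
have sM2 : M2 <= s0 by apply: le_trans (ler_norm _) _; rewrite /s0 addrAC lerDr addr_ge0.
have sM3 : M3 <= s0 by apply: le_trans (ler_norm _) _; rewrite /s0 lerDr addr_ge0.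
rewrite -/del; case: (Q0_good i j uij) => hQ.
  rewrite (split s0) (splitr e); apply: le_trans (normcD _ _) _; apply: lerD.
    exact: le_trans (hQ s0) (hM3 s0 sM3).
  by rewrite normcN; apply: part2; rewrite ger0_norm.
rewrite (split (- s0)) (splitr e); apply: le_trans (normcD _ _) _; apply: lerD.
  apply: le_trans (hQ (- s0)) _; rewrite mulNr atanN; exact: hM3.
by rewrite normcN; apply: part2; rewrite normrN ger0_norm.
Unshelve. all: by end_near. Qed.

End Uniqueness.

(** * The constant matrix connecting the limit with the normalized solution *)

Section Connection.
Variable R : realType.
Local Notation C := R[i].

Lemma mderiv_bounded (m n : nat) (f f' : R -> 'M[C]_(m, n)) (M : R) :
  (forall s, mderiv f s (f' s)) -> exists2 B, 0 <= B & forall s, `|s| <= M -> mxle (f s) B.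
Proof.
move=> df; have h i j : exists2 B, 0 <= B & forall s, `|s| <= M -> normc (f s i j) <= B.
  by apply: cderiv_bounded => s; exact: df.
have B0 i j : 0 <= s2val (cid2 (h i j)) by case: cid2.
exists (\sum_i \sum_j s2val (cid2 (h i j))).
  by apply: sumr_ge0 => i _; apply: sumr_ge0 => j _.
move=> s sM i j; rewrite (bigD1 i)//= (bigD1 j)//= -addrA.
apply: (@le_trans _ _ (s2val (cid2 (h i j)))); first by case: cid2 => /= B _; apply.
rewrite lerDl addr_ge0//; first by apply: sumr_ge0 => k _.
by apply: sumr_ge0 => k _; apply: sumr_ge0 => l _.
Qed.

Lemma outer_domE N0 (l : C) : 0 < N0 -> outer_dom N0 l <-> ln N0 <= Re l.
Proof.
move=> N00; rewrite /outer_dom /cover_abs /=.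
by rewrite -{1}(lnK (N00 : N0 \is Num.pos)) ler_expR.
Qed.

Variables (T : Type) (F : set_system T).
Context {PF : ProperFilter F}.

(** Y0 is known only as a pointwise limit. Gronwall's inequality therefore compares Y x with Yr Cm
    along a path from a base point, where Cm makes them agree in the limit, and uniqueness of limits
    identifies Y0 at the other end. *)
Lemma solution_connection (n : nat) (N0 : R) (A : T -> C -> 'M[C]_n) (A0 : C -> 'M[C]_n)
    (Y : T -> C -> 'M[C]_n) (Y0 Yr : C -> 'M[C]_n) : 0 < N0 ->
  fundamental_solution N0 A0 Yr ->
  (\forall x \near F, fundamental_solution N0 (A x) (Y x)) ->
  (forall l, outer_dom N0 l -> mlim F (Y^~ l) (Y0 l)) ->
  (forall (g g' : R -> C) M, (forall s, cderiv g s (g' s)) -> (forall s, N0 <= normc (g s)) ->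
    (exists2 B, 0 <= B & forall s, `|s| <= M -> mxle (A0 (g s)) B) /\
    forall e : R, 0 < e -> \forall x \near F, forall s, `|s| <= M -> mxle (A x (g s) - A0 (g s)) e) ->
  exists Cm, forall l, outer_dom N0 l -> Y0 l = Yr l *m Cm.
Proof.
move=> N00 solr sol lim unif.
pose l0 : C := (ln N0)%:C.
have ol0 : outer_dom N0 l0 by apply/outer_domE.
exists (invmx (Yr l0) *m Y0 l0) => l1 ol1; set Cm := invmx _ *m _.
have Cm0 : Yr l0 *m Cm = Y0 l0 by rewrite /Cm mulKVmx//; exact: (solr l0 ol0).1.
(* The sine keeps the path inside the segment from l0 to l1, hence in the domain,
   for every real s. *)
pose g (s : R) : C := 2^-1 * (l0 + l1) + 2^-1 * (l1 - l0) * (sin s)%:C.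
pose d (s : R) : C := 2^-1 * (l1 - l0) * (cos s)%:C.
have two : (2%:R : C) != 0 by rewrite pnatr_eq0.
have og s : outer_dom N0 (g s).
  apply/outer_domE => //; have := (outer_domE l1 N00).1 ol1.
  have -> : Re (g s) = 2^-1 * (ln N0 + Re l1) + 2^-1 * (Re l1 - ln N0) * sin s.
    have h2 : (2^-1 : C) = (2^-1 : R)%:C by rewrite fmorphV rmorph_nat.
    by rewrite /g /l0 h2; case: (l1) => a b /=; ring.
  have := sin_geN1 s; have := sin_le1 s; nra.
have dg s : cderiv g s (d s).
  rewrite -[d s]add0r; apply: cderivD; first exact: cderiv_cst.
  by apply: cderivZ; split; [exact: is_derive_sin|exact: is_derive_cst].
pose h := pi / 2 : R.
have h0 : - h <= h by have := @pi_ge0 R; rewrite /h; lra.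
have ga : g (- h) = l0.
  by rewrite /g /h sinN sin_pihalf rmorphN rmorph1; field.
have gb : g h = l1 by rewrite /g /h sin_pihalf rmorph1; field.
pose z s := cexp (g s).
have Nz s : N0 <= normc (z s) by rewrite normc_cover_abs; exact: og.
have dz s : cderiv z s (z s * d s) by exact: cderiv_cexp.
have [[BA BA0 hBA] hunif] := unif z _ h dz Nz.
have [Bz Bz0 hBz] := cderiv_bounded h dz.
pose B1 := Bz * normc (2^-1 * (l1 - l0)).
have B10 : 0 <= B1 by rewrite mulr_ge0// normc_ge0.
have hB1 s : `|s| <= h -> normc (z s * d s) <= B1.
  move=> sh; rewrite Normc.normcM; apply: ler_pM; rewrite ?normc_ge0 ?hBz//.
  rewrite /d Normc.normcM ler_piMr ?normc_ge0// normc_real ler_norml.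
  by rewrite cos_geN1 cos_le1.
have dYr s := mderiv_fundamental_solution solr og (dg s).
have dYrC s := mderivM (dYr s) (mderiv_cst Cm s).
have [BY BY0 hBY] := mderiv_bounded h dYrC.
have [D D0 hD] := @gronwall R n n (B1 * (BA + 1)) (- h) h (mulr_ge0 B10 (addr_ge0 BA0 ler01)) h0.
apply: (mlim_unique PF (lim l1 ol1)) => e e0.
pose e1 := e / D.
have e10 : 0 < e1 by rewrite divr_gt0.
pose K := B1 * (n%:R * BY) + 1.
have K0 : 0 < K by rewrite ltr_wpDl// mulr_ge0// mulr_ge0.
pose e2 := Num.min 1 (e1 / K).
have e20 : 0 < e2 by rewrite lt_min ltr01 divr_gt0.
near=> x.
have solx : fundamental_solution N0 (A x) (Y x) by near: x.
have hA : forall s, `|s| <= h -> mxle (A x (z s) - A0 (z s)) e2 by near: x; exact: hunif.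
have dY s := mderiv_fundamental_solution solx og (dg s).
pose U s := Y x (g s) - Yr (g s) *m Cm.
(* U' = z' A_x U + E: both solutions are put in the equation of parameter x, and E is the price paid
   by Yr Cm. *)
pose E s := (z s * d s) *: ((A x (z s) - A0 (z s)) *m (Yr (g s) *m Cm)).
have -> : e = e1 * D by rewrite /e1 divfK// lt0r_neq0.
have -> : Y x l1 - Yr l1 *m Cm = U h by rewrite /U gb.
have itv s : - h <= s <= h -> `|s| <= h by rewrite ler_norml.
apply: (hD U E (fun s => (z s * d s) *: A x (z s)) e1 (ltW e10)).
- move=> s; apply: mderiv_eq (mderivB (dY s) (dYrC s)) _.
  rewrite /U /E mulmx0 addr0 -/(z s) -!scalemxAl -scalerBr -scalerDr; congr (_ *: _).
  by rewrite mulmxBr mulmxBl !mulmxA addrA subrK.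
- move=> s /itv sh; apply: mxleZ; first exact: hB1.
  rewrite -[A x _](subrK (A0 (z s))) addrC; apply: mxleD; first exact: hBA.
  by apply: mxle_trans (hA s sh) _; rewrite /e2 ge_min lexx.
- move=> s /itv sh; apply: mxle_trans (mxleZ (hB1 s sh) (mxleM (hA s sh) (hBY s sh))) _.
  apply: (@le_trans _ _ (K * e2)).
    rewrite /K -subr_ge0.
    have -> : (B1 * (n%:R * BY) + 1) * e2 - B1 * (n%:R * (e2 * BY)) = e2 by ring.
    exact: ltW.
  by rewrite mulrC -ler_pdivlMr// /e2 ge_min lexx orbT.
- rewrite /U ga Cm0; near: x; exact: lim.
Unshelve. all: by end_near. Qed.

End Connection.

(** * Dependence on the deformation parameters *)

Section Segment.
Variables (R : realType) (n : nat) (N0 eps0 : R) (t0 : 'rV[R[i]]_n).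
Local Notation C := R[i].
Hypothesis t0_eps : polydisc eps0 t0.

Definition segment_point (x : R) : 'rV[C]_n := x%:C *: t0.
Local Notation t := segment_point.

Lemma segment_point0 : t 0 = 0.
Proof. by rewrite /segment_point scale0r. Qed.

Lemma segment_point_polydisc x : `|x| <= 1 -> polydisc eps0 (t x).
Proof.
move=> x1; rewrite /polydisc/= normrZ; apply: le_trans t0_eps.
by rewrite ler_piMl// lenormcE normc_real.
Qed.

Lemma polydisc0 : polydisc eps0 (0 : 'rV[C]_n).
Proof. by rewrite -segment_point0; apply: segment_point_polydisc; rewrite normr0. Qed.

Lemma near0_le1 : \forall x \near (0 : R), `|x| <= 1.
Proof.
apply/nbhs_normP; exists 1 => //= x; rewrite /= sub0r normrN; exact: ltW.
Qed.

Lemma segment_point_continuous : continuous segment_point.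
Proof.
move=> s; apply: cvgZr_tmp; apply/cvg_normcP => e e0.
exact: (cderiv_near (cderiv_id s) e0).
Qed.

Lemma segment_point_cvg : t x @[x --> (0 : R)] --> (0 : 'rV[C]_n).
Proof. by have := @segment_point_continuous 0; rewrite /continuous_at segment_point0. Qed.

Lemma holomorphic_mlim (m p : nat) (f : 'rV[C]_n -> 'M[C]_(m, p)) :
  holomorphic_on (polydisc eps0) f -> mlim (nbhs (0 : R)) (fun x => f (t x)) (f (t 0)).
Proof.
move=> [W [h [oW DW dh hf]]] e e0; rewrite segment_point0.
have ch : h (t x) @[x --> (0 : R)] --> h 0.
  apply: (@cvg_comp _ _ _ _ h _ (nbhs (0 : 'rV[C]_n))); first exact: segment_point_cvg.
  have := differentiable_continuous (dh 0 (DW 0 polydisc0)). exact.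
have hx := cvg_mx_entry ch e0; near=> x.
have x1 : `|x| <= 1 by near: x; exact: near0_le1.
rewrite -(hf _ polydisc0) -(hf _ (segment_point_polydisc x1)).
by near: x; exact: hx.
Unshelve. all: by end_near. Qed.

Variable A : C -> 'rV[C]_n -> 'M[C]_n.
Hypothesis holA : @holomorphic_on R (C * 'rV[C]_n)%type 'M[C]_n
     [set p | N0%:C <= `|p.1| /\ polydisc eps0 p.2] (fun p => A p.1 p.2).

(** The map (s, x) -> A (z s) (t x) is continuous at x = 0, and compactness of [a, b] makes this
    uniform in s. *)
Lemma holomorphic_uniform (z : R -> C) (a b : R) :
  (forall s, {for s, continuous z}) -> (forall s, N0 <= normc (z s)) ->
  (exists2 B, 0 <= B & forall s, a <= s <= b -> mxle (A (z s) 0) B) /\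
  forall e : R, 0 < e -> \forall x \near (0 : R), forall s, a <= s <= b ->
    mxle (A (z s) (t x) - A (z s) 0) e.
Proof.
move=> cz Nz; have [W [h [oW DW dh hA]]] := holA.
have D s x : `|x| <= 1 -> N0%:C <= `|z s| /\ polydisc eps0 (t x).
  by move=> x1; split; [rewrite normr_normc lecR|exact: segment_point_polydisc].
have hE s x : `|x| <= 1 -> A (z s) (t x) = h (z s, t x).
  by move=> x1; rewrite (hA (z s, t x) (D s x x1)).
have n01 : `|0 : R| <= 1 by rewrite normr0.
have hc s : h (z p.1, t p.2) @[p --> (s, 0 : R)] --> h (z s, 0).
  have c2 : (z p.1, t p.2) @[p --> (s, 0 : R)] --> (z s, 0 : 'rV[C]_n).
    have k1 : z p.1 @[p --> (s, 0 : R)] --> z s.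
      by apply: (cvg_comp (fun p : R * R => p.1) z); [exact: cvg_fst|exact: cz].
    have k2 : t p.2 @[p --> (s, 0 : R)] --> (0 : 'rV[C]_n).
      by apply: (cvg_comp (fun p : R * R => p.2) t); [exact: cvg_snd|exact: segment_point_cvg].
    exact: (cvg_pair k1 k2).
  apply: (cvg_comp _ h c2).
  have Dz : [set p : C * 'rV[C]_n | N0%:C <= `|p.1| /\ polydisc eps0 p.2] (z s, 0).
    by split => /=; [rewrite normr_normc lecR|exact: polydisc0].
  by have := differentiable_continuous (dh (z s, 0) (DW _ Dz)); exact.
have near2 s (e : R) : 0 < e -> \forall s' \near s & x \near (0 : R),
    mxle (A (z s') (t x) - A (z s) 0) e.
  move=> e0; have := cvg_mx_entry (hc s) e0 => -[[U V] /= [sU V0] UV].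
  exists (U, V `&` [set x | `|x| <= 1]) => /=.
    by split => //; apply: filterI => //; exact: near0_le1.
  move=> [s' x] /= [Us' [Vx x1]]; have /= := UV (s', x) (conj Us' Vx).
  by rewrite -hE// -segment_point0 -(hE s 0).
have near1 s (e : R) : 0 < e -> \forall s' \near s, mxle (A (z s') 0 - A (z s) 0) e.
  move=> e0; have [[U V] /= [sU V0] UV] := near2 s e e0.
  apply: filterS sU => s' Us'; rewrite -{1}segment_point0; apply: (UV (s', 0)).
  by split => //=; exact: nbhs_singleton.
have cpt : near_covering `[a, b] by apply/compact_near_coveringP; exact: segment_compact.
split.
  (* The bound itself comes from the same covering argument, with a natural number k tending to
     infinity as parameter. *)
  have hk : \forall k \near \oo, forall s, s \in `[a, b] -> mxle (A (z s) 0) k%:R.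
    apply: (cpt nat \oo (fun k s => mxle (A (z s) 0) k%:R)).
    move=> s _; have [B B0 hB] := mxle_bound (A (z s) 0).
    have hs := near1 s 1 ltr01.
    exists ([set s' | mxle (A (z s') 0 - A (z s) 0) 1], [set k | B + 1 <= k%:R]) => /=.
      split => //; exists (Num.bound (B + 1)) => //= k kB.
      apply: le_trans (ltW (archi_boundP _)) _; first by rewrite addr_ge0.
      by rewrite ler_nat.
    move=> [s' k] /= [h1 h2]; rewrite -[A (z s') 0](subrK (A (z s) 0)).
    by apply: mxle_trans (mxleD h1 hB) _; rewrite addrC.
  have [k {}hk] := filter_ex hk; exists k%:R => // s sab; apply: hk.
move=> e e0; have e2 : 0 < e / 2 by rewrite divr_gt0.
have hx : \forall x \near (0 : R), forall s, s \in `[a, b] -> mxle (A (z s) (t x) - A (z s) 0) e.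
  apply: (cpt R (nbhs (0 : R)) (fun x s => mxle (A (z s) (t x) - A (z s) 0) e)).
  move=> s _; have [[U V] /= [sU V0] UV] := near2 s _ e2.
  exists (U `&` [set s' | mxle (A (z s') 0 - A (z s) 0) (e / 2)], V) => /=.
    by split => //; apply: filterI => //; exact: near1.
  move=> [s' x] /= [[Us' hs'] Vx].
  have -> : A (z s') (t x) - A (z s') 0 = (A (z s') (t x) - A (z s) 0) - (A (z s') 0 - A (z s) 0).
    by rewrite opprB addrA subrK.
  rewrite (splitr e); apply: mxleB => //.
  exact: (UV (s', x)).
by apply: filterS hx => x hx s sab; apply: hx; rewrite in_itv.
Qed.

Variable Ac : nat -> 'rV[C]_n -> 'M[C]_n.
Hypothesis N0_gt0 : 0 < N0.
Hypothesis seriesA : forall (z : C) t, N0%:C <= `|z| -> polydisc eps0 t ->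
  (fun m : nat => \sum_(j < m) z ^- j *: Ac j t) @ \oo --> A z t.

(** On the compact circle |z| = 2 N0, A is bounded by B + 1 for all small x at once; Cauchy's
    estimate passes this on to all coefficients and to the tails with a single S. *)
Lemma cauchy_uniform : exists2 S, 0 <= S & \forall x \near (0 : R),
  (forall j, mxle (Ac j (t x)) (S * (2 * N0) ^+ j)) /\
  (forall m z, 4 * N0 <= normc z ->
    mxle (A z (t x) - fser_sum (fun j => Ac j (t x)) m z)
      (2 * S * (2 * N0) ^+ m / normc z ^+ m)).
Proof.
pose z (s : R) : C := (2 * N0)%:C * cexp (0 +i* s).
have nz s : normc (z s) = 2 * N0.
  rewrite /z Normc.normcM normc_real normc_cexp /= expR0 mulr1.
  by rewrite ger0_norm// mulr_ge0// ltW.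
have cz s : {for s, continuous z}.
  have d1 : cderiv (fun s : R => 0 +i* s) s (0 +i* 1).
    by split => /=; [exact: is_derive_cst|exact: is_derive_id].
  apply/cvg_normcP => e e0.
  exact: (cderiv_near (cderivZ (2 * N0)%:C (cderiv_cexp d1)) e0).
have Nz s : N0 <= normc (z s) by rewrite nz ler_peMl ?ler1n// ltW.
have [[B B0 hB] hu] := @holomorphic_uniform z 0 (2 * pi) cz Nz.
exists (B + 1); first by rewrite addr_ge0.
near=> x.
have x1 : `|x| <= 1 by near: x; exact: near0_le1.
have px := segment_point_polydisc x1.
have hx : forall s, 0 <= s <= 2 * pi -> mxle (A (z s) (t x) - A (z s) 0) 1.
  by near: x; exact: hu.
have entry i j w : N0 <= normc w ->
    series_to (fun k => w ^- k * Ac k (t x) i j) (A w (t x) i j).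
  move=> Nw e e0; have Nw' : N0%:C <= `|w| by rewrite normr_normc lecR.
  have [M _ hM] := cvg_mx_entry (seriesA Nw' px) e0.
  exists M => m Mm; have := hM m Mm i j; rewrite !mxE summxE.
  by under eq_bigr do rewrite mxE.
have coef i j k : normc (Ac k (t x) i j) <= (B + 1) * (2 * N0) ^+ k.
  apply: (@cauchy_estimate R N0 (B + 1) (fun k => Ac k (t x) i j) (fun w => A w (t x) i j)) => //.
    exact: entry.
  move=> s s2; rewrite -/(z s) -[A _ _](subrK (A (z s) 0)) mxE addrC.
  by apply: le_trans (normcD _ _) (lerD (hB s s2 i j) (hx s s2 i j)).
split=> [k i j|m w hw i j]; first exact: coef.
have h := @series_tail R N0 (B + 1) (fun k => Ac k (t x) i j) (fun w => A w (t x) i j) N0_gt0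
  (addr_ge0 B0 ler01) (entry i j) (coef i j) m w hw.
rewrite !mxE summxE (eq_bigr (fun k : 'I_m => w ^- k * Ac k (t x) i j))//.
by move=> k _; rewrite mxE.
Unshelve. all: by end_near. Qed.

(* [A_1] is the limit of [z (A - A_0)] as z -> oo, uniformly in the parameter. *)
Lemma residue_mlim : mlim (nbhs (0 : R)) (fun x => Ac 0%N (t x)) (Ac 0%N 0) ->
  mlim (nbhs (0 : R)) (fun x => Ac 1%N (t x)) (Ac 1%N 0).
Proof.
move=> lim0 e e0.
have [S S0 hS] := cauchy_uniform.
have [_ tail0] := nbhs_singleton hS; rewrite segment_point0 in tail0.
pose K := 2 * S * (2 * N0) ^+ 2.
have K0 : 0 <= K by apply: mulr_ge0; [exact: mulr_ge0|exact: sqr_ge0].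
(* At |z| = r the two tails, multiplied by r, contribute at most 2 K / r <= e / 2; the tolerance e /
   (4 r) on A and on A_0 yields the other half. *)
pose r := 4 * N0 + 4 * K / e.
have Ke : 0 <= 4 * K / e by apply: divr_ge0; [exact: mulr_ge0|exact: ltW].
have r0 : 0 < r by apply: ltr_pwDl => //; exact: mulr_gt0.
have rN : 4 * N0 <= r by rewrite /r lerDl.
have nr : normc (r%:C : C) = r by rewrite normc_real gtr0_norm.
have rK : 2 * (K / r) <= e / 2.
  rewrite mulrA ler_pdivrMr//; have : 4 * K <= e * r.
    rewrite /r mulrDr [e * (4 * K / e)]mulrC divfK ?lt0r_neq0// lerDr.
    by apply: mulr_ge0; [exact: ltW|apply: mulr_ge0 => //; exact: ltW].
  lra.
have cr (s : R) : {for s, continuous (fun=> r%:C : C)} by exact: cst_continuous.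
have Nr (s : R) : N0 <= normc (r%:C : C) by rewrite nr; apply: le_trans rN; rewrite ler_peMl ?ler1n// ltW.
have [_ hu] := @holomorphic_uniform (fun=> r%:C) 0 0 cr Nr.
have d0 : 0 < e / (4 * r) by rewrite divr_gt0// mulr_gt0.
near=> x.
have hA : mxle (A r%:C (t x) - A r%:C 0) (e / (4 * r)).
  have h : forall s : R, 0 <= s <= 0 -> mxle (A r%:C (t x) - A r%:C 0) (e / (4 * r)).
    by near: x; exact: hu.
  by apply: (h 0); rewrite lexx.
have h0 : mxle (Ac 0%N (t x) - Ac 0%N 0) (e / (4 * r)) by near: x; exact: lim0.
have [_ tailx] : (forall j, mxle (Ac j (t x)) (S * (2 * N0) ^+ j)) /\
  (forall m z, 4 * N0 <= normc z ->
    mxle (A z (t x) - fser_sum (fun j => Ac j (t x)) m z)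
      (2 * S * (2 * N0) ^+ m / normc z ^+ m)).
  by near: x.
have h1 := tailx 2%N r%:C; rewrite nr in h1.
have h2 := tail0 2%N r%:C; rewrite nr in h2.
have two (f : nat -> 'M[C]_n) : fser_sum f 2 r%:C = f 0%N + r%:C^-1 *: f 1%N.
  by rewrite /fser_sum big_ord_recl big_ord1 /= expr0 invr1 scale1r expr1.
have rC0 : (r%:C : C) != 0 by rewrite -normc_eq0 nr lt0r_neq0.
have -> : Ac 1%N (t x) - Ac 1%N 0 = r%:C *: ((A r%:C (t x) - A r%:C 0) - (Ac 0%N (t x) - Ac 0%N 0)
   - ((A r%:C (t x) - fser_sum (fun j => Ac j (t x)) 2 r%:C)
     - (A r%:C 0 - fser_sum (fun j => Ac j 0) 2 r%:C))).
  rewrite !two; apply/matrixP => i j; rewrite !mxE; field; exact: rC0.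
have hr : normc (r%:C : C) <= r by rewrite nr.
apply: mxle_trans (mxleZ hr (mxleB (mxleB hA h0) (mxleB (h1 rN) (h2 rN)))) _.
have -> : r * (e / (4 * r) + e / (4 * r) + (2 * S * (2 * N0) ^+ 2 / r ^+ 2 + 2 * S * (2 * N0) ^+ 2 / r ^+ 2)) =
  e / 2 + 2 * (K / r) by rewrite /K; field; exact: lt0r_neq0.
by rewrite [leRHS](splitr e) lerD2l.
Unshelve. all: by end_near. Qed.

End Segment.

(** * Stokes directions and cells *)

Section Directions.
Variable R : realType.
Local Notation C := R[i].

Lemma cisD (x y : R) : cis (x + y) = cis x * cis y.
Proof. by rewrite /cis -cexpD; congr cexp; apply/eqP; rewrite eq_complex /= addr0 !eqxx. Qed.

Lemma cispi : cis pi = - 1 :> C.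
Proof.
by rewrite /cis /cexp /= expR0 cospi sinpi; apply/eqP; rewrite eq_complex /= !mul1r oppr0 !eqxx.
Qed.

Lemma cis_int_pi (k : int) : exists2 r : R, r ^+ 2 = 1 & cis (k%:~R * pi) = r%:C.
Proof.
have nat_case m : cis (m%:R * pi) = ((-1) ^+ m : R)%:C :> C.
  elim: m => [|m IH]; first by rewrite mul0r /cis cexp0.
  by rewrite -natr1 mulrDl mul1r cisD IH cispi exprSr rmorphM rmorphN rmorph1.
have sq m : ((-1) ^+ m) ^+ 2 = 1 :> R by rewrite -exprM mulnC exprM sqrrN !expr1n.
case: k => m; first by exists ((-1) ^+ m); [exact: sq|rewrite -nat_case].
exists ((-1) ^+ m.+1); first exact: sq.
have h : cis (m.+1%:R * pi) * cis ((Negz m)%:~R * pi) = 1 :> C.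
  by rewrite -cisD -mulrDl NegzE mulrNz addrN mul0r /cis cexp0.
apply: (mulfI (cexp_neq0 (0 +i* (m.+1%:R * pi)))).
by rewrite -/(cis _) h nat_case -rmorphM -expr2 sq.
Qed.

Lemma arg_mod_pi_line (w : C) (eta : R) :
  arg_mod_pi w eta -> exists r : R, w = r%:C * cis eta.
Proof.
move=> [m [r [_ ->]]]; have [s _ hs] := cis_int_pi m.
by exists (r * s); rewrite cisD hs rmorphM; ring.
Qed.

(** w cis hi = i y with y real, so w = y e^(i (pi/2 - hi)), and pi/2 - hi equals 3 pi/2 - ttau
    modulo pi. The sign of y decides between the multiples - k - 1 and - k. *)
Lemma crossing_of_stokes (w : C) (hi ttau : R) (k : int) :
  hi = ttau + k%:~R * pi -> w != 0 -> Re (w * cis hi) = 0 ->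
  arg_mod_pi w (3 * pi / 2 - ttau).
Proof.
move=> hiE w0 Rew; set y := Im (w * cis hi).
have e1 : w * cis hi = y%:C * cis (pi / 2).
  rewrite /cis {2}/cexp /= expR0 cos_pihalf sin_pihalf.
  have -> : w * cis hi = Re (w * cis hi) +i* Im (w * cis hi) by case: (w * cis hi).
  by rewrite Rew -/y; apply/eqP; rewrite eq_complex /=; apply/andP; split; apply/eqP; ring.
have e2 : w = y%:C * cis (pi / 2 - hi).
  have h : cis hi * cis (- hi) = 1 :> C by rewrite -cisD addrN /cis cexp0.
  by rewrite -[w]mulr1 -h mulrA e1 -mulrA -cisD.
have y0 : y != 0.
  by apply: contra w0 => /eqP y0; rewrite e2 y0 mul0r.
have [ypos|yneg] := ltrP 0 y.
  exists (- k - 1), y; split => //; rewrite {1}e2; congr (_ * cis _).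
  by rewrite hiE rmorphB rmorphN /=; field.
exists (- k), (- y); split; first by rewrite oppr_gt0 lt_neqAle y0.
rewrite {1}e2; have -> : 3 * pi / 2 - ttau + (- k)%:~R * pi = (pi / 2 - hi) + pi.
  by rewrite hiE rmorphN /=; field.
by rewrite (cisD (pi / 2 - hi)) cispi mulrN1 rmorphN mulrNN.
Qed.

Lemma stokes_direction_opp (n : nat) (u : 'rV[C]_n) (hi : R) :
  stokes_direction u (hi - pi) -> stokes_direction u hi.
Proof.
move=> [a [c [uac h]]]; exists a, c; split => //.
have -> : cis hi = - cis (hi - pi) by rewrite -[in LHS](subrK pi hi) (cisD (hi - pi)) cispi mulrN1.
by rewrite mulrN ReN h oppr0.
Qed.

(** Only the two boundary rays are in question. Neither is a Stokes ray, as directions come in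
    opposite pairs, so the extension goes past both. *)
Lemma closed_sector_extended (n : nat) (u : 'rV[C]_n) (ttau : R) (k : int) :
  ~ stokes_direction u (ttau + k%:~R * pi) ->
  closed_sector (ttau + k%:~R * pi - pi) (ttau + k%:~R * pi) `<=` extended_sector u ttau k.
Proof.
set hi := ttau + _ => nst l [h1 h2].
have loE : ttau - pi + k%:~R * pi = hi - pi by rewrite /hi; ring.
rewrite /extended_sector loE -/hi.
have [e1|n1] := eqVneq (cover_arg l) (hi - pi).
  right; split; first by rewrite e1.
  rewrite e1 => th t1 t2; have -> : th = hi - pi by apply/eqP; rewrite eq_le t1 t2.
  by move=> /stokes_direction_opp.
have [e2|n2] := eqVneq (cover_arg l) hi.
  left; right; split; first by rewrite e2.
  rewrite e2 => th t1 t2; have -> // : th = hi by apply/eqP; rewrite eq_le t1 t2.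
by left; left; split; rewrite lt_neqAle ?h1 ?h2 ?andbT// eq_sym.
Qed.

Lemma stokes_labelling_shift (n : nat) (u : 'rV[C]_n) (tau : int -> R) (mu : int) :
  stokes_labelling u tau mu -> forall (k sigma : int), tau (sigma + k * mu) = tau sigma + k%:~R * pi.
Proof.
move=> [_ _ h].
have hn (m : nat) sigma : tau (sigma + m%:Z * mu) = tau sigma + m%:R * pi.
  elim: m => [|m IH]; first by rewrite !mul0r !addr0.
  have -> : m.+1%:Z = m%:Z + 1 by rewrite -addn1 PoszD.
  rewrite mulrDl mul1r addrA h IH -natr1; ring.
case=> m sigma; first exact: hn.
have := hn m.+1 (sigma + Negz m * mu).
rewrite -addrA -mulrDl NegzE addNr mul0r addr0 => ->.
by rewrite mulrNz -pmulrn; ring.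
Qed.

End Directions.

(** * Scaling of the coalescence and crossing loci and of the cells *)

Section Cells.
Variables (R : realType) (n s : nat) (lam : 'I_s -> R[i]) (block : 'I_n -> 'I_s).
Variables (u0 : 'rV[R[i]]_n) (ttau eps0 : R).
Local Notation C := R[i].
Hypothesis hu0 : forall a : 'I_n, u0 0 a = lam (block a).
Hypothesis heps0_lt : forall i j : 'I_s, i != j -> eps0 < half_line_dist lam ttau i j.
Local Notation W := (polydisc eps0 `\`
  (coalescence_locus u0 eps0 `|` crossing_locus u0 eps0 ttau)).

Lemma polydisc_entry (t : 'rV[C]_n) a : polydisc eps0 t -> normc (t 0 a) <= eps0.
Proof. by move=> ht; exact: (mxle_norm ht). Qed.

Lemma half_line_dist_lt i j (r : R) : i != j ->
  2 * eps0 < normc (lam i - lam j + r%:C * cis (3 * pi / 2 - ttau)).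
Proof.
move=> /heps0_lt; rewrite /half_line_dist ltr_pdivlMr// mulrC => h.
apply: lt_le_trans h _; apply: ge_inf; last by exists r.
by exists 0 => _ [r' _ <-]; exact: normc_ge0.
Qed.

(** Moving t inside the polydisc changes a difference of eigenvalues by at most 2 eps0, less than
    its distance at t = 0 from the line of direction 3 pi/2 - ttau. Pairs from different blocks thus
    neither coalesce nor cross. *)
Lemma shifted_difference (t : 'rV[C]_n) (x r : R) a c : 0 <= x <= 1 -> polydisc eps0 t ->
  block a != block c ->
  (u0 + x%:C *: t) 0 a - (u0 + x%:C *: t) 0 c <> r%:C * cis (3 * pi / 2 - ttau).
Proof.
move=> /andP[x0 x1] ht bac; rewrite !mxE !hu0 => e.
have := half_line_dist_lt (- r) bac; apply/negP; rewrite -leNgt.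
have -> : lam (block a) - lam (block c) + (- r)%:C * cis (3 * pi / 2 - ttau) =
    x%:C * (t 0 c - t 0 a) by rewrite rmorphN mulNr -e; ring.
rewrite Normc.normcM normc_real ger0_norm//.
have h : normc (t 0 c - t 0 a) <= 2 * eps0.
  apply: le_trans (normcD _ _) _; rewrite normcN mulr_natl mulr2n.
  by apply: lerD; exact: polydisc_entry.
by apply: le_trans h; rewrite ler_piMl// normc_ge0.
Qed.

(** Within a block, scaling t by x > 0 multiplies the difference of eigenvalues by x, which
    preserves both its vanishing and its argument; [shifted_difference] settles the other pairs. *)
Lemma segment_in_domain (t : 'rV[C]_n) x : W t -> 0 < x <= 1 -> W (x%:C *: t).
Proof.
move=> [tp tn] /andP[x0 x1].
have xC : (x%:C : C) != 0 by rewrite -normc_eq0 normc_real normr_eq0 lt0r_neq0.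
have x01 : 0 <= x <= 1 by rewrite ltW.
have px : polydisc eps0 (x%:C *: t).
  by apply: segment_point_polydisc => //; rewrite ger0_norm// ltW.
have same a c : block a = block c ->
    (u0 + x%:C *: t) 0 a - (u0 + x%:C *: t) 0 c = x%:C * ((u0 + t) 0 a - (u0 + t) 0 c).
  by move=> bac; rewrite !mxE !hu0 bac; ring.
split=> // -[[_ [a [c [ac e]]]]|[_ [a [c [ac ne ar]]]]].
  have [bac|bac] := eqVneq (block a) (block c); last first.
    apply: (@shifted_difference t x 0 a c x01 tp bac).
    by rewrite e subrr mul0r.
  apply: tn; left; split=> //; exists a, c; split=> //.
  have := same a c bac; rewrite e subrr => /esym/eqP.
  by rewrite mulf_eq0 (negbTE xC) subr_eq0 => /eqP.
have [bac|bac] := eqVneq (block a) (block c); last first.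
  have [r er] := arg_mod_pi_line ar.
  exact: (@shifted_difference t x r a c x01 tp bac er).
apply: tn; right; split=> //; exists a, c.
have sE := same a c bac.
split=> //.
  apply: contra ne => /eqP e; move: sE; rewrite e subrr mulr0 => /eqP.
  by rewrite subr_eq0.
have [m [r [r0 er]]] := ar; exists m, (r / x); split; first by rewrite divr_gt0.
apply: (mulfI xC); rewrite -sE er mulrA -rmorphM; congr (_%:C * _).
by rewrite mulrCA divff ?mulr1// lt0r_neq0.
Qed.

(** The half-open segment from 0 to t is connected, avoids both loci and contains t, so it stays in
    the component of t. *)
Lemma cell_segment c : is_cell u0 eps0 ttau c ->
  exists2 t, polydisc eps0 t & forall x, 0 < x <= 1 -> c (x%:C *: t) /\ W (x%:C *: t).
Proof.
move=> [t [Wt ->]]; exists t; first by case: Wt.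
pose J := segment_point t @` `]0, 1].
have J1 : J t by exists 1; [rewrite /= in_itv /= ltr01 lexx|rewrite /segment_point scale1r].
have JW : J `<=` W.
  by move=> _ [x /= + <-]; rewrite in_itv /= => hx; exact: segment_in_domain.
have Jc : connected J.
  apply: connected_continuous_connected; last first.
    by apply: continuous_subspaceT; exact: segment_point_continuous.
  by apply/connected_intervalP; exact: interval_is_interval.
move=> x hx; split; last exact: segment_in_domain.
apply: (connected_component_max J1 JW Jc).
by exists x => //=; rewrite in_itv.
Qed.

Lemma no_stokes_outside_crossing (t : 'rV[C]_n) (k : int) : W t ->
  ~ stokes_direction (u0 + t) (ttau + k%:~R * pi).
Proof.
move=> [tp tn] [a [c [ne h]]]; apply: tn; right; split=> //; exists a, c; split=> //.
  by apply: contra ne => /eqP ->.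
by apply: crossing_of_stokes h; [|rewrite subr_eq0].
Qed.

End Cells.

Section LimitLemmas.
Variable R : realType.
Local Notation C := R[i].

Lemma mlim_at_right (m n : nat) (M : R -> 'M[C]_(m, n)) L :
  mlim (nbhs (0 : R)) M L -> mlim ((0 : R)^'+) M L.
Proof. by move=> h e e0; apply: cvg_within; exact: h. Qed.

Lemma mlim_near_eq (T : Type) (F : set_system T) {FF : Filter F} (m n : nat)
    (M M' : T -> 'M[C]_(m, n)) L :
  (\forall x \near F, M x = M' x) -> mlim F M L -> mlim F M' L.
Proof.
move=> e h d d0; apply: filterS (filterI e (h d d0)) => x [Mx hx].
by rewrite -Mx.
Qed.

Lemma mlim_diag_mx (T : Type) (F : set_system T) {FF : Filter F} (n : nat)
    (d : T -> 'rV[C]_n) d0 :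
  mlim F d d0 -> mlim F (fun x => diag_mx (d x)) (diag_mx d0).
Proof.
move=> h e e0; apply: filterS (h e e0) => x hx i j.
rewrite -linearB/= mxE; case: eqP => _; last by rewrite Normc.normc0 ltW.
exact: hx.
Qed.

Lemma mlim_diagonal (T : Type) (F : set_system T) {FF : Filter F} (n : nat)
    (M : T -> 'M[C]_n) L :
  mlim F M L -> mlim F (fun x => \row_a M x a a) (\row_a L a a).
Proof.
move=> h e e0; apply: filterS (h e e0) => x hx i j.
by have := hx j j; rewrite !mxE.
Qed.

End LimitLemmas.

(** * Application to the system and its normalized solutions *)

Theorem corollary14p1 (R : realType) (n : nat) (hn : (0 < n)%N)
  (* the eigenvalues at t = 0: distinct values lam, arranged in s blocks *)
  (s : nat) (lam : 'I_s -> R[i]) (hlam : injective lam)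
  (block : 'I_n -> 'I_s)
  (hblock_mono : forall a b : 'I_n, (a <= b)%N -> (block a <= block b)%N)
  (hblock_onto : forall i : 'I_s, exists a : 'I_n, block a = i)
  (u0 : 'rV[R[i]]_n) (hu0 : forall a : 'I_n, u0 0 a = lam (block a))
  (* the admissible direction and the Stokes directions of Lambda(0) *)
  (ttau : R) (httau : admissible u0 ttau)
  (tau : int -> R) (mu nu : int)
  (htau : (1 < s)%N ->
     [/\ stokes_labelling u0 tau mu, tau nu < ttau & ttau < tau (nu + 1)])
  (* the radius epsilon_0 = delta_0 *)
  (eps0 : R) (heps0 : 0 < eps0)
  (heps0_lt : forall i j : 'I_s, i != j -> eps0 < half_line_dist lam ttau i j)
  (* the system *)
  (N0 : R) (hN0 : 0 < N0)
  (A : R[i] -> 'rV[R[i]]_n -> 'M[R[i]]_n)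
  (Ac : nat -> 'rV[R[i]]_n -> 'M[R[i]]_n)
  (hA_holo : @holomorphic_on R (R[i] * 'rV[R[i]]_n)%type 'M[R[i]]_n
     [set p | N0%:C <= `|p.1| /\ polydisc eps0 p.2] (fun p => A p.1 p.2))
  (hA_series : forall (z : R[i]) t, N0%:C <= `|z| -> polydisc eps0 t ->
     (fun m : nat => \sum_(j < m) z ^- j *: Ac j t) @ \oo --> A z t)
  (G0 : 'rV[R[i]]_n -> 'M[R[i]]_n)
  (hG0_holo : holomorphic_on (polydisc eps0) G0)
  (hG0_unit : forall t, polydisc eps0 t -> G0 t \in unitmx)
  (hG0_0 : G0 0 = 1%:M)
  (hG0_diag : forall t, polydisc eps0 t ->
     invmx (G0 t) *m Ac 0%N t *m G0 t = diag_mx (u0 + t))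
  (b : 'rV[R[i]]_n -> 'rV[R[i]]_n)
  (hb : forall t, b t = formal_exponents (G0 t) (Ac 1%N t))
  (* the coefficients of the formal solution, and hypothesis 1) *)
  (F : nat -> 'rV[R[i]]_n -> 'M[R[i]]_n)
  (hF : forall t, (polydisc eps0 `\` coalescence_locus u0 eps0) t ->
     formal_solution (fun j => Ac j t)
       (fun k => G0 t *m fser_unit (fun j => F j t) k) (u0 + t) (b t))
  (hF_holo : forall j : nat, (1 <= j)%N -> holomorphic_on (polydisc eps0) (F j))
  (* the actual solutions on the cells *)
  (Y : int -> set 'rV[R[i]]_n -> R[i] -> 'rV[R[i]]_n -> 'M[R[i]]_n)
  (hY_holo : forall k c l, is_cell u0 eps0 ttau c -> outer_dom N0 l ->
     holomorphic_on c (Y k c l))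
  (hY_sol : forall k c t, is_cell u0 eps0 ttau c -> c t ->
     fundamental_solution N0 (fun z => A z t) (fun l => Y k c l t))
  (hY_asym : forall k c t, is_cell u0 eps0 ttau c -> c t ->
     asymptotic_expansion (extended_sector (u0 + t) ttau k)
       (reduced_solution (G0 t) (u0 + t) (b t) (fun l => Y k c l t))
       (fser_unit (fun j => F j t)))
  (* hypothesis 2): the analytic continuation in t of each of them *)
  (Yc : int -> set 'rV[R[i]]_n -> R[i] -> 'rV[R[i]]_n -> 'M[R[i]]_n)
  (hYc_holo : forall k c l, is_cell u0 eps0 ttau c -> outer_dom N0 l ->
     holomorphic_on (polydisc eps0) (Yc k c l))
  (hYc_ext : forall k c l t, is_cell u0 eps0 ttau c -> outer_dom N0 l -> c t ->
     Yc k c l t = Y k c l t)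
  (* the normalized solutions of the system at t = 0 *)
  (Yr Gr : int -> R[i] -> 'M[R[i]]_n)
  (hYr_sol : forall k, fundamental_solution N0 (fun z => A z 0) (Yr k))
  (hYr_form : forall k l, outer_dom N0 l ->
     Yr k l = Gr k l *m zpow (b 0) l *m expz u0 l)
  (hGr_asym : forall k,
     asymptotic_expansion (stokes_sector s tau (nu + k * mu)) (Gr k)
       (fser_unit (fun j => F j 0))) :
  forall (k : int) (c : set 'rV[R[i]]_n) (l : R[i]),
    is_cell u0 eps0 ttau c -> outer_dom N0 l ->
    reduced_solution (G0 0) u0 (b 0) (fun l' => Yc k c l' 0) l = Gr k l /\
    Yc k c l 0 = Yr k l.
Proof.
move=> k c l cc ol.
have [t0 pt0 seg] := cell_segment hu0 heps0_lt cc.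
pose t := segment_point t0; pose hi := ttau + k%:~R * pi.
have t00 : t 0 = 0 := segment_point0 t0.
pose F0 := (0 : R)^'+.
have PF0 : ProperFilter F0 by exact: at_right_proper_filter.
have near01 : \forall x \near F0, 0 < x <= 1.
  near=> x; apply/andP; split; first by near: x; exact: nbhs_right_gt.
  by near: x; apply: nbhs_right_le.
have nR : (0 : R) < n%:R by rewrite ltr0n.
have limG : mlim (nbhs (0 : R)) (fun x => G0 (t x)) (G0 (t 0)).
  exact: holomorphic_mlim pt0 _ _ _ hG0_holo.
rewrite t00 in limG.
have nearG : \forall x \near (0 : R), G0 (t x) \in unitmx /\ mxle (invmx (G0 (t x))) 2.
  have q0 : (0 : R) < (2 * n%:R)^-1 by rewrite invr_gt0 mulr_gt0.
  by apply: filterS (limG _ q0) => x; rewrite hG0_0; exact: unitmx_near1.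
have uG : G0 0 \in unitmx by rewrite hG0_0 unitmx1.
have limGi : mlim (nbhs (0 : R)) (fun x => invmx (G0 (t x))) (invmx (G0 0)).
  exact: mlim_invmx.
have limt : mlim (nbhs (0 : R)) (fun x => u0 + t x) (u0 + t 0).
  apply: mlimD; first exact: mlim_cst.
  move=> e e0; apply: cvg_mx_entry e0; rewrite t00; exact: (@segment_point_cvg R n t0).
rewrite t00 in limt.
(* A_0 is recovered as G0 Lambda G0^-1; A_1, and with it b, then follows from [residue_mlim]. *)
have lim0 : mlim (nbhs (0 : R)) (fun x => Ac 0%N (t x)) (Ac 0%N 0).
  have conj0 t' : polydisc eps0 t' -> G0 t' *m diag_mx (u0 + t') *m invmx (G0 t') = Ac 0%N t'.
    move=> pt1; have u1 := hG0_unit t' pt1.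
    by rewrite -hG0_diag// !mulmxA mulmxV// mul1mx mulmxK.
  rewrite -conj0; last exact: polydisc0 pt0.
  have lim00 : mlim (nbhs (0 : R)) (fun x => G0 (t x) *m diag_mx (u0 + t x) *m invmx (G0 (t x)))
      (G0 0 *m diag_mx (u0 + 0) *m invmx (G0 0)).
    by apply: mlimM limGi; apply: mlimM limG _; exact: mlim_diag_mx.
  apply: mlim_near_eq lim00.
  apply: filterS (@near0_le1 R) => x x1; apply: conj0.
  exact: (segment_point_polydisc pt0 x1).
have lim1 : mlim (nbhs (0 : R)) (fun x => Ac 1%N (t x)) (Ac 1%N 0).
  exact: (residue_mlim pt0 hA_holo hN0 hA_series lim0).
have limb : mlim F0 (fun x => b (t x)) (b (t 0)).
  apply: mlim_at_right; rewrite t00 hb; under [X in mlim _ X]funext do rewrite hb.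
  exact: (mlim_diagonal (mlimM (mlimM limGi lim1) limG)).
(* The factor G0 makes these the coefficients of a formal solution of the original system rather
   than of the diagonalized one. *)
pose H j x := G0 (t x) *m fser_unit (fun i => F i (t x)) j.
have limH j : mlim F0 (H j) (H j 0).
  apply: mlim_at_right; apply: mlimM; first by rewrite t00.
  case: j => [|j]; first exact: mlim_cst.
  by apply: (holomorphic_mlim pt0 (f := F j.+1)); exact: hF_holo.
have tailA m : exists2 c' : R, 0 <= c' & \forall x \near F0,
    (forall j, (j < m)%N -> mxle (Ac j (t x)) c') /\
    (forall z, 4 * N0 <= normc z ->
      mxle (A z (t x) - fser_sum (fun j => Ac j (t x)) m z) (c' / normc z ^+ m)).
  have [S S0 hS] := cauchy_uniform pt0 hA_holo hN0 hA_series.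
  have N2 : 0 <= 2 * N0 by rewrite mulr_ge0// ltW.
  pose c1 := \sum_(j < m) S * (2 * N0) ^+ j; pose c2 := 2 * S * (2 * N0) ^+ m.
  have c10 : 0 <= c1 by apply: sumr_ge0 => j _; rewrite mulr_ge0// exprn_ge0.
  have c20 : 0 <= c2 by rewrite mulr_ge0 ?exprn_ge0// mulr_ge0.
  exists (c1 + c2); first exact: addr_ge0.
  apply: cvg_within; apply: filterS hS => x [h1 h2]; split=> [j jm|z hz].
    apply: mxle_trans (h1 j) _; rewrite /c1 (bigD1 (Ordinal jm))//= -addrA lerDl.
    by rewrite addr_ge0// sumr_ge0// => i _; rewrite mulr_ge0// exprn_ge0.
  apply: mxle_trans (h2 m z hz) _.
  by rewrite ler_wpM2r ?invr_ge0 ?exprn_ge0 ?normc_ge0// lerDr.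
have limY l' : outer_dom N0 l' -> mlim F0 (fun x => Y k c l' (t x)) (Yc k c l' 0).
  move=> ol'; rewrite -t00; have hol := hYc_holo k c l' cc ol'.
  apply: (mlim_near_eq _ (mlim_at_right (holomorphic_mlim pt0 hol))).
  by apply: filterS near01 => x /seg[cx _]; exact: hYc_ext.
have solY : \forall x \near F0, fundamental_solution N0 (fun z => A z (t x)) (fun l' => Y k c l' (t x)).
  by apply: filterS near01 => x /seg[cx _]; exact: hY_sol.
have [Cm connect] : exists Cm, forall l', outer_dom N0 l' -> Yc k c l' 0 = Yr k l' *m Cm.
  apply: (solution_connection hN0 (hYr_sol k) solY limY) => g g' M dg Ng.
  have cg s' : {for s', continuous g}.
    by apply/cvg_normcP => e e0; exact: cderiv_near (dg s') e0.
  have [[B B0 hB] hu] := holomorphic_uniform pt0 hA_holo (- M) M cg Ng.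
  split; first by exists B => // s' sM; apply: hB; rewrite -ler_norml.
  move=> e e0; apply: cvg_within; apply: filterS (hu e e0) => x hx s' sM.
  by apply: hx; rewrite -ler_norml.
have asymY : \forall x \near F0, asymptotic_on_sector hi (fun j => H j x) (u0 + t x) (b (t x))
    (fun l' => Y k c l' (t x)).
  near=> x.
  have [cx Wx] : c (t x) /\ (polydisc eps0 `\` (coalescence_locus u0 eps0
      `|` crossing_locus u0 eps0 ttau)) (t x) by apply: seg; near: x.
  have ugx : G0 (t x) \in unitmx by apply: hG0_unit; case: Wx.
  move=> m; have [BG BG0 hBG] := mxle_bound (G0 (t x)).
  have sub := closed_sector_extended (no_stokes_outside_crossing (k := k) Wx).
  have [K [M hKM]] := hY_asym k c (t x) cc cx _ _ sub m.
  exists (n%:R * (BG * K)), M => l' sl' Ml'.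
  have -> : Y k c l' (t x) *m zpow (- b (t x)) l' *m expz (- (u0 + t x)) l' -
      fser_sum (fun j => H j x) m (cexp l') = G0 (t x) *m
      (reduced_solution (G0 (t x)) (u0 + t x) (b (t x)) (fun l1 => Y k c l1 (t x)) l' -
       \sum_(j < m) (cover_proj l') ^- j *: fser_unit (fun i => F i (t x)) j).
    rewrite mulmxBr /reduced_solution !mulmxA mulmxV// mul1mx mulmx_sumr; congr (_ - _).
    by apply: eq_bigr => j _; rewrite -scalemxAr.
  apply: mxle_trans (mxleM hBG (mxle_norm (hKM l' sl' Ml'))) _.
  by rewrite -!mulrA.
have H0E j : H j 0 = fser_unit (fun i => F i 0) j by rewrite /H t00 hG0_0 mul1mx.
(* Shifting by k mu turns tau_nu < ttau < tau_(nu+1) into tau_sigma < hi < tau_(sigma+1) with sigma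
   = nu + k mu, so both boundary rays lie strictly inside the Stokes sector. *)
have closed_stokes : closed_sector (hi - pi) hi `<=` stokes_sector s tau (nu + k * mu).
  rewrite /stokes_sector; case: leqP => // s1 l' [h1 h2].
  have [lab t1 t2] := htau s1.
  rewrite /sector /= addrAC !(stokes_labelling_shift lab).
  by split; move: h1 h2 t1 t2; rewrite /hi; lra.
have YrG l' : outer_dom N0 l' -> Yr k l' *m zpow (- b 0) l' *m expz (- u0) l' = Gr k l'.
  move=> ol'; rewrite hYr_form// -(mulmxA _ (zpow (b 0) l') (expz u0 l')) zpow_expzC !mulmxA.
  by rewrite -(mulmxA _ (zpow (b 0) l')) zpowKN mulmx1 -mulmxA expzKN mulmx1.
have asymYr : asymptotic_on_sector hi (fun j => H j 0) (u0 + t 0) (b (t 0)) (Yr k).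
  move=> m; have [K [M hKM]] := hGr_asym k _ _ closed_stokes m.
  exists K, (Num.max M N0) => l' sl'; rewrite ge_max => /andP[Ml' Nl'].
  rewrite t00 addr0 YrG//; have -> : fser_sum (fun j => H j 0) m (cexp l') =
      \sum_(j < m) (cover_proj l') ^- j *: fser_unit (fun i => F i 0) j.
    by apply: eq_bigr => j _; rewrite H0E.
  exact: (mxle_norm (hKM l' sl' Ml')).
have same_sign i j : (u0 + t 0) 0 i = (u0 + t 0) 0 j ->
    (\forall x \near F0, 0 <= complex.Re (cis hi * ((u0 + t x) 0 i - (u0 + t x) 0 j))) \/
    (\forall x \near F0, complex.Re (cis hi * ((u0 + t x) 0 i - (u0 + t x) 0 j)) <= 0).
  rewrite t00 addr0 => uij.
  have xE x : complex.Re (cis hi * ((u0 + t x) 0 i - (u0 + t x) 0 j)) =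
      x * complex.Re (cis hi * (t0 0 i - t0 0 j)).
    have -> : cis hi * ((u0 + t x) 0 i - (u0 + t x) 0 j) = x%:C * (cis hi * (t0 0 i - t0 0 j)).
      by rewrite /t /segment_point !mxE uij; ring.
    by case: (cis hi * _) => y z /=; rewrite mul0r subr0.
  have [h|/ltW h] := leP 0 (complex.Re (cis hi * (t0 0 i - t0 0 j))); [left|right];
    apply: filterS near01 => x /andP[/ltW x0 _]; rewrite xE.
    exact: mulr_ge0.
  exact: mulr_ge0_le0.
have distinct_ray i j : (u0 + t 0) 0 i != (u0 + t 0) 0 j ->
    complex.Re (cis hi * ((u0 + t 0) 0 i - (u0 + t 0) 0 j)) != 0.
  rewrite t00 addr0 => uij; apply/eqP => h; apply: httau; exists i, j; split=> //.
  (* cis hi is cis ttau up to sign, so a vanishing real part would contradict the admissibility of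
     ttau. *)
  have [r r2 hr] := cis_int_pi R k.
  have r0 : r != 0 by apply/eqP => r0; move: r2; rewrite r0 expr0n/= => /esym/eqP; rewrite oner_eq0.
  move: h; rewrite /hi cisD hr mulrAC mulrC.
  have -> : complex.Re (r%:C * (cis ttau * (u0 0 i - u0 0 j))) =
      r * complex.Re ((u0 0 i - u0 0 j) * cis ttau).
    by rewrite [cis ttau * _]mulrC; case: (_ * cis ttau) => y z /=; rewrite mul0r subr0.
  by move/eqP; rewrite mulf_eq0 (negbTE r0) => /eqP.
have Cm1 : Cm = 1%:M.
  apply: (connection_trivial (Ac := fun j x => Ac j (t x)) (H := H) (u := fun x => u0 + t x)
    (b := fun x => b (t x)) (A := fun x z => A z (t x)) hn hN0 _ limH _ limb _ tailA solY asymY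
    limY asymYr connect same_sign distinct_ray).
  - apply: filterS near01 => x /seg[_ [px nx]]; apply: hF; split=> // hc; apply: nx.
    by left.
  - by rewrite H0E.
  - by apply: mlim_at_right; rewrite t00.
have YE l' : outer_dom N0 l' -> Yc k c l' 0 = Yr k l'.
  by move=> ol'; rewrite connect// Cm1 mulmx1.
split; last exact: YE.
by rewrite /reduced_solution hG0_0 invmx1 mul1mx YE// YrG.
Unshelve. all: by end_near. Qed.
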